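(* Let $p,Q$ be real-valued measurable functions on the finite interval $\mathcal J=(a,b)$ with $1/p,\ Q/p,\ Q^2/p\in L_1(\mathcal J)$, and let $L_{\min}$ and, for operators $K$ on $\mathbb C^2$, $L_K$ be the operators on $L_2(\mathcal J,\mathbb C)$ defined in the context. Every $L_K$ with $K$ a contracting operator on $\mathbb C^2$ is a maximal dissipative extension of $L_{\min}$. Conversely, for any maximal dissipative extension $\widetilde L$ of $L_{\min}$ there exists a contracting operator $K$ on $\mathbb C^2$ such that $\widetilde L=L_K$. This correspondence between contracting operators $K$ on $\mathbb C^2$ and maximal dissipative extensions $\widetilde L$ of $L_{\min}$ is bijective.
   Context: Let $\mathcal J=(a,b)$ be a finite interval and $L_2=L_2(\mathcal J,\mathbb C)$; $p$ is finite and nonzero a.e. The formal expression $-(py')'+qy$ with $q=Q'$ (distributional derivative) is interpreted through the quasi-derivatives $$D^{[0]}y=y,\qquad D^{[1]}y=py'-Qy,\qquad D^{[2]}y=(D^{[1]}y)'+\frac Qp D^{[1]}y+\frac{Q^2}{p}y$$ as $l[y]:=-D^{[2]}y$. The maximal operator is $L_{\max}y=l[y]$ with $\operatorname{Dom}(L_{\max})=\{y\in L_2:\ y,D^{[1]}y\in AC([a,b],\mathbb C),\ D^{[2]}y\in L_2\}$; the minimal operator $L_{\min}$ is the restriction of $L_{\max}$ to $\{y\in\operatorname{Dom}(L_{\max}):\ D^{[k]}y(a)=D^{[k]}y(b)=0,\ k=0,1\}$. Define $\Gamma_1,\Gamma_2:\operatorname{Dom}(L_{\max})\to\mathbb C^2$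 by $$\Gamma_1y=(D^{[1]}y(a),-D^{[1]}y(b)),\qquad \Gamma_2y=(y(a),y(b)).$$ For a linear operator $K$ on $\mathbb C^2$, $L_K$ denotes the restriction of $L_{\max}$ to the set of $y\in\operatorname{Dom}(L_{\max})$ satisfying $$(K-I)\Gamma_1y+i(K+I)\Gamma_2y=0.$$ A contracting operator is one with $\|K\|\le1$ (with respect to the standard Hermitian norm on $\mathbb C^2$). A densely defined linear operator $L$ on a complex Hilbert space $\mathcal H$ is dissipative if $\operatorname{Im}(Lf,f)_{\mathcal H}\ge0$ for all $f\in\operatorname{Dom}(L)$ (inner product linear in the first argument), and maximal dissipative if, in addition, it has no nontrivial dissipative extensions on $\mathcal H$. *)

(* Defs.v *)
From HB Require Import structures.
From mathcomp Require Import all_boot all_order all_algebra.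
From mathcomp Require Import generic_quotient ring_quotient sesquilinear.
From mathcomp Require Import complex ring lra.
From mathcomp Require Import all_classical all_reals all_analysis.
From mathcomp Require Import measurable_realfun.

Set Implicit Arguments.
Unset Strict Implicit.
Unset Printing Implicit Defensive.

Import Order.TTheory GRing.Theory Num.Theory numFieldNormedType.Exports.

Local Open Scope classical_set_scope.
Local Open Scope quotient_scope.
Local Open Scope ring_scope.
Local Open Scope complex_scope.

Section SquareIntegrable.
Context {R : realType} (a b : R).
Local Notation C := R[i].
Local Notation J := `]a, b[%classic.
Local Notation mu := (@lebesgue_measure R : {measure set _ -> \bar R}).
Local Notation Re := (@complex.Re R).
Local Notation Im := (@complex.Im R).

(* [lebesgue_measure] lives on the Borel sigma-algebra: the elements of L_2 are
   Borel functions, and [represents] below compares classes with arbitrary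
   functions almost everywhere, so Lebesgue measurable functions are covered. *)
Definition cmeasurable (f : R -> C) : Prop :=
  measurable_fun J (Re \o f) /\ measurable_fun J (Im \o f).

Definition square_integrable (f : R -> C) : Prop :=
  cmeasurable f /\
  mu.-integrable J (EFin \o (fun x => Re (f x) ^+ 2 + Im (f x) ^+ 2)).

Definition L2pred : {pred (R -> C)} := [pred f | `[< square_integrable f >]].

Let mJ : measurable J. Proof. exact: measurable_itv. Qed.

Lemma cReD (z w : C) : Re (z + w) = Re z + Re w.
Proof. by case: z; case: w. Qed.
Lemma cImD (z w : C) : Im (z + w) = Im z + Im w.
Proof. by case: z; case: w. Qed.
Lemma cReM (z w : C) : Re (z * w) = Re z * Re w - Im z * Im w.
Proof. by case: z; case: w. Qed.
Lemma cImM (z w : C) : Im (z * w) = Re z * Im w + Im z * Re w.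
Proof. by case: z; case: w. Qed.
Lemma cReJ (z : C) : Re z^* = Re z. Proof. by case: z. Qed.
Lemma cImJ (z : C) : Im z^* = - Im z. Proof. by case: z. Qed.

Lemma cmeasurable_lin (c : C) (f g : R -> C) :
  cmeasurable f -> cmeasurable g -> cmeasurable (c *: f + g).
Proof.
move=> [rf jf] [rg jg]; split.
- rewrite (_ : _ \o _ =
    (fun x => (Re c * Re (f x) - Im c * Im (f x)) + Re (g x))); last first.
    by apply/funext => x /=; rewrite cReD cReM.
  apply: measurable_funD => //.
  by apply: measurable_funB; apply: measurable_funM.
- rewrite (_ : _ \o _ =
    (fun x => (Re c * Im (f x) + Im c * Re (f x)) + Im (g x))); last first.
    by apply/funext => x /=; rewrite cImD cImM.
  apply: measurable_funD => //.
  by apply: measurable_funD; apply: measurable_funM.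
Qed.

Lemma cmeasurable_sqr (f : R -> C) : cmeasurable f ->
  measurable_fun J (fun x => Re (f x) ^+ 2 + Im (f x) ^+ 2).
Proof.
move=> [rf jf]; apply: measurable_funD.
- by apply: (@measurable_funX _ _ _ _ _ 2%N).
- by apply: (@measurable_funX _ _ _ _ _ 2%N).
Qed.

Lemma square_integrable_lin (c : C) (f g : R -> C) :
  square_integrable f -> square_integrable g -> square_integrable (c *: f + g).
Proof.
move=> [mf sf] [mg sg]; have mh := cmeasurable_lin c mf mg; split=> //.
have mh2 := cmeasurable_sqr mh.
pose K := 2 * (Re c ^+ 2 + Im c ^+ 2).
pose F x := Re (f x) ^+ 2 + Im (f x) ^+ 2.
pose G x := Re (g x) ^+ 2 + Im (g x) ^+ 2.
apply: (@le_integrable _ _ _ mu _ mJ (EFin \o _)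
  (EFin \o (fun x => K * F x + 2 * G x))).
- exact/measurable_EFinP.
- move=> x _; rewrite /= lee_fin cReD cImD cReM cImM /F /G.
  set u := Re (f x); set v := Im (f x); set s := Re (g x); set t := Im (g x).
  rewrite ger0_norm ?addr_ge0 ?sqr_ge0// ger0_norm; last first.
    by rewrite addr_ge0// mulr_ge0 ?mulr_ge0 ?addr_ge0 ?sqr_ge0.
  rewrite -subr_ge0 /K.
  have -> : 2 * (Re c ^+ 2 + Im c ^+ 2) * (u ^+ 2 + v ^+ 2)
    + 2 * (s ^+ 2 + t ^+ 2) - ((Re c * u - Im c * v + s) ^+ 2
    + (Re c * v + Im c * u + t) ^+ 2) = (Re c * u - Im c * v - s) ^+ 2
    + (Re c * v + Im c * u - t) ^+ 2 by ring.
  by rewrite addr_ge0 ?sqr_ge0.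
- rewrite (_ : _ \o _ =
    (fun x => K%:E * (EFin \o F) x) \+ (fun x => 2%:E * (EFin \o G) x))%E//.
  by apply: (@integrableD _ _ _ mu) => //; apply: (@integrableZl _ _ _ mu).
Qed.

Lemma square_integrable0 : square_integrable 0.
Proof.
split; first by split; exact: measurable_cst.
rewrite (_ : _ \o _ = cst 0%E); first exact: integrable0.
by apply/funext => x /=; rewrite expr0n/= addr0.
Qed.

Lemma L2pred_submod : submod_closed L2pred.
Proof.
split; first by apply/asboolP; exact: square_integrable0.
move=> c f g /asboolP sf /asboolP sg; apply/asboolP.
exact: square_integrable_lin.
Qed.

HB.instance Definition _ := GRing.isSubmodClosed.Build C (R -> C) L2pred
  L2pred_submod.

Record L2fun := MkL2fun { L2val :> R -> C ; L2valP : L2val \in L2pred }.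
HB.instance Definition _ := [isSub for L2val].
HB.instance Definition _ := [Choice of L2fun by <:].
HB.instance Definition _ := [SubChoice_isSubLmodule of L2fun by <:].

Definition ae_eqJ (f g : R -> C) : Prop := {ae mu, forall x, J x -> f x = g x}.

Lemma ae_eqJ2 (f1 g1 f2 g2 f3 g3 : R -> C) :
  (forall x, f1 x = g1 x -> f2 x = g2 x -> f3 x = g3 x) ->
  ae_eqJ f1 g1 -> ae_eqJ f2 g2 -> ae_eqJ f3 g3.
Proof.
move=> H; have F := ae_filter_ringOfSetsType mu.
by apply: (@filterS2 _ _ F) => x H1 H2 Jx; apply: H; [exact: H1|exact: H2].
Qed.

Definition L2null : {pred L2fun} := [pred f : L2fun | `[< ae_eqJ f 0 >]].

Lemma L2null_submod : submod_closed L2null.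
Proof.
split.
  by apply/asboolP; rewrite /ae_eqJ; apply: nearW => x _.
move=> c f g /asboolP f0 /asboolP g0; apply/asboolP.
apply: ae_eqJ2 f0 g0 => x fx gx.
by rewrite -[LHS]/(c * L2val f x + L2val g x) fx// gx// mulr0 addr0.
Qed.

HB.instance Definition _ := GRing.isSubmodClosed.Build C L2fun L2null
  L2null_submod.

(* L_2((a, b), C): square integrable functions modulo equality almost everywhere
   on (a, b); values outside (a, b) are irrelevant. *)
Definition L2 : Type := Quotient.quot L2null.
HB.instance Definition _ := GRing.Zmodule.on L2.
HB.instance Definition _ := EqQuotient.on L2.

Implicit Types (f g h : L2fun) (u v w : L2) (c : C).

Lemma L2_eqP f g : reflect (ae_eqJ f g) (f == g %[mod L2]).
Proof.
rewrite piE Quotient.equivE; apply: (iffP (asboolP _)) => fg_.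
- apply: ae_eqJ2 (fg_) (fg_) => x + _.
  by rewrite -[LHS]/(L2val f x - L2val g x) => /subr0_eq.
- apply: (ae_eqJ2 _ fg_ fg_) => x fgx _.
  by rewrite -[LHS]/(L2val f x - L2val g x) fgx subrr.
Qed.

Definition L2scale c : L2 -> L2 := lift_op1 L2 ( *:%R c).

Lemma pi_L2scale c f : \pi_L2 (c *: f) = L2scale c (\pi_L2 f).
Proof.
unlock L2scale; apply/eqP/L2_eqP; have ff : ae_eqJ f (repr (\pi_L2 f)).
  by apply/L2_eqP; rewrite reprK.
apply: ae_eqJ2 (ff) (ff) => x fx _.
by rewrite -[LHS]/(c * L2val f x) fx.
Qed.

Lemma L2scaleA c d u : L2scale c (L2scale d u) = L2scale (c * d) u.
Proof. by rewrite -[u]reprK -!pi_L2scale scalerA. Qed.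
Lemma L2scale1 : left_id 1 L2scale.
Proof. by move=> u; rewrite -[u]reprK -pi_L2scale scale1r. Qed.
Lemma L2scaleDr : right_distributive L2scale +%R.
Proof.
move=> c u v; rewrite -[u]reprK -[v]reprK.
by rewrite -[_ + _](raddfD \pi_L2) -!pi_L2scale scalerDr (raddfD \pi_L2).
Qed.
Lemma L2scaleDl u : {morph L2scale^~ u : c d / c + d}.
Proof.
by move=> c d; rewrite -[u]reprK -!pi_L2scale scalerDl (raddfD \pi_L2).
Qed.

HB.instance Definition _ := GRing.Zmodule_isLmodule.Build C L2
  L2scaleA L2scale1 L2scaleDr L2scaleDl.

Definition cintegrable (F : R -> C) : Prop :=
  mu.-integrable J (EFin \o (Re \o F)) /\ mu.-integrable J (EFin \o (Im \o F)).

Definition cintegral (F : R -> C) : C :=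
  (\int[mu]_(x in J) Re (F x)) +i* (\int[mu]_(x in J) Im (F x)).

Definition fdot (F G : R -> C) : C := cintegral (fun x => F x * (G x)^*).

Lemma cintegral_lin c (F G : R -> C) : cintegrable F -> cintegrable G ->
  cintegral (fun x => c * F x + G x) = c * cintegral F + cintegral G.
Proof.
move=> [rF jF] [rG jG].
have iZ k (h : R -> R) : mu.-integrable J (EFin \o h) ->
    mu.-integrable J (EFin \o (fun x => k * h x)).
  move=> ih; rewrite (_ : _ \o _ = (fun x => k%:E * (EFin \o h) x)%E)//.
  exact: (@integrableZl _ _ _ mu).
have iD (h k : R -> R) : mu.-integrable J (EFin \o h) ->
    mu.-integrable J (EFin \o k) ->
    mu.-integrable J (EFin \o (fun x => h x + k x)).
  move=> ih ik; rewrite (_ : _ \o _ = (EFin \o h) \+ (EFin \o k))%E//.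
  exact: (@integrableD _ _ _ mu).
rewrite /cintegral; apply/eqP; rewrite eq_complex.
rewrite cReD cReM cImD cImM /=; apply/andP; split; apply/eqP.
- transitivity (\int[mu]_(x in J)
    ((Re c * Re (F x) + - Im c * Im (F x)) + Re (G x))).
    by apply: eq_Rintegral => x _; rewrite cReD cReM mulNr.
  rewrite (RintegralD (mu := mu)) ?(RintegralD (mu := mu)) ?RintegralZl ?mulNr//.
  - exact: iZ.
  - exact: iZ.
  - by apply: iD; exact: iZ.
- transitivity (\int[mu]_(x in J)
    ((Re c * Im (F x) + Im c * Re (F x)) + Im (G x))).
    by apply: eq_Rintegral => x _; rewrite cImD cImM.
  rewrite (RintegralD (mu := mu)) ?(RintegralD (mu := mu)) ?RintegralZl//.
  - exact: iZ.
  - exact: iZ.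
  - by apply: iD; exact: iZ.
Qed.

Lemma cintegrable_dot F G : square_integrable F -> square_integrable G ->
  cintegrable (fun x => F x * (G x)^*).
Proof.
move=> [[rF jF] sF] [[rG jG] sG].
pose U x := Re (F x) ^+ 2 + Im (F x) ^+ 2.
pose V x := Re (G x) ^+ 2 + Im (G x) ^+ 2.
have sFG : mu.-integrable J (EFin \o (fun x => U x + V x)).
  rewrite (_ : _ \o _ = (EFin \o U) \+ (EFin \o V))%E//.
  exact: (@integrableD _ _ _ mu).
split; apply: (@le_integrable _ _ _ mu _ mJ (EFin \o _) _ _ _ sFG).
- apply/measurable_EFinP; rewrite (_ : _ \o _ =
    (fun x => Re (F x) * Re (G x) + Im (F x) * Im (G x))); last first.
    by apply/funext => x /=; rewrite cReM cReJ cImJ mulrN opprK.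
  by apply: measurable_funD; apply: measurable_funM.
- move=> x _; rewrite /= lee_fin cReM cReJ cImJ mulrN opprK /U /V.
  set u := Re (F x); set v := Im (F x); set s := Re (G x); set t := Im (G x).
  rewrite [leRHS]ger0_norm ?addr_ge0 ?sqr_ge0// ler_norml.
  have h1 := sqr_ge0 (u - s); have h2 := sqr_ge0 (v - t).
  have h3 := sqr_ge0 (u + s); have h4 := sqr_ge0 (v + t).
  by apply/andP; split; nra.
- apply/measurable_EFinP; rewrite (_ : _ \o _ =
    (fun x => Im (F x) * Re (G x) - Re (F x) * Im (G x))); last first.
    by apply/funext => x /=; rewrite cImM cReJ cImJ mulrN addrC.
  by apply: measurable_funB; apply: measurable_funM.
- move=> x _; rewrite /= lee_fin cImM cReJ cImJ mulrN /U /V.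
  set u := Re (F x); set v := Im (F x); set s := Re (G x); set t := Im (G x).
  rewrite [leRHS]ger0_norm ?addr_ge0 ?sqr_ge0// ler_norml.
  have h1 := sqr_ge0 (u - t); have h2 := sqr_ge0 (v - s).
  have h3 := sqr_ge0 (u + t); have h4 := sqr_ge0 (v + s).
  by apply/andP; split; nra.
Qed.

Lemma fdot_lin c F G H : square_integrable F -> square_integrable G ->
  square_integrable H -> fdot (c *: F + G) H = c * fdot F H + fdot G H.
Proof.
move=> sF sG sH; rewrite /fdot -cintegral_lin; try exact: cintegrable_dot.
congr cintegral; apply/funext => x.
by rewrite -[(c *: F + G) x]/(c * F x + G x) mulrDl mulrA.
Qed.

Lemma fdotC F G : square_integrable F -> square_integrable G ->
  fdot F G = (fdot G F)^*.
Proof.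
move=> sF sG; rewrite /fdot /cintegral /=; congr (_ +i* _).
  by apply: eq_Rintegral => x _; rewrite !cReM !cReJ !cImJ; ring.
have [_ i1] := cintegrable_dot sG sF.
rewrite -mulN1r -(RintegralZl (mu := mu))//.
by apply: eq_Rintegral => x _; rewrite !cImM !cReJ !cImJ; ring.
Qed.

Lemma fdot_ae F G F' G' : square_integrable F -> square_integrable G ->
  square_integrable F' -> square_integrable G' ->
  ae_eqJ F F' -> ae_eqJ G G' -> fdot F G = fdot F' G'.
Proof.
move=> sF sG sF' sG' FF' GG'.
have [i1 i2] := cintegrable_dot sF sG; have [i3 i4] := cintegrable_dot sF' sG'.
have FG : ae_eqJ (fun x => F x * (G x)^*) (fun x => F' x * (G' x)^*).
  by apply: ae_eqJ2 FF' GG' => x -> ->.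
have Fil := ae_filter_ringOfSetsType mu.
rewrite /fdot /cintegral /Rintegral; congr (fine _ +i* fine _).
- apply: (@ae_eq_integral _ _ _ mu) => //.
  + exact: measurable_int i1.
  + exact: measurable_int i3.
  + by apply: (@filterS _ _ Fil _ _ _ FG) => x + Jx => /= ->.
- apply: (@ae_eq_integral _ _ _ mu) => //.
  + exact: measurable_int i2.
  + exact: measurable_int i4.
  + by apply: (@filterS _ _ Fil _ _ _ FG) => x + Jx => /= ->.
Qed.

Lemma fdot_self F : square_integrable F ->
  fdot F F = (\int[mu]_(x in J) (Re (F x) ^+ 2 + Im (F x) ^+ 2))%:C.
Proof.
move=> sF; rewrite /fdot /cintegral /real_complex_def; congr (_ +i* _).
  by apply: eq_Rintegral => x _; rewrite !cReM !cReJ !cImJ; ring.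
rewrite (_ : (fun x => _) = cst 0) ?Rintegral_cst ?mul0r//.
by apply/funext => x; rewrite cImM cReJ cImJ mulrN addrC mulrC subrr.
Qed.

Lemma L2fun_sqint f : square_integrable f.
Proof. by have /asboolP := L2valP f. Qed.

(* Linear in the first argument. *)
Definition L2dot u v : C := fdot (repr u) (repr v).

Lemma pi_L2dot f g : L2dot (\pi_L2 f) (\pi_L2 g) = fdot f g.
Proof.
apply: fdot_ae; try exact: L2fun_sqint.
- by apply/L2_eqP; rewrite reprK.
- by apply/L2_eqP; rewrite reprK.
Qed.

Lemma L2dotC u v : L2dot u v = (-1) ^+ false * (L2dot v u)^*.
Proof. by rewrite expr0 mul1r; apply: fdotC; exact: L2fun_sqint. Qed.

Lemma L2dot_linl v c u w : L2dot (c *: u + w) v = c * L2dot u v + L2dot w v.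
Proof.
rewrite -[u]reprK -[v]reprK -[w]reprK -[_ *: _]pi_L2scale.
rewrite -[_ + \pi_L2 _](raddfD \pi_L2) !pi_L2dot.
by apply: fdot_lin; exact: L2fun_sqint.
Qed.

Lemma L2dot_bilinear :
  bilinear_for ( *%R : GRing.Scale.law _ _) (@conjc R \; *%R) L2dot.
Proof.
split=> [v c u w|v c u w]; first exact: L2dot_linl.
rewrite 3!(L2dotC v) !expr0 !mul1r L2dot_linl.
by rewrite (rmorphD (@conjc R)) (rmorphM (@conjc R)).
Qed.

HB.instance Definition _ := bilinear_isBilinear.Build C L2 L2 C
  *%R (@conjc R \; *%R) L2dot L2dot_bilinear.
HB.instance Definition _ := isHermitianSesquilinear.Build C L2 false (@conjc R)
  L2dot L2dotC.

Lemma L2dot_gt0 u : u != 0 -> 0 < L2dot u u.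
Proof.
rewrite -[u]reprK; move: (repr u) => f f0; rewrite pi_L2dot.
have sf := L2fun_sqint f; rewrite fdot_self// ltcR lt_neqAle.
apply/andP; split; last first.
  by apply: Rintegral_ge0 => x _; rewrite addr_ge0 ?sqr_ge0.
apply/eqP => i0; move/negP: f0; apply.
rewrite -(raddf0 \pi_L2); apply/L2_eqP.
have [_ intf] := sf.
pose U x := Re (f x) ^+ 2 + Im (f x) ^+ 2.
have mU : measurable_fun J (EFin \o U) := measurable_int _ intf.
have U0 : (\int[mu]_(x in J) `|(EFin \o U) x| = 0)%E.
  have finU : (\int[mu]_(x in J) (U x)%:E)%E \is a fin_num.
    exact: (@integrable_fin_num _ _ _ mu).
  transitivity (\int[mu]_(x in J) (U x)%:E)%E.
    by apply: eq_integral => x _ /=; rewrite ger0_norm ?addr_ge0 ?sqr_ge0.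
  by rewrite -(fineK finU) -[fine _]/(Rintegral mu J U) -i0.
have /(ae_eq_integral_abs mu mJ mU) := U0.
have Fil := ae_filter_ringOfSetsType mu.
apply: (@filterS _ _ Fil) => x + Jx => /(_ Jx) /= [] /eqP.
rewrite paddr_eq0 ?sqr_ge0// !sqrf_eq0 => /andP[/eqP r0 /eqP j0].
rewrite -[RHS]/(0 : C); apply/eqP; rewrite eq_complex.
by rewrite -[L2val f x]/(f x) r0 j0 !eqxx.
Qed.

HB.instance Definition _ := isDotProduct.Build C L2 L2dot L2dot_gt0.

End SquareIntegrable.

(* Operators are given by their graphs, so extension is inclusion of sets and
   two operators are equal iff they have the same domain and the same values. *)
Section Operators.
Context {R : realType} {H : lmodType R[i]}.
Variable dot : {dot H for (@conjc R)}.
Implicit Types A B : set (H * H).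

Definition linear_operator A : Prop :=
  [/\ A 0,
      forall (c : R[i]) u v, A u -> A v -> A (c *: u + v) &
      forall f g h, A (f, g) -> A (f, h) -> g = h].

Definition domain A : set H := [set f | exists g, A (f, g)].

Definition hnorm (f : H) : R := Num.sqrt (complex.Re (dot f f)).

Definition densely_defined A : Prop :=
  forall (f : H) (e : R), 0 < e -> exists2 g, domain A g & hnorm (f - g) < e.

Definition dissipative A : Prop :=
  [/\ linear_operator A, densely_defined A &
      forall f g, A (f, g) -> 0 <= complex.Im (dot g f)].

Definition maximal_dissipative A : Prop :=
  dissipative A /\ forall B, dissipative B -> A `<=` B -> B = A.

Definition maximal_dissipative_extension A B : Prop :=
  A `<=` B /\ maximal_dissipative B.

End Operators.

Section Contractions.
Context {R : realType}.
Local Notation C := R[i].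

Definition hermitian_norm n (v : 'cV[C]_n) : R :=
  Num.sqrt (\sum_i ComplexField.Normc.normc (v i 0) ^+ 2).

(* The set is bounded above, so that [sup] is a genuine supremum. *)
Definition operator_norm n (K : 'M[C]_n) : R :=
  sup [set hermitian_norm (K *m v) | v in [set v | hermitian_norm v <= 1]].

Definition contracting n (K : 'M[C]_n) : Prop := operator_norm K <= 1.

End Contractions.

Section SturmLiouville.
Context {R : realType}.
Local Notation C := R[i].
Variables (a b : R) (p Q : R -> R).
Implicit Types y u : R -> C.
Local Notation J := `]a, b[%classic.
Local Notation mu := (@lebesgue_measure R).

Definition absolutely_continuous y : Prop :=
  forall e : R, 0 < e -> exists2 d : R, 0 < d &
    forall (n : nat) (s t : 'I_n -> R),
      (forall i, [/\ a <= s i, s i <= t i & t i <= b]) ->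
      trivIset setT (fun i => `]s i, t i[%classic) ->
      \sum_i (t i - s i) < d ->
      \sum_i ComplexField.Normc.normc (y (t i) - y (s i)) < e.

(* [derive1] is total; the functions differentiated below are absolutely
   continuous, hence differentiable almost everywhere in the interval. *)
Definition cderive y (x : R) : C :=
  derive1 (@complex.Re R \o y) x +i* derive1 (@complex.Im R \o y) x.

Definition qderiv1 y (x : R) : C :=
  (p x)%:C * cderive y x - (Q x)%:C * y x.

(* [u] is the absolutely continuous representative of the first
   quasi-derivative of [y]; it is unique on [a, b] when a < b. *)
Definition qderiv1_rep y u : Prop :=
  absolutely_continuous u /\ ae_eqJ a b u (qderiv1 y).

Definition qderiv2 y u (x : R) : C :=
  cderive u x + (Q x / p x)%:C * u x + (Q x ^+ 2 / p x)%:C * y x.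

Definition represents (f : L2 a b) y : Prop := ae_eqJ a b (repr f) y.

(* The maximal operator restricted by a condition [bc] on the pair of [y] and
   its first quasi-derivative. *)
Definition L_restr (bc : (R -> C) -> (R -> C) -> Prop) :
    set (L2 a b * L2 a b) :=
  [set fg | exists y u,
    [/\ absolutely_continuous y, qderiv1_rep y u,
        represents fg.1 y, represents fg.2 (\- qderiv2 y u) & bc y u]].

Definition L_max := L_restr (fun _ _ => True).

Definition L_min := L_restr (fun y u =>
  [/\ y a = 0, y b = 0, u a = 0 & u b = 0]).

Definition Gamma1 (u : R -> C) : 'cV[C]_2 :=
  \col_(i < 2) if i == 0 then u a else - u b.

Definition Gamma2 (y : R -> C) : 'cV[C]_2 :=
  \col_(i < 2) if i == 0 then y a else y b.

Definition L_K (K : 'M[C]_2) := L_restr (fun y u =>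
  (K - 1%:M) *m Gamma1 u + 'i *: ((K + 1%:M) *m Gamma2 y) = 0).

(* Lebesgue (not only Borel) measurable and integrable real functions. *)
Definition Lebesgue_measurable (f : R -> R) : Prop :=
  @measurable_fun _ _ (caratheodory_type (@wlength R idfun)^*%mu)
    (measurableTypeR R) J f.

Definition Lebesgue_integrable (f : R -> R) : Prop :=
  completed_lebesgue_measure.-integrable J (EFin \o f).

End SturmLiouville.

Arguments L_restr {R} a b p Q bc _.
Arguments L_max {R} a b p Q _.
Arguments L_min {R} a b p Q _.
Arguments L_K {R} a b p Q K _.

(* Main.v *)
(* By Green's identity, [4 Im (L y, y) = |x| ^ 2 - |z| ^ 2] on the domain of the
   maximal operator, where [x = Gamma1 y + i Gamma2 y] and
   [z = Gamma1 y - i Gamma2 y], and the boundary condition of [L_K] reads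
   [K x = z]. A dissipative extension of the symmetric operator [L_min] is a
   restriction of its adjoint, which is [L_max]: the range of [L_min] and
   [ker L_max] are orthogonal complements, because the inhomogeneous system can
   be solved with zero data at [a]. Since [(x, z)] takes all values, maximal
   dissipative extensions correspond to maximal linear relations between [x] and
   [z] with [|z| <= |x|], and these are the graphs of the contractions of C^2.
   The system is solved for merely integrable coefficients, so it is read in
   integral form: an absolutely continuous function is an integral of its
   derivative (Radon-Nikodym for the Stieltjes measure of its variation), and
   that derivative exists almost everywhere by Lebesgue differentiation. *)

Require Import Defs.
From HB Require Import structures.
From mathcomp Require Import all_boot all_order all_algebra.
From mathcomp Require Import complex.
From mathcomp Require Import ring lra.
From mathcomp Require Import all_classical all_reals all_analysis.
From mathcomp Require Import measurable_realfun.

Set Implicit Arguments.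
Unset Strict Implicit.
Unset Printing Implicit Defensive.

Import Order.TTheory GRing.Theory Num.Theory numFieldNormedType.Exports.

Local Open Scope classical_set_scope.
Local Open Scope ring_scope.
Local Open Scope complex_scope.

(** * Absolutely continuous functions are primitives *)

(** The coefficients are only Lebesgue measurable, while the integrals are taken over Borel sets.
    Hence [1 / p], [Q / p] and [Q ^ 2 / p] are replaced by Borel functions [r], [s], [t] equal to
    them almost everywhere, and [L_restrE] is the only bridge back to [p] and [Q]. Past it, all that
    counts is that [r], [s], [t] are real and integrable and that [r] is nonzero almost everywhere.
    With such rough coefficients smooth test functions need not lie in the minimal domain, so its
    density is not shown by approximation: its orthogonal complement is shown to be trivial, and
    completeness of L_2 turns this into density. The operator theory is separated from the analysis.
    It knows the maximal operator only as a relation between a pair [(f, g)] and four boundary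
    values, given by linearity, Green's identity, uniqueness and solvability from arbitrary data at
    [a]. *)

Section RealAC.
Context {R : realType}.
Local Notation Re := (@complex.Re R).
Local Notation Im := (@complex.Im R).
Implicit Types (a b : R) (f : R -> R) (l : seq (R * R)).

(** End points are compared instead of intersecting open intervals, and families are lists instead
    of indexed families: such families can be split, concatenated and refined by induction. *)
Definition nonoverlapping (x y : R * R) := (x.2 <= y.1) || (y.2 <= x.1).

Definition subitv a b (x : R * R) := [&& a <= x.1, x.1 <= x.2 & x.2 <= b].

Definition family_length l : R := \sum_(x <- l) (x.2 - x.1).

Definition family_variation f l : R := \sum_(x <- l) `|f x.2 - f x.1|.

Definition real_ac a b f := forall e, 0 < e -> exists2 d, 0 < d &
  forall l, all (subitv a b) l -> pairwise nonoverlapping l ->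
    family_length l < d -> family_variation f l < e.

Lemma nonoverlappingC : symmetric nonoverlapping.
Proof. by move=> x y; rewrite /nonoverlapping orbC. Qed.

Lemma normc_ge_Re (z : R[i]) : `|Re z| <= ComplexField.Normc.normc z.
Proof.
case: z => x y /=; rewrite -[leLHS]ger0_norm// -sqrtr_sqr ler_wsqrtr//.
by rewrite real_normK ?num_real// lerDl sqr_ge0.
Qed.

Lemma normc_ge_Im (z : R[i]) : `|Im z| <= ComplexField.Normc.normc z.
Proof.
case: z => x y /=; rewrite -[leLHS]ger0_norm// -sqrtr_sqr ler_wsqrtr//.
by rewrite real_normK ?num_real// lerDr sqr_ge0.
Qed.

Lemma normc_le_ReIm (z : R[i]) :
  ComplexField.Normc.normc z <= `|Re z| + `|Im z|.
Proof.
case: z => x y /=; rewrite -[leRHS]ger0_norm ?addr_ge0//.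
rewrite -sqrtr_sqr ler_wsqrtr//.
have -> : (`|x| + `|y|) ^+ 2 = x ^+ 2 + y ^+ 2 + 2 * (`|x| * `|y|).
  by rewrite sqrrD !real_normK ?num_real//; ring.
by rewrite lerDl !mulr_ge0.
Qed.

Lemma absolutely_continuous_real_ac a b (y : R -> R[i]) :
  absolutely_continuous a b y ->
  forall g, (forall z w, `|g z - g w| <= ComplexField.Normc.normc (z - w)) ->
  real_ac a b (g \o y).
Proof.
move=> acy g gle e e0; have [d d0 H] := acy e e0; exists d => // l la lp ld.
pose s (i : 'I_(size l)) := (nth (0, 0) l i).1.
pose t (i : 'I_(size l)) := (nth (0, 0) l i).2.
apply: le_lt_trans (H (size l) s t _ _ _).
- rewrite /family_variation (big_nth (0, 0)) big_mkord.
  by apply: ler_sum => i _; exact: gle.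
- move=> i; have /allP/(_ (nth (0, 0) l i)) := la.
  by rewrite mem_nth// => /(_ isT)/and3P[].
- have ij (i j : 'I_(size l)) : (i < j)%N -> `]s i, t i[ `&` `]s j, t j[ = set0.
    move=> ij; apply/seteqP; split => // x [] /=; rewrite !in_itv/=.
    move/pairwiseP: lp => /(_ (0, 0)) /(_ i j) /=; rewrite !inE.
    move=> /(_ (ltn_ord i) (ltn_ord j) ij).
    rewrite /nonoverlapping -/(t i) -/(s i) -/(t j) -/(s j).
    move=> /orP[] h /andP[h1 h2] /andP[h3 h4].
    + by have := lt_trans (lt_le_trans h2 h) h3; rewrite ltxx.
    + by have := lt_trans (lt_le_trans h4 h) h1; rewrite ltxx.
  apply/trivIsetP => i j _ _ neq.
  have := neq; rewrite neq_lt => /orP[] h; first exact: ij.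
  by rewrite setIC ij.
- move: ld; rewrite /family_length (big_nth (0, 0)) big_mkord.
  exact.
Qed.

Lemma absolutely_continuous_Re a b (y : R -> R[i]) :
  absolutely_continuous a b y -> real_ac a b (Re \o y).
Proof.
move=> /absolutely_continuous_real_ac; apply => z w.
by rewrite (le_trans _ (normc_ge_Re _))// raddfB.
Qed.

Lemma absolutely_continuous_Im a b (y : R -> R[i]) :
  absolutely_continuous a b y -> real_ac a b (Im \o y).
Proof.
move=> /absolutely_continuous_real_ac; apply => z w.
by rewrite (le_trans _ (normc_ge_Im _))// raddfB.
Qed.

Lemma real_ac_absolutely_continuous a b (y : R -> R[i]) :
  real_ac a b (Re \o y) -> real_ac a b (Im \o y) -> absolutely_continuous a b y.
Proof.
move=> ry iy e e0; have e20 : 0 < e / 2 by rewrite divr_gt0.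
have [d1 d10 H1] := ry _ e20; have [d2 d20 H2] := iy _ e20.
exists (Num.min d1 d2); first by rewrite lt_min d10.
(* An empty open interval is disjoint from every set, yet its end points may lie inside another
   interval, which [nonoverlapping] forbids. Such intervals contribute 0 to both sums and are
   dropped. *)
move=> n s t st tr; pose l := [seq (s i, t i) | i <- enum 'I_n & s i < t i].
have big_l (F : R * R -> R) : (forall x, F (x, x) = 0) ->
    \sum_(x <- l) F x = \sum_i F (s i, t i).
  move=> F0; rewrite big_map big_filter big_enum_cond/=.
  rewrite [RHS](bigID (fun i => s i < t i))/= [X in _ + X]big1 ?addr0// => i.
  rewrite -leNgt => ts; have [_ st_ _] := st i.
  by rewrite (_ : t i = s i) ?F0//; apply/eqP; rewrite eq_le ts st_.
have la : all (subitv a b) l.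
  apply/allP => x /mapP[i _ ->]; have [h1 h2 h3] := st i.
  by rewrite /subitv /= h1 h2 h3.
have lp : pairwise nonoverlapping l.
  have : uniq [seq i <- enum 'I_n | s i < t i] by rewrite filter_uniq// enum_uniq.
  have : all (fun i => s i < t i) [seq i <- enum 'I_n | s i < t i].
    exact: filter_all.
  rewrite /l; elim: [seq i <- _ | _] => //= i r IH /andP[si sr] /andP[ir ur].
  rewrite IH// andbT; apply/allP => x /mapP[j jr ->]; rewrite /nonoverlapping /=.
  have /allP/(_ _ jr) sj := sr.
  rewrite leNgt (leNgt (t j)) -negb_and; apply/negP => /andP[h1 h2].
  have ij : i != j by apply: contraNneq ir => ->.
  move/trivIsetP: tr => /(_ i j I I ij).
  (* If neither interval ends before the other begins, the midpoint between the larger left end and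
     the smaller right end lies in both. *)
  apply/eqP/set0P; pose m := Num.max (s i) (s j); pose M := Num.min (t i) (t j).
  have mM : m < M by rewrite /m /M lt_min !gt_max si sj h1 h2.
  have [mm1 mm2] : m < (m + M) / 2 /\ (m + M) / 2 < M by split; lra.
  exists ((m + M) / 2); move: mm1 mm2; rewrite /m /M gt_max lt_min.
  rewrite -/m -/M => /andP[h3 h4] /andP[h5 h6].
  by split; rewrite /= in_itv/= ?h3 ?h4 ?h5 ?h6.
rewrite lt_min => /andP[ld1 ld2].
have lenE : family_length l = \sum_i (t i - s i).
  by rewrite /family_length big_l// => x; rewrite subrr.
apply: (@le_lt_trans _ _ (family_variation (Re \o y) l +
    family_variation (Im \o y) l)).
  rewrite /family_variation !big_l/=; try by move=> x; rewrite subrr normr0.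
  rewrite -big_split/=; apply: ler_sum => i _.
  by apply: le_trans (normc_le_ReIm _) _; rewrite !raddfB.
rewrite [e]splitr ltrD//; first by apply: H1 => //; rewrite lenE.
by apply: H2 => //; rewrite lenE.
Qed.

End RealAC.

(** * Total variation of an absolutely continuous function and its Jordan decomposition *)

Section TotalVariationAC.
Context {R : realType}.
Implicit Types (a b : R) (f : R -> R) (s : seq R) (l : seq (R * R)).
Local Notation TV := total_variation.

Definition pieces a s := [seq (x.2, x.1) | x <- zip s (a :: s)].

Lemma piecesP a b s : itv_partition a b s ->
  [/\ all (subitv a b) (pieces a s), pairwise nonoverlapping (pieces a s),
      family_length (pieces a s) = b - a &
      forall f, family_variation f (pieces a s) = variation a b f s].
Proof.
move=> abs; split; last first.
- by move=> f; rewrite (variation_zip _ abs) /family_variation big_map.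
- elim: s a abs => [a /itv_partition_nil <-|c s IH a abs].
    by rewrite /family_length big_nil subrr.
  rewrite /family_length /pieces/= big_cons/=.
  have := IH _ (itv_partition_cons abs); rewrite /family_length /pieces => ->.
  by rewrite addrC subrKA.
- elim: s a abs => [//|c s IH a abs] /=.
  have cbs := itv_partition_cons abs.
  rewrite -/(pieces c s) (IH _ cbs) andbT.
  have : all (subitv c b) (pieces c s).
    elim: s c {abs IH} cbs => //= d s IH c cbs.
    have [/= /andP[cd _] _] := cbs; have dbs := itv_partition_cons cbs.
    rewrite /subitv/= lexx (ltW cd) (itv_partition_le dbs)/= -/(pieces d s).
    apply/allP => x /(allP (IH _ dbs)) /and3P[h1 h2 h3].
    by rewrite (le_trans (ltW cd) h1) h2 h3.
  by apply: sub_all => x /and3P[cx _ _]; rewrite /nonoverlapping /= cx.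
- elim: s a abs => //= d s IH c cbs.
  have [/= /andP[cd _] _] := cbs; have dbs := itv_partition_cons cbs.
  rewrite /subitv/= lexx (ltW cd) (itv_partition_le dbs)/= -/(pieces d s).
  apply/allP => x /(allP (IH _ dbs)) /and3P[h1 h2 h3].
  by rewrite /subitv (le_trans (ltW cd) h1) h2 h3.
Qed.

(* The intervals of [k] are replaced by the pieces of a partition one by one. *)
Lemma family_total_variation_mixed a b f (e d : R)
    (H : forall l, all (subitv a b) l -> pairwise nonoverlapping l ->
      family_length l < d -> family_variation f l < e) (k l : seq (R * R)) :
  all (subitv a b) (k ++ l) -> pairwise nonoverlapping (k ++ l) ->
  family_length (k ++ l) < d ->
  (\sum_(x <- k) TV x.1 x.2 f + (family_variation f l)%:E <= e%:E)%E.
Proof.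
elim: k l => [|x k IH] l /=.
  by move=> *; rewrite big_nil add0e lee_fin ltW// H.
move=> /andP[xab akl] /andP[xkl pkl] dkl; have /and3P[ax xx xb] := xab.
have len_kl : family_length (k ++ l) < d.
  apply: le_lt_trans dkl; rewrite {2}/family_length big_cons.
  by rewrite -/(family_length _) lerDr subr_ge0.
have S_le := IH l akl pkl len_kl.
rewrite big_cons; set S := (\sum_(_ <- k) _)%E in S_le *.
set V := family_variation f l in S_le *.
have S0 : (0 <= S)%E.
  rewrite /S big_seq; apply: sume_ge0 => y yk; apply: total_variation_ge0.
  have /allP/(_ y) := akl.
  by rewrite mem_cat yk => /(_ isT)/and3P[].
have V0 : 0 <= V by apply: sumr_ge0.
have Sfin : S \is a fin_num.
  rewrite ge0_fin_numE//; apply: le_lt_trans (ltry e).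
  by apply: le_trans S_le; rewrite leeDl ?lee_fin.
have [xx'|x12] := eqVneq x.1 x.2.
  by rewrite xx' total_variationxx add0e.
have xlt : x.1 < x.2 by rewrite lt_neqAle x12 xx.
(* Since [S] is finite it can be moved to the right, where the total variation on [x] is a supremum
   over partitions. Each partition is handled by the induction hypothesis with its pieces added to
   [l]. *)
rewrite -(fineK Sfin) -addeA -EFinD -leeBrDr// -EFinB.
apply: ge_ereal_sup => _ [_ [s xs <-] <-]; rewrite lee_fin lerBrDr.
have [p1 p2 p3 p4] := piecesP xs.
have sub_no y z : subitv x.1 x.2 y -> nonoverlapping x z -> nonoverlapping y z.
  move=> /and3P[h1 h2 h3] /orP[h|h]; rewrite /nonoverlapping.
    by rewrite (le_trans h3 h).
  by rewrite (le_trans h h1) orbT.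
have := IH (pieces x.1 s ++ l).
rewrite -/S {1}/family_variation big_cat/= -!/(family_variation _ _) p4 -/V.
rewrite -(fineK Sfin) -EFinD lee_fin => h.
apply: le_trans (h _ _ _); first by rewrite addrCA addrA addrAC addrC.
- move: akl; rewrite !all_cat => /andP[-> ->] /=; rewrite andbT.
  apply/allP => y /(allP p1) /and3P[h1 h2 h3].
  by rewrite /subitv (le_trans ax h1) h2 (le_trans h3 xb).
- move: pkl; rewrite !pairwise_cat => /and3P[akl_ -> ->]; rewrite p2/= andbT.
  move: xkl; rewrite all_cat => /andP[xk xl].
  rewrite allrel_catr akl_ andbT; apply/andP; split.
    apply/allrelP => u v uk vp; rewrite nonoverlappingC.
    by apply: sub_no; [exact: (allP p1)|exact: (allP xk)].
  apply/allrelP => u v up vl.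
  by apply: sub_no; [exact: (allP p1)|exact: (allP xl)].
- move: dkl; rewrite /family_length big_cons !big_cat/=.
  by rewrite -!/(family_length _) p3; lra.
Qed.

Lemma real_ac_family_total_variation a b f : real_ac a b f ->
  forall e, 0 < e -> exists2 d, 0 < d &
  forall l, all (subitv a b) l -> pairwise nonoverlapping l ->
    family_length l < d -> (\sum_(x <- l) TV x.1 x.2 f <= e%:E)%E.
Proof.
move=> acf e e0; have [d d0 H] := acf e e0; exists d => // l al pl dl.
have := family_total_variation_mixed H (k := l) (l := [::]).
rewrite cats0 => /(_ al pl dl).
by rewrite /family_variation big_nil adde0.
Qed.

(** The [d] belonging to the tolerance 1 bounds the variation on every interval shorter than [d],
    and finitely many steps [h n] of length [d / 2], truncated at [y], lead from [x] to [y]. *)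
Lemma real_ac_total_variation_fin_num a b f : real_ac a b f ->
  forall x y, a <= x -> x <= y -> y <= b -> TV x y f \is a fin_num.
Proof.
move=> acf x y ax xy yb.
have [d d0 H] := real_ac_family_total_variation acf ltr01.
have small u v : a <= u -> u <= v -> v <= b -> v - u < d ->
    TV u v f \is a fin_num.
  move=> au uv vb uvd; rewrite ge0_fin_numE ?total_variation_ge0//.
  have := H [:: (u, v)]; rewrite /= /subitv /= au uv vb /= /family_length.
  by rewrite !big_seq1 => /(_ isT isT uvd) /le_lt_trans; apply; rewrite ltry.
pose h n := Num.min (x + n%:R * (d / 2)) y.
have hx n : x <= h n.
  by rewrite le_min xy andbT lerDl mulr_ge0// divr_ge0// ltW.
have hy n : h n <= y by rewrite ge_min lexx orbT.
have hS n : h n <= h n.+1 /\ h n.+1 - h n < d.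
  rewrite /h -(natr1 n) mulrDl mul1r addrA; set m := _ + n%:R * _.
  by case: (leP m y) => h1; case: (leP (m + d / 2) y) => h2; split; lra.
have fin n : TV x (h n) f \is a fin_num.
  elim: n => [|n IH].
    by rewrite /h mul0r addr0 min_l// total_variationxx.
  rewrite (total_variationD f (hx n) (hS n).1) fin_numD IH/=; apply: small.
  - exact: le_trans ax (hx n).
  - exact: (hS n).1.
  - exact: le_trans (hy _) yb.
  - exact: (hS n).2.
have [n nxy] : exists n, y <= x + n%:R * (d / 2).
  exists (Num.bound ((y - x) / (d / 2))).
  rewrite -lerBlDl -ler_pdivrMr ?divr_gt0//.
  by apply/ltW/archi_boundP; rewrite divr_ge0 ?subr_ge0// divr_ge0// ltW.
by have := fin n; rewrite /h min_r.
Qed.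

Lemma real_acZD a b f g c : real_ac a b f -> real_ac a b g ->
  real_ac a b (fun x => c * f x + g x).
Proof.
move=> acf acg e e0; pose C := 1 + `|c|.
have C0 : 0 < C by rewrite ltr_wpDr.
have e2 : 0 < e / 2 / C by rewrite !divr_gt0.
have [d1 d10 H1] := acf _ e2; have [d2 d20 H2] := acg _ e2.
exists (Num.min d1 d2); first by rewrite lt_min d10.
move=> l al pl; rewrite lt_min => /andP[dl1 dl2].
have h1 := H1 _ al pl dl1; have h2 := H2 _ al pl dl2.
apply: (@le_lt_trans _ _ (C * (family_variation f l + family_variation g l))).
  rewrite /family_variation -big_split/= mulr_sumr.
  apply: ler_sum => x _.
  have -> : c * f x.2 + g x.2 - (c * f x.1 + g x.1) =
            c * (f x.2 - f x.1) + (g x.2 - g x.1) by ring.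
  apply: le_trans (ler_normD _ _) _; rewrite normrM /C.
  have := normr_ge0 (f x.2 - f x.1); have := normr_ge0 (g x.2 - g x.1).
  by have := normr_ge0 c; nra.
have -> : e = C * (e / 2 / C + e / 2 / C) by field; rewrite gt_eqF.
by rewrite ltr_pM2l// ltrD.
Qed.

(* The Jordan decomposition [f = TV - (TV - f)]. *)
Lemma real_ac_nondecreasing_decomposition a b f : a <= b -> real_ac a b f ->
  exists g h, [/\ real_ac a b g, real_ac a b h,
    {in `[a, b] &, nondecreasing g}, {in `[a, b] &, nondecreasing h} &
    forall x, f x = g x - h x].
Proof.
move=> ab acf; pose g x := fine (TV a x f).
have fin := real_ac_total_variation_fin_num acf.
have gB x y : a <= x -> x <= y -> y <= b -> g y - g x = fine (TV x y f).
  move=> ax xy yb; rewrite /g (total_variationD f ax xy).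
  by rewrite fineD ?fin// ?(le_trans xy)// addrC addKr.
have acg : real_ac a b g.
  move=> e e0; have e20 : 0 < e / 2 by rewrite divr_gt0.
  have [d d0 H] := real_ac_family_total_variation acf e20.
  exists d => // l al pl dl; apply: (@le_lt_trans _ _ (e / 2)); last by lra.
  rewrite -lee_fin; apply: le_trans (H _ al pl dl).
  rewrite /family_variation -sumEFin big_seq [leRHS]big_seq.
  apply: lee_sum => x /(allP al) /and3P[? ? ?].
  rewrite gB// ger0_norm ?fine_ge0 ?total_variation_ge0//.
  by rewrite fineK ?fin.
exists g, (fun x => g x - f x); split => //.
- rewrite (_ : (fun x => _) = (fun x => -1 * f x + g x)).
    exact: real_acZD.
  by apply/funext => x; rewrite mulN1r addrC.
- move=> x y; rewrite !in_itv/= => /andP[ax xb] /andP[ay yb] xy.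
  by rewrite -subr_ge0 gB// fine_ge0// total_variation_ge0.
- move=> x y; rewrite !in_itv/= => /andP[ax xb] /andP[ay yb] xy.
  rewrite -subr_ge0.
  have -> : g y - f y - (g x - f x) = (g y - g x) - (f y - f x) by ring.
  rewrite gB// subr_ge0 (le_trans (ler_norm _))// -lee_fin fineK ?fin//.
  exact: total_variation_ge.
- by move=> x; rewrite opprB addrC subrK.
Qed.

End TotalVariationAC.

(** * The Radon-Nikodym density of an absolutely continuous function *)

Section StieltjesDensity.
Context {R : realType}.
Local Notation mu := (@lebesgue_measure R).
Implicit Types (a b : R) (h f : R -> R).

(** The integral form of [f' = h]. It determines [f] on the closed interval from [f a], so the end
    points need no one-sided derivatives. *)
Definition is_primitive a b h f :=
  mu.-integrable `]a, b[ (EFin \o h) /\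
  forall x, a <= x -> x <= b -> f x = f a + \int[mu]_(t in `]a, x[) h t.

Section nondecreasing.
Variables (a b : R) (g : R -> R).
Hypotheses (ab : a < b) (acg : real_ac a b g).
Hypothesis ndg : {in `[a, b] &, nondecreasing g}.

(** A Stieltjes measure needs a monotone function on the whole line; composing with [clamp]
    continues [g] by constants. *)
Let clamp (x : R) : R := Num.max a (Num.min x b).

Let clamp_itv x : clamp x \in `[a, b].
Proof. by rewrite in_itv/= le_max lexx/= ge_max (ltW ab) ge_min lexx orbT. Qed.

Let clamp_nd : nondecreasing clamp.
Proof. by move=> x y xy; rewrite /clamp le_max2// le_min2. Qed.

Let clampK x : a <= x -> x <= b -> clamp x = x.
Proof. by move=> ax xb; rewrite /clamp min_l// max_r. Qed.

Let clamp_lip x y : x <= y -> clamp y - clamp x <= y - x.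
Proof.
move=> xy; rewrite /clamp.
by case: (leP x b) => h1; case: (leP y b) => h2;
  rewrite ?(max_r (ltW ab)); case: (leP a x) => h3; case: (leP a y) => h4; lra.
Qed.

Let G x := g (clamp x).

Let G_nd : nondecreasing G.
Proof. by move=> x y xy; apply: ndg => //; exact: clamp_nd. Qed.

Let G_rc : forall x, G y @[y --> x^'+] --> G x.
Proof.
move=> x; apply/cvgrPdist_lt => e e0; have [d d0 H] := acg e0.
near=> y; have xy : x <= y by near: y; exact: nbhs_right_ge.
have yd : y - x < d.
  by rewrite ltrBlDl; near: y; apply: nbhs_right_lt; rewrite ltrDl.
have := H [:: (clamp x, clamp y)].
rewrite /= andbT /subitv /= /family_length /family_variation !big_seq1/=.
rewrite distrC; apply => //.
  have := clamp_itv x; have := clamp_itv y; rewrite !in_itv/=.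
  by move=> /andP[_ yb] /andP[ax _]; rewrite ax yb clamp_nd.
exact: le_lt_trans (clamp_lip xy) yd.
Unshelve. all: by end_near. Qed.

Let Gc : cumulative R R :=
  HB.pack G (isCumulative.Build R _ R G G_nd G_rc).

Let nu0 : {measure set (measurableTypeR R) -> \bar R} :=
  lebesgue_stieltjes_measure Gc.

Let nu0E x y : x <= y -> nu0 `]x, y]%classic = (G y - G x)%:E.
Proof.
move=> xy; rewrite /nu0/= /lebesgue_stieltjes_measure /measure_extension.
rewrite measurable_mu_extE/=; last exact: is_ocitv.
by rewrite wlength_itv_bnd.
Qed.

Let ab_fin : (nu0 `]a, b]%classic < +oo)%E.
Proof. by rewrite nu0E ?ltW// ltry. Qed.

(** Restricting to []a, b]] yields a finite measure, as Radon-Nikodym requires. *)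
Let nu : {finite_measure set (measurableTypeR R) -> \bar R} :=
  @mfrestr _ (measurableTypeR R) R `]a, b]%classic nu0
    (measurable_itv `]a, b]) ab_fin.

Let nuE x : a <= x -> x <= b -> nu `]a, x]%classic = (g x - g a)%:E.
Proof.
move=> ax xb; rewrite /nu/= /mfrestr /mrestr.
rewrite (_ : _ `&` _ = `]a, x]%classic).
  by rewrite -/nu0 nu0E// /G !clampK// ltW.
by apply/setIidl; apply: subset_itvl; rewrite bnd_simp.
Qed.

Let grid (n : nat) (k : nat) : R := a + k%:R * ((b - a) / n.+1%:R).

Let cell n k : set R := `]grid n k, grid n k.+1]%classic.

Let step_gt0 n : 0 < (b - a) / n.+1%:R.
Proof. by rewrite divr_gt0// subr_gt0. Qed.

Let gridS n k : grid n k.+1 = grid n k + (b - a) / n.+1%:R.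
Proof. by rewrite /grid -(natr1 k) mulrDl mul1r addrA. Qed.

Let grid_nd n : {homo grid n : i j / (i <= j)%N >-> i <= j}.
Proof. by move=> i j ij; rewrite lerD2l ler_wpM2r ?ler_nat// ltW. Qed.

Let grid0 n : grid n 0 = a. Proof. by rewrite /grid mul0r addr0. Qed.

Let gridN n : grid n n.+1 = b.
Proof. by rewrite /grid mulrC divfK// addrC subrK. Qed.

Let cell_cover n x : a < x -> x <= b -> exists2 k : 'I_n.+1, True & cell n k x.
Proof.
move=> ax xb; have : forall m, (m <= n.+1)%N -> x <= grid n m ->
    exists2 k : 'I_n.+1, True & cell n k x.
  elim=> [_|m IH mn]; first by rewrite grid0 leNgt ax.
  move=> xm; have [xlem|xgtm] := leP x (grid n m).
    by apply: IH => //; exact: ltnW.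
  by exists (Ordinal mn) => //; rewrite /cell /= in_itv/= xgtm xm.
by move=> /(_ n.+1 (leqnn _)); apply; rewrite gridN.
Qed.

(** An inner approximation of [U] by finitely many intervals, because absolute continuity speaks of
    finite families only. *)
Let cells n (U : set R) : set R :=
  \big[setU/set0]_(k < n.+1 | `[< cell n k `<=` U >]) cell n k.

Let cells_measurable n U : measurable (cells n U : set (measurableTypeR R)).
Proof. by apply: bigsetU_measurable => i _; exact: measurable_itv. Qed.


Let cellsP n U x : cells n U x <->
  exists2 k : 'I_n.+1, cell n k `<=` U & cell n k x.
Proof.
rewrite /cells; split.
  elim/big_ind: _ => //.
    by move=> A B IA IB [/IA|/IB].
  by move=> k /asboolP kU kx; exists k.
move=> [k kU kx]; rewrite (bigD1 k)/=; last exact/asboolP.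
by left.
Qed.

(** The cells inside [U] have total length at most [mu U], so their [nu]-measure is controlled by
    absolute continuity; as [U] is open, each of its points in []a, b]] lies in such a cell for all
    fine enough grids. *)
Let nu_open_small e : 0 < e -> exists2 d, 0 < d & forall U : set R, open U ->
  (mu U < d%:E)%E -> (nu U <= e%:E)%E.
Proof.
move=> e0; have [d d0 H] := acg e0; exists d => // U oU Ud.
have mU : measurable (U : set (measurableTypeR R)) by exact: open_measurable.
have nu_cells n : (nu (cells n U) <= e%:E)%E.
  pose P k := `[< cell n k `<=` U >].
  have trivP : trivIset [set k : 'I_n.+1 | P k] (fun k : 'I_n.+1 => cell n k).
    have lt_disj (i j : 'I_n.+1) : (i < j)%N -> cell n i `&` cell n j = set0.
      move=> ij; apply/seteqP; split => // x [].
      rewrite /cell /= !in_itv/= => /andP[_ xi] /andP[jx _].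
      have := le_lt_trans (le_trans xi (grid_nd n ij)) jx.
      by rewrite ltxx.
    apply/trivIsetP => i j _ _ neq.
    have := neq; rewrite neq_lt => /orP[] h; first exact: lt_disj.
    by rewrite setIC lt_disj.
  pose l := [seq (grid n k, grid n k.+1) | k : 'I_n.+1 <- enum 'I_n.+1 & P k].
  have big_l (F : R * R -> R) :
      \sum_(x <- l) F x = \sum_(k < n.+1 | P k) F (grid n k, grid n k.+1).
    by rewrite big_map big_filter big_enum_cond.
  have len_l : (family_length l)%:E = mu (cells n U).
    rewrite /family_length big_l /cells.
    rewrite measure_bigsetU_ord_cond//; last by move=> *; exact: measurable_itv.
    rewrite -sumEFin; apply: eq_bigr => k _.
    apply/esym; apply: etrans (lebesgue_measure_itv _) _.
    by rewrite /= lte_fin gridS ltrDl step_gt0 -EFinB.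
  have := H l; rewrite -lte_fin len_l /family_variation big_l => Hl.
  apply: (@le_trans _ _ (\sum_(k < n.+1 | P k) (g (grid n k.+1) - g (grid n k))%:E)%E).
    rewrite /cells measure_bigsetU_ord_cond//; last first.
      by move=> *; exact: measurable_itv.
    apply: lee_sum => k _.
    rewrite /nu/= /mfrestr /mrestr -/nu0.
    have nk : (k < n.+1)%N by [].
    have ak : a <= grid n k by rewrite -(grid0 n) grid_nd.
    have kb : grid n k.+1 <= b by rewrite -[leRHS](gridN n) grid_nd.
    have kk : grid n k <= grid n k.+1 by exact: grid_nd.
    rewrite (_ : _ `&` _ = cell n k); last first.
      by apply/setIidl; apply: subset_itv; rewrite bnd_simp.
    by rewrite nu0E// /G !clampK// ?(le_trans ak)// ?(le_trans kk).
  rewrite sumEFin lee_fin ltW//.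
  apply: (le_lt_trans _ (Hl _ _ _)).
  - by apply: ler_sum => k _; exact: ler_norm.
  - apply/allP => x /mapP[k _ ->]; rewrite /subitv/=.
    by rewrite -{1}(grid0 n) -{1}(gridN n) !grid_nd.
  - have := iota_ltn_sorted 0 n.+1; rewrite -val_enum_ord => st.
    rewrite /l pairwise_map; apply: (subseq_pairwise (filter_subseq _ _)).
    move: st; rewrite sorted_map (sorted_pairwise) => [|x y z]; last exact: ltn_trans.
    by apply: sub_pairwise => i j /= ij; rewrite /nonoverlapping /= grid_nd.
  - apply: le_lt_trans Ud; apply: le_measure; rewrite ?inE//.
    by move=> x /cellsP[k kU /kU].
(* The grids are not nested, so [cells n U] need not grow with [n]; the intersections of its tails
   do. *)
pose T n := \bigcap_(m in [set m | (n <= m)%N]) cells m U.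
have mT n : measurable (T n : set (measurableTypeR R)).
  by apply: bigcap_measurable => //; exists n => /=.
have TU : U `&` `]a, b]%classic `<=` \bigcup_n T n.
  move=> x [Ux]; rewrite /= in_itv/= => /andP[ax xb].
  have /nbhs_ballP[r /= r0 rU] : nbhs x U by apply: open_nbhs_nbhs.
  have [N N0] : exists N : nat, (b - a) / N.+1%:R < r.
    exists (Num.bound ((b - a) / r)).
    rewrite ltr_pdivrMr// mulrC -ltr_pdivrMr//.
    apply: lt_trans (archi_boundP _) _; last by rewrite ltr_nat.
    by rewrite divr_ge0 ?subr_ge0 ?ltW.
  exists N => // m Nm; apply/cellsP; have [k _ kx] := cell_cover m ax xb.
  exists k => // y ky; apply: rU; move: kx ky; rewrite /cell /= !in_itv/= gridS.
  have mN : (b - a) / m.+1%:R <= (b - a) / N.+1%:R.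
    by rewrite ler_pM2l ?subr_gt0// lef_pV2 ?posrE// ler_nat.
  move: mN N0; set u := _ / m.+1%:R; set v := _ / N.+1%:R; set w := grid m k.
  move=> uv vr /andP[h1 h2] /andP[h3 h4]; rewrite /ball/= ltr_norml.
  by apply/andP; split; lra.
have ndT : nondecreasing_seq T.
  by move=> i j ij; apply/subsetPset => x Tx m jm; apply: Tx; exact: leq_trans jm.
have mbT : measurable (\bigcup_n T n : set (measurableTypeR R)).
  exact: bigcup_measurable.
have cvT := nondecreasing_cvg_mu (mu := nu) mT mbT ndT.
have -> : nu U = nu (U `&` `]a, b]%classic).
  by rewrite /nu/= /mfrestr /mrestr -setIA setIid.
apply: (@le_trans _ _ (nu (\bigcup_n T n))).
  by apply: le_measure; rewrite ?inE//; exact: measurableI.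
rewrite -(cvg_lim _ cvT)//; apply: lime_le; first by apply/cvg_ex; eexists; exact: cvT.
apply: nearW => n; apply: le_trans (nu_cells n).
apply: le_measure; rewrite ?inE//.
by move=> x; apply => /=.
Qed.

(** By outer regularity a null set lies in open sets of arbitrarily small length, to which
    [nu_open_small] applies. *)
Let nu_dominated : nu `<< mu.
Proof.
apply/null_content_dominatesP => A mA muA.
apply/eqP; rewrite eq_le measure_ge0 andbT; apply/lee_addgt0Pr => e e0.
rewrite add0e; have [d d0 H] := nu_open_small e0.
have [|U [oU AU]] := lebesgue_regularity_outer mA _ d0.
  by rewrite muA ltry.
have mU : measurable (U : set (measurableTypeR R)) by exact: open_measurable.
have UE : mu U = mu (U `\` A).
  rewrite -[in LHS](setDUK AU) setUC; apply: measureU0 => //.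
  exact: measurableD.
move=> Ud; have {}Ud : (mu U < d%:E)%E by rewrite UE.
apply: le_trans (H U oU Ud).
by apply: le_measure => //; rewrite inE.
Qed.

Lemma nondecreasing_ac_primitive : exists h, is_primitive a b h g.
Proof.
have [f [f0 ffin fint fE]] := radon_nikodym_sigma_finite nu_dominated.
have fineE : f = EFin \o (fine \o f).
  by apply/funext => x /=; rewrite fineK.
exists (fine \o f); split.
  by rewrite -fineE; exact: integrableS fint.
move=> x ax xb; rewrite /Rintegral (_ : (fun t => _) = f); last first.
  by apply/funext => t /=; rewrite fineK.
rewrite integral_itv_bndo_bndc//; last first.
  by apply: measurable_funS (measurable_int _ fint).
by rewrite -fE// nuE//= addrC subrK.
Qed.

End nondecreasing.

Lemma real_ac_primitive a b f : a < b -> real_ac a b f ->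
  exists h, is_primitive a b h f.
Proof.
move=> ab acf.
have [g1 [g2 [ac1 ac2 nd1 nd2 fE]]] :=
  real_ac_nondecreasing_decomposition (ltW ab) acf.
have [h1 [i1 E1]] := nondecreasing_ac_primitive ab ac1 nd1.
have [h2 [i2 E2]] := nondecreasing_ac_primitive ab ac2 nd2.
exists (h1 \- h2); split.
  rewrite (_ : _ \o _ = (EFin \o h1) \- (EFin \o h2))%E//.
  exact: integrableB.
move=> x ax xb; rewrite !fE E1// E2// RintegralB//; first by ring.
  apply: integrableS i1 => //; exact: subset_itvl.
  apply: integrableS i2 => //; exact: subset_itvl.
Qed.

End StieltjesDensity.

(** * Calculus of primitives *)

Section Primitives.
Context {R : realType}.
Local Notation mu := (@lebesgue_measure R).
Implicit Types (a b : R) (h k f g : R -> R) (l : seq (R * R)).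

Definition ae_in a b (P : R -> Prop) := {ae mu, forall x, `]a, b[%classic x -> P x}.

Lemma ae_in1 a b (P P' : R -> Prop) :
  (forall x, a < x -> x < b -> P x -> P' x) -> ae_in a b P -> ae_in a b P'.
Proof.
move=> H; apply: (@filterS _ _ (ae_filter_ringOfSetsType mu)) => x Px Jx.
by have := Jx; rewrite /= in_itv/= => /andP[ax xb]; apply: H => //; exact: Px.
Qed.

Lemma ae_in2 a b (P1 P2 P' : R -> Prop) :
  (forall x, a < x -> x < b -> P1 x -> P2 x -> P' x) ->
  ae_in a b P1 -> ae_in a b P2 -> ae_in a b P'.
Proof.
move=> H; apply: (@filterS2 _ _ (ae_filter_ringOfSetsType mu)) => x P1x P2x Jx.
have := Jx; rewrite /= in_itv/= => /andP[ax xb].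
by apply: H => //; [exact: P1x|exact: P2x].
Qed.

Lemma ae_in3 a b (P1 P2 P3 P' : R -> Prop) :
  (forall x, a < x -> x < b -> P1 x -> P2 x -> P3 x -> P' x) ->
  ae_in a b P1 -> ae_in a b P2 -> ae_in a b P3 -> ae_in a b P'.
Proof.
move=> H h1 h2 h3.
have h12 : ae_in a b (fun x => P1 x /\ P2 x) :=
  ae_in2 (fun x _ _ p q => conj p q) h1 h2.
by apply: ae_in2 h12 h3 => x ax xb []; exact: H.
Qed.

Lemma integrable_subitv a b h x y : mu.-integrable `]a, b[ (EFin \o h) ->
  a <= x -> y <= b -> mu.-integrable `]x, y[ (EFin \o h).
Proof.
by move=> ih ax yb; apply: integrableS ih => //; apply: subset_itv; rewrite bnd_simp.
Qed.

Lemma ae_in_Rintegral a b h k : measurable_fun `]a, b[ h ->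
  measurable_fun `]a, b[ k -> ae_in a b (fun x => h x = k x) ->
  \int[mu]_(x in `]a, b[) h x = \int[mu]_(x in `]a, b[) k x.
Proof.
move=> mh mk hk; congr fine; apply: ae_eq_integral => //.
- exact/measurable_EFinP.
- exact/measurable_EFinP.
- by apply: (ae_in1 _ hk) => x ax xb ->.
Qed.

(** The Borel sigma-algebra is not complete, so equality almost everywhere does not carry
    measurability over to [k], which is therefore assumed. *)
Lemma ae_in_integrable a b h k : mu.-integrable `]a, b[ (EFin \o h) ->
  measurable_fun `]a, b[ k -> ae_in a b (fun x => h x = k x) ->
  mu.-integrable `]a, b[ (EFin \o k).
Proof.
move=> /integrableP[mh ih] mk hk; apply/integrableP; split.
  exact/measurable_EFinP.
apply: le_lt_trans ih; rewrite le_eqVlt; apply/orP; left; apply/eqP.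
apply: ae_eq_integral => //.
- by apply: measurableT_comp => //; exact/measurable_EFinP.
- exact: measurableT_comp.
- by apply: (ae_in1 _ hk) => x ax xb /= ->.
Qed.

Lemma is_primitive_measurable a b h f : is_primitive a b h f ->
  measurable_fun `]a, b[ h.
Proof. by move=> [ih _]; apply/measurable_EFinP; exact: measurable_int ih. Qed.

Lemma is_primitive_ae a b h k f : is_primitive a b h f ->
  measurable_fun `]a, b[ k -> ae_in a b (fun x => h x = k x) ->
  is_primitive a b k f.
Proof.
move=> pf mk hk; have mh := is_primitive_measurable pf; have [ih fE] := pf.
split; first exact: ae_in_integrable hk.
move=> x ax xb; rewrite fE//; congr (_ + _).
have sub : `]a, x[ `<=` `]a, b[ by apply: subset_itvl; rewrite bnd_simp.
apply: ae_in_Rintegral; [exact: measurable_funS mh|exact: measurable_funS mk|].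
apply: (@filterS _ _ (ae_filter_ringOfSetsType mu) _ _ _ hk) => y H Jy.
by apply: H; exact: sub.
Qed.

Lemma is_primitiveB a b h f s t : is_primitive a b h f ->
  a <= s -> s <= t -> t <= b -> f t - f s = \int[mu]_(x in `]s, t[) h x.
Proof.
move=> [ih fE] as_ st tb; have sb := le_trans st tb; have at_ := le_trans as_ st.
rewrite fE// (fE s)//.
move: st; rewrite le_eqVlt => /predU1P[->|st].
  by rewrite subrr set_itv_ge ?bnd_simp ?ltxx// Rintegral_set0.
have it : mu.-integrable `]a, t[ (EFin \o h) by exact: integrable_subitv ih _ _.
have is_ : mu.-integrable `]a, s[ (EFin \o h) by exact: integrable_subitv ih _ _.
rewrite (Rintegral_itv_bndo_bndc is_).
have := Rintegral_itvB (x := s) it; rewrite !bnd_simp => <-//.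
by ring.
Qed.

(** Absolute continuity of the integral, applied to the union [U l] of the intervals of the
    family. *)
Lemma is_primitive_ac a b h f : is_primitive a b h f -> real_ac a b f.
Proof.
move=> pf; have [ih fE] := pf; have mh := is_primitive_measurable pf.
have iT : mu.-integrable setT (EFin \o (h \_ `]a, b[)).
  by rewrite -restrict_EFin; apply/integrable_restrict => //=; rewrite setTI.
move=> e e0; have [d [d0 H]] := integral_normr_continuous iT e0.
exists d => // l al pl dl.
pose U (l : seq (R * R)) : set R := \big[setU/set0]_(x <- l) `]x.1, x.2[%classic.
have mU m : measurable (U m) by apply: bigsetU_measurable.
suff [h1 h2] : (mu (U l) <= (family_length l)%:E)%E /\
    family_variation f l <= \int[mu]_(x in U l) `|(h \_ `]a, b[) x|.
  by apply: le_lt_trans h2 (H _ (mU l) _); apply: le_lt_trans h1 _; rewrite lte_fin.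
elim: l al pl {dl} => [|x l IH] /=.
  rewrite /U /family_length /family_variation !big_nil measure0.
  by rewrite Rintegral_set0.
move=> /andP[/and3P[ax xx xb] al] /andP[xl pl]; have [IH1 IH2] := IH al pl.
have disj : [disjoint `]x.1, x.2[%classic & U l].
  apply/disj_setPS => t [tx Ut].
  have : exists2 y, y \in l & `]y.1, y.2[%classic t.
    move: Ut; rewrite /U; elim: (l) => [|z r IHr]; first by rewrite big_nil.
    rewrite big_cons => -[zt|/IHr[y yr yt]]; first by exists z; rewrite ?mem_head.
    by exists y => //; rewrite inE yr orbT.
  move=> [y yl]; move: tx; rewrite /= !in_itv/= => /andP[t1 t2] /andP[t3 t4].
  have /allP/(_ _ yl)/orP[h3|h3] := xl.
    by have := lt_trans (lt_le_trans t2 h3) t3; rewrite ltxx.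
  by have := lt_trans (lt_le_trans t4 h3) t1; rewrite ltxx.
rewrite /U /family_length /family_variation !big_cons; split.
  rewrite EFinD; apply: le_trans (measureU2 _ _ _) _ => //=.
    exact: mU.
  apply: leeD => //; rewrite lebesgue_measure_itv/= lte_fin.
  by case: ifP => _; rewrite ?lee_fin ?subr_ge0 -?EFinB.
have iN : mu.-integrable setT (EFin \o (fun t => `|(h \_ `]a, b[) t|)).
  exact: integrable_norm.
rewrite Rintegral_setU//; first last.
- by apply: integrableS iN => //; apply: measurableU => //; exact: mU.
- exact: mU.
apply: lerD => //; rewrite (is_primitiveB pf)//.
have ix : mu.-integrable `]x.1, x.2[ (EFin \o h) by exact: integrable_subitv ih _ _.
apply: le_trans (le_normr_Rintegral _ ix) _ => //.
rewrite le_eqVlt; apply/orP; left; apply/eqP; apply: eq_Rintegral => t.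
rewrite inE /= in_itv/= => /andP[t1 t2]; rewrite patchE mem_set//=.
by rewrite in_itv/= (le_lt_trans ax t1) (lt_le_trans t2 xb).
Qed.

(** Almost every point is a Lebesgue point of the integrand, and there the fundamental theorem of
    calculus holds. *)
Lemma is_primitive_is_derive a b h f : is_primitive a b h f ->
  ae_in a b (fun x => is_derive x 1 f (h x)).
Proof.
move=> pf; have [ih fE] := pf; pose h' := h \_ `]a, b[.
have iT : mu.-integrable setT (EFin \o h').
  by rewrite -restrict_EFin; apply/integrable_restrict => //=; rewrite setTI.
have /lebesgue_differentiation := integrable_locally_restrict (measurable_itv _) ih.
apply: (@filterS _ _ (ae_filter_ringOfSetsType mu)) => x xp.
move=> /[dup] Jx /=; rewrite in_itv/= => /andP[ax xb].
have iu : mu.-integrable `[a, (x + 1)] (EFin \o h').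
  by apply: integrableS iT.
have xx1 : x < x + 1 by rewrite ltrDl.
have ax' : (BLeft a < BRight x)%E by rewrite lte_fin.
have [d1 d2] := FTC1_lebesgue_pt xx1 iu ax' xp.
have -> : h x = h' x by rewrite /h' patchE mem_set.
set F := (fun y => _) in d1 d2.
have dF : is_derive x 1 F (h' x).
  by apply: DeriveDef; [exact: d1|rewrite -derive1E; exact: d2].
(* [F] integrates the density cut off outside the interval, so [f] and [f a + F] need only agree
   near the interior point [x], which is enough for the derivative. *)
have : is_derive x 1 (cst (f a) + F) (0 + h' x) by apply: is_deriveD.
rewrite add0r; apply: near_eq_is_derive.
near=> y.
have ay : a < y by near: y; exact: lt_nbhsr.
have yb : y < b by near: y; exact: lt_nbhsl.
rewrite -[LHS]/(f a + F y) (fE y) ?ltW// /F; congr (_ + _).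
rewrite -Rintegral_itv_obnd_cbnd; last by apply: integrableS iT.
rewrite -Rintegral_itv_bndo_bndc; last by apply: integrableS iT.
apply: eq_Rintegral => t; rewrite inE/= in_itv/= => /andP[t1 t2].
by rewrite /h' patchE mem_set//= in_itv/= t1 (lt_trans t2).
Unshelve. all: by end_near. Qed.

(** Turns pointwise differentiation rules into integral ones: once absolute continuity is known, it
    suffices to compute the derivative almost everywhere. The product and exponential rules below
    arise in this way. *)
Lemma real_ac_is_primitive a b f k : a < b -> real_ac a b f ->
  measurable_fun `]a, b[ k -> ae_in a b (fun x => f^`()%classic x = k x) ->
  is_primitive a b k f.
Proof.
move=> ab /(real_ac_primitive ab)[h hf] mk fk.
apply: is_primitive_ae (hf) mk _.
apply: ae_in2 (is_primitive_is_derive hf) fk => x _ _ [_ dh] <-.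
by rewrite derive1E.
Qed.

Lemma real_ac_continuous a b f : real_ac a b f ->
  {in `]a, b[%classic, continuous f}.
Proof.
move=> acf x; rewrite inE/= in_itv/= => /andP[ax xb].
apply/cvgrPdist_lt => e e0; have [d d0 H] := acf e e0.
near=> y.
have ay : a < y by near: y; exact: lt_nbhsr.
have yb : y < b by near: y; exact: lt_nbhsl.
have yd : `|x - y| < d by near: y; apply/nbhs_ballP; exists d.
have HH u v : a < u -> u <= v -> v < b -> v - u < d -> `|f v - f u| < e.
  move=> au uv vb uvd; have := H [:: (u, v)].
  rewrite /= /subitv /family_length /family_variation !big_seq1 /=.
  by apply => //; rewrite (ltW au) uv (ltW vb).
have [xy|yx] := leP x y.
  rewrite distrC; apply: HH => //.
  by rewrite distrC in yd; apply: le_lt_trans yd; exact: ler_norm.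
by apply: HH => //; [exact: ltW|apply: le_lt_trans yd; exact: ler_norm].
Unshelve. all: by end_near. Qed.

Lemma real_ac_measurable a b f : real_ac a b f -> measurable_fun `]a, b[ f.
Proof.
move=> acf; apply: open_continuous_measurable_fun (real_ac_continuous acf).
exact: interval_open.
Qed.

Lemma is_primitive_bounded a b h f : a <= b -> is_primitive a b h f ->
  exists2 M, 0 <= M & forall x, a <= x -> x <= b -> `|f x| <= M.
Proof.
move=> ab [ih fE]; exists (`|f a| + \int[mu]_(t in `]a, b[) `|h t|).
  by rewrite addr_ge0// Rintegral_ge0.
move=> x ax xb; rewrite fE//; apply: le_trans (ler_normD _ _) _.
have ihx : mu.-integrable `]a, x[ (EFin \o h) by exact: integrable_subitv ih _ _.
rewrite lerD2l; apply: le_trans (le_normr_Rintegral _ ihx) _ => //.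
have iN : mu.-integrable `]a, b[ (EFin \o (fun t => `|h t|)).
  exact: integrable_norm.
rewrite -lee_fin /Rintegral !fineK.
- apply: ge0_subset_integral => //; last exact: subset_itvl.
  exact: measurable_int iN.
- exact: integrable_fin_num.
- by apply: integrable_fin_num => //; exact: integrable_subitv iN _ _.
Qed.

Lemma is_primitiveZD a b h k f g c : is_primitive a b h f ->
  is_primitive a b k g ->
  is_primitive a b (fun x => c * h x + k x) (fun x => c * f x + g x).
Proof.
move=> [ih fE] [ik gE].
have iZ x y : a <= x -> y <= b ->
    mu.-integrable `]x, y[ (EFin \o (fun t => c * h t)).
  move=> ax yb; rewrite (_ : _ \o _ = (fun t => c%:E * (EFin \o h) t)%E)//.
  by apply: integrableZl => //; exact: integrable_subitv ih _ _.
split.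
  rewrite (_ : _ \o _ = (EFin \o (fun t => (c * h t)%R)) \+ (EFin \o k))%E//.
  by apply: integrableD => //; exact: iZ.
move=> x ax xb; rewrite fE// gE// RintegralD//; first last.
- exact: integrable_subitv ik _ _.
- exact: iZ.
rewrite RintegralZl//; first by ring.
exact: integrable_subitv ih _ _.
Qed.

Lemma is_primitiveM a b h k f g : a < b -> is_primitive a b h f ->
  is_primitive a b k g ->
  is_primitive a b (fun x => h x * g x + f x * k x) (fun x => f x * g x).
Proof.
move=> ab pf pg.
have acf := is_primitive_ac pf; have acg := is_primitive_ac pg.
have [M M0 fM] := is_primitive_bounded (ltW ab) pf.
have [N N0 gN] := is_primitive_bounded (ltW ab) pg.
(* An increment of [f * g] is at most [N] times that of [f] plus [M] times that of [g]; the summand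
   1 makes the constant positive, so that [e] can be divided by it. *)
have C0 : 0 < M + N + 1 by rewrite ltr_wpDl// addr_ge0.
apply: real_ac_is_primitive => //.
- move=> e e0; have e2 : 0 < e / 2 / (M + N + 1) by rewrite !divr_gt0.
  have [d1 d10 H1] := acf _ e2; have [d2 d20 H2] := acg _ e2.
  exists (Num.min d1 d2); first by rewrite lt_min d10.
  move=> l al pl; rewrite lt_min => /andP[dl1 dl2].
  have h1 := H1 _ al pl dl1; have h2 := H2 _ al pl dl2.
  apply: (@le_lt_trans _ _ ((M + N + 1) *
      (family_variation f l + family_variation g l))).
    rewrite /family_variation -big_split/= mulr_sumr big_seq [leRHS]big_seq.
    apply: ler_sum => x /(allP al)/and3P[ax xx xb].
    have -> : f x.2 * g x.2 - f x.1 * g x.1 =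
        (f x.2 - f x.1) * g x.2 + f x.1 * (g x.2 - g x.1) by ring.
    apply: le_trans (ler_normD _ _) _; rewrite !normrM.
    have := fM x.1 ax (le_trans xx xb); have := gN x.2 (le_trans ax xx) xb.
    have := normr_ge0 (f x.2 - f x.1); have := normr_ge0 (g x.2 - g x.1).
    have := normr_ge0 (f x.1); have := normr_ge0 (g x.2).
    set F := `|f x.2 - _|; set G := `|g x.2 - _|; set f1 := `|f _|; set g1 := `|g _|.
    move=> g10 f10 G0 F0 gN' fM'.
    have : F * g1 <= F * N by rewrite ler_wpM2l.
    have : f1 * G <= M * G by rewrite ler_wpM2r.
    have := mulr_ge0 M0 F0; have := mulr_ge0 N0 G0.
    by nra.
  have -> : e = (M + N + 1) * (e / 2 / (M + N + 1) + e / 2 / (M + N + 1)).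
    by field; rewrite gt_eqF.
  by rewrite ltr_pM2l// ltrD.
- apply: measurable_funD; apply: measurable_funM.
  + exact: is_primitive_measurable pf.
  + exact: real_ac_measurable acg.
  + exact: real_ac_measurable acf.
  + exact: is_primitive_measurable pg.
- apply: ae_in2 (is_primitive_is_derive pf) (is_primitive_is_derive pg).
  move=> x _ _ df dg; rewrite derive1E derive_val.
  by rewrite addrC /GRing.scale/= mulrC.
Qed.

Lemma is_primitive_expR a b h f c : a < b -> is_primitive a b h f ->
  is_primitive a b (fun x => c * h x * expR (c * f x)) (fun x => expR (c * f x)).
Proof.
move=> ab pf; have acf := is_primitive_ac pf.
have [M M0 fM] := is_primitive_bounded (ltW ab) pf.
(* A Lipschitz constant of [u |-> expR (c * u)] on [[-M, M]], increased by 1 to be positive. *)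
pose C := expR (`|c| * M) * `|c| + 1.
have C0 : 0 < C by rewrite ltr_wpDl// mulr_ge0// expR_ge0.
have expB u v K : u <= K -> v <= K -> `|expR u - expR v| <= expR K * `|u - v|.
  wlog vu : u v / v <= u => [H uK vK|uK vK].
    have [vu|/ltW uv] := leP v u; first exact: H.
    by rewrite distrC (distrC u); exact: H.
  rewrite !ger0_norm ?subr_ge0 ?ler_expR//.
  have -> : expR u - expR v = expR u * (1 - expR (v - u)).
    by rewrite mulrBr mulr1 -expRD [u + _]addrC subrK.
  apply: ler_pM.
  - exact: expR_ge0.
  - by rewrite subr_ge0 -expR0 ler_expR subr_le0.
  - by rewrite ler_expR.
  - have := expR_ge1Dx (v - u); lra.
apply: real_ac_is_primitive => //.
- move=> e e0; have [d d0 H] := acf _ (divr_gt0 e0 C0).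
  exists d => // l al pl dl; have := H _ al pl dl; rewrite ltr_pdivlMr//.
  apply: le_lt_trans; rewrite /family_variation mulr_suml.
  rewrite big_seq [leRHS]big_seq; apply: ler_sum => x /(allP al)/and3P[ax xx xb].
  have K y : a <= y -> y <= b -> c * f y <= `|c| * M.
    move=> ay yb; apply: le_trans (ler_norm _) _; rewrite normrM.
    by rewrite ler_wpM2l// fM.
  have K1 : c * f x.1 <= `|c| * M by apply: K => //; exact: le_trans xx xb.
  have K2 : c * f x.2 <= `|c| * M by apply: K => //; exact: le_trans ax xx.
  have E : `|expR (c * f x.2) - expR (c * f x.1)| <=
      expR (`|c| * M) * `|c * f x.2 - c * f x.1| by exact: expB.
  apply: le_trans E _.
  rewrite -mulrBr normrM mulrCA mulrA mulrC ler_wpM2l// /C.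
  by rewrite mulrC lerDl.
- apply: measurable_funM.
    by apply: measurable_funM => //; exact: is_primitive_measurable pf.
  apply: measurableT_comp => //.
  by apply: measurable_funM => //; exact: real_ac_measurable acf.
- apply: ae_in1 (is_primitive_is_derive pf) => x _ _ df.
  have dcf : is_derive x 1 (fun y => c * f y) (c * h x).
    by apply: is_deriveZ.
  have := @is_derive1_comp _ expR (fun y => c * f y) x _ _ (is_derive_expR _) dcf.
  by move=> [_ dE]; rewrite derive1E [LHS]dE mulrC.
Qed.

End Primitives.

(** * Borel versions of Lebesgue integrable functions *)

Section BorelVersion.
Context {R : realType}.
Local Notation mu := (@lebesgue_measure R).
Local Notation cmu := (@completed_lebesgue_measure R).
Local Notation hlength := (@wlength R idfun).
Local Notation cR := (caratheodory_type hlength^*%mu).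

Let id_measurable : measurable_fun setT (idfun : cR -> measurableTypeR R).
Proof. by move=> _ B mB; rewrite setTI; exact: sub_caratheodory. Qed.

(** The Borel measure is the push-forward of its completion along the identity, which is measurable
    from the larger sigma-algebra to the smaller one. *)
Lemma ge0_integral_completed (D : set R) (f : R -> \bar R) :
  measurable (D : set (measurableTypeR R)) ->
  measurable_fun (D : set (measurableTypeR R)) f ->
  (forall x, D x -> 0 <= f x)%E ->
  (\int[mu]_(x in D) f x = \int[cmu]_(x in D) f x)%E.
Proof.
move=> mD mf f0.
rewrite -[RHS](@ge0_integral_pushforward _ _ cR (measurableTypeR R) R idfun
  id_measurable cmu D f mD mf) //.
by move=> x; rewrite inE; exact: f0.
Qed.

Lemma caratheodory_borel (E : set R) : measurable (E : set cR) ->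
  exists A N : set (measurableTypeR R),
    [/\ measurable A, measurable N, mu N = 0%E, A `<=` E & E `<=` A `|` N].
Proof.
move=> mE.
have : (completed_algebra_gen mu).-sigma.-measurable E.
  by rewrite completed_caratheodory_measurable.
rewrite g_sigma_completed_algebra_genE => -[A mA [N0 [N [mN N0_ NN]] <-]].
exists A, N; split => //.
by move=> x [Ax|/NN Nx]; [left|right].
Qed.

(* A Lebesgue measurable function is made Borel by setting it to 0 on one null
   set carrying the Borel defects of all [f > q], [q] rational. *)
Lemma Lebesgue_integrable_borel (a b : R) (f : R -> R) :
  Lebesgue_integrable a b f ->
  exists2 g, mu.-integrable `]a, b[ (EFin \o g) &
    ae_in a b (fun x => g x = f x).
Proof.
move=> fi; pose J : set R := `]a, b[%classic.
have mJ : measurable (J : set (measurableTypeR R)) by exact: measurable_itv.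
have mJc : measurable (J : set cR) by exact: sub_caratheodory.
have /integrableP[mf ifoo] := fi.
(* An enumeration of the rationals; numbers that encode none give 0, which merely repeats a
   value. *)
pose r_ (n : nat) : R := ratr (odflt 0 (@unpickle rat n)).
have r_dense (x y : R) : x < y -> exists2 n, x < r_ n & r_ n < y.
  move=> /rat_in_itvoo[q]; rewrite in_itv/= => /andP[xq qy].
  by exists (pickle q); rewrite /r_ pickleK.
pose E n := J `&` [set x | r_ n < f x].
have mE n : measurable (E n : set cR).
  rewrite (_ : E n = J `&` (EFin \o f) @^-1` `](r_ n)%:E, +oo[); last first.
    by apply/seteqP; split => x [Jx] /= fx; split => //; move: fx;
      rewrite /= in_itv/= andbT lte_fin.
  exact: (mf mJc _ (emeasurable_itv `](r_ n)%:E, +oo[)).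
have /choice[AN HAN] : forall n, exists AN : set R * set R,
    [/\ measurable (AN.1 : set (measurableTypeR R)),
      measurable (AN.2 : set (measurableTypeR R)), mu AN.2 = 0%E,
      AN.1 `<=` E n & E n `<=` AN.1 `|` AN.2].
  move=> n; have [A [N [h1 h2 h3 h4 h5]]] := caratheodory_borel (mE n).
  by exists (A, N).
pose M : set R := \bigcup_n (AN n).2.
have mM : measurable (M : set (measurableTypeR R)).
  by apply: bigcupT_measurable => n; have [] := HAN n.
have negM : mu.-negligible M.
  apply: negligible_bigcup => n; have [_ mN N0 _ _] := HAN n.
  by exists (AN n).2; split.
pose g x := if `[< M x >] then 0 else f x.
have gM x : M x -> g x = 0 by rewrite /g; case: asboolP.
have gNM x : ~ M x -> g x = f x by rewrite /g; case: asboolP.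
have mg : measurable_fun (J : set (measurableTypeR R)) g.
  apply: (measurability _ (RGenOInfty.measurableE R)).
  move=> _ [_ [r ->] <-].
  (* Off [M] the set where [g > r] is a union of the Borel cores over rationals above [r]. On [M]
     the function is 0, so the whole of [M] counts exactly when [r < 0]. *)
  have -> : J `&` g @^-1` `]r, +oo[ =
      (\bigcup_(n in [set n | r < r_ n]) ((AN n).1 `\` M)) `|`
      (if r < 0 then J `&` M else set0).
    apply/seteqP; split => x /=.
      rewrite in_itv/= andbT => -[Jx]; have [Mx|NMx] := pselect (M x).
        by rewrite gM// => ->; right.
      rewrite gNM// => /r_dense[n rn nf]; left; exists n => //; split => //.
      have [_ _ _ _] := HAN n; case/(_ x) => // Nx.
      by case: NMx; exists n.
    move=> [[n /= rn [Ax NMx]]|].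
      have [_ _ _ /(_ _ Ax) [Jx /= nf] _] := HAN n; split => //.
      by rewrite in_itv/= andbT gNM// (lt_trans rn).
    case: ifPn => // r0 [Jx Mx]; split => //.
    by rewrite in_itv/= andbT gM.
  apply: measurableU.
    apply: bigcup_measurable => n _; apply: measurableD => //.
    by have [] := HAN n.
  by case: ifP => // _; exact: measurableI.
exists g.
  apply/integrableP; split; first exact/measurable_EFinP.
  rewrite ge0_integral_completed//; last first.
    by apply: measurableT_comp => //; exact/measurable_EFinP.
  apply: le_lt_trans ifoo; apply: ge0_le_integral.
  - exact: mJc.
  - by move=> x _; exact: abse_ge0.
  - apply: measurableT_comp => //; apply/measurable_EFinP.
    move=> _ B mB; have := mg mJ B mB; exact: sub_caratheodory.
  - exact: measurableT_comp.
  - move=> x Jx /=; rewrite lee_fin; have [Mx|NMx] := pselect (M x).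
      by rewrite gM// normr0.
    by rewrite gNM.
have aeM : {ae mu, forall x, ~ M x}.
  by apply: negligibleS negM => x /= /contrapT.
by apply: (@filterS _ _ (ae_filter_ringOfSetsType mu) _ _ _ aeM) => x + _; exact: gNM.
Qed.

End BorelVersion.

(** * Linear systems with integrable coefficients *)

Section GeometricConvergence.
Context {R : realType}.
Implicit Types (A x : R) (f : nat -> R).

(** The increments from [n] on sum to at most [2 * A * 2^-1 ^+ n], so the intervals [[v n, u n]] are
    nested and share a point. The explicit error is what later gives bounds uniform in the space
    variable. *)
Lemma geometric_seq_limit f A : (forall n, `|f n.+1 - f n| <= A * 2^-1 ^+ n) ->
  exists l, forall n, `|l - f n| <= 2 * A * 2^-1 ^+ n.
Proof.
move=> fA; pose u n := f n + 2 * A * 2^-1 ^+ n; pose v n := f n - 2 * A * 2^-1 ^+ n.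
have uS n : u n.+1 <= u n.
  have := fA n; rewrite ler_norml /u exprS => /andP[_ h].
  by set q := 2^-1 ^+ n in h *; lra.
have vS n : v n <= v n.+1.
  have := fA n; rewrite ler_norml /v exprS => /andP[h _].
  by set q := 2^-1 ^+ n in h *; lra.
have ndu : nonincreasing_seq u by apply/nonincreasing_seqP.
have ndv : nondecreasing_seq v by apply/nondecreasing_seqP.
have vu n : v n <= u n.
  have : 0 <= A * 2^-1 ^+ n by apply: le_trans (fA n).
  by rewrite /u /v; set q := A * _; rewrite -!mulrA -/q; lra.
have vu2 n m : v n <= u m.
  have [nm|mn] := leqP n m.
    by rewrite (le_trans (ndv _ _ nm)).
  by rewrite (le_trans (vu n))// ndu// ltnW.
have cu : cvgn u.
  apply: nonincreasing_is_cvgn => //; exists (v 0) => _ [n _ <-]; exact: vu2.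
exists (limn u) => n; have h1 : limn u <= u n by exact: nonincreasing_cvgn_ge.
have h2 : v n <= limn u by apply: limr_ge => //; apply: nearW => m; exact: vu2.
by move: h1 h2; rewrite /u /v ler_norml; set q := _ * _; move=> *;
  apply/andP; split; lra.
Qed.

Lemma geometric_cvg0 f A : (forall n, `|f n| <= A * 2^-1 ^+ n) ->
  f n @[n --> \oo] --> 0.
Proof.
move=> fA; have c0 : A * 2^-1 ^+ n @[n --> \oo] --> (0 : R).
  rewrite -[X in _ --> X](mulr0 A); apply: cvgMr; apply: cvg_expr.
  by rewrite ger0_norm ?invr_ge0// invf_lt1// ltr1n.
apply/cvgr0Pnorm_lt => e e0; move/cvgr0Pnorm_lt : c0 => /(_ e e0).
by apply: filterS => n; apply: le_lt_trans; rewrite (le_trans (fA n))// ler_norm.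
Qed.

Lemma geometric_eq0 x A : (forall n, `|x| <= A * 2^-1 ^+ n) -> x = 0.
Proof.
move=> /(@geometric_cvg0 (fun=> x)) h.
exact: (cvg_unique _ (cvg_cst x) h).
Qed.

Lemma geometric_limit_cvg f A l : (forall n, `|l - f n| <= A * 2^-1 ^+ n) ->
  f n @[n --> \oo] --> l.
Proof.
move=> h; apply: cvg_sub0 (cvg_cst l).
by apply: (@geometric_cvg0 _ A) => n; rewrite /= -normrN opprB.
Qed.

End GeometricConvergence.

Section LinearODE.
Context {R : realType}.
Local Notation mu := (@lebesgue_measure R).
Variables (a b : R).
Hypothesis ab : a < b.
Implicit Types (h k f g : R -> R).

Local Notation intJ h := (mu.-integrable `]a, b[ (EFin \o h)).

Definition bounded_measurable f :=
  measurable_fun `]a, b[ f /\ exists M, forall x, a <= x -> x <= b -> `|f x| <= M.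

Lemma is_primitive_bounded_measurable h f :
  is_primitive a b h f -> bounded_measurable f.
Proof.
move=> pf; split; first exact: real_ac_measurable (is_primitive_ac pf).
by have [M _ fM] := is_primitive_bounded (ltW ab) pf; exists M.
Qed.

Lemma integrable_bounded_mul h f : intJ h -> bounded_measurable f ->
  intJ (fun x => h x * f x).
Proof.
move=> ih [mf [M fM]]; have mh : measurable_fun `]a, b[ h.
  by apply/measurable_EFinP; exact: measurable_int ih.
have M0 : 0 <= M := le_trans (normr_ge0 _) (fM a (lexx a) (ltW ab)).
apply: (@le_integrable _ _ _ mu _ _ (EFin \o _) (EFin \o (fun x => M * `|h x|))) => //.
- by apply/measurable_EFinP; exact: measurable_funM.
- move=> x; rewrite /= in_itv/= => /andP[ax xb]; rewrite lee_fin normrM.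
  by rewrite [leRHS]ger0_norm ?mulr_ge0// mulrC ler_wpM2r// fM ?ltW.
- rewrite (_ : _ \o _ = (fun x => M%:E * (EFin \o (fun x => `|h x|%R)) x)%E)//.
  by apply: integrableZl => //; exact: integrable_norm.
Qed.

Lemma integrable_add h k : intJ h -> intJ k -> intJ (fun x => h x + k x).
Proof.
move=> ih ik; rewrite (_ : _ \o _ = (EFin \o h) \+ (EFin \o k))%E//.
exact: integrableD.
Qed.

Lemma integrable_opp h : intJ h -> intJ (fun x => - h x).
Proof.
by move=> ih; rewrite (_ : _ \o _ = (\- (EFin \o h))%E)//; exact: integrableN.
Qed.

Definition primitive_from c h (x : R) := c + \int[mu]_(t in `]a, x[) h t.

Lemma primitive_from_a c h : primitive_from c h a = c.
Proof.
by rewrite /primitive_from set_itv_ge ?bnd_simp ?ltxx// Rintegral_set0 addr0.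
Qed.

Lemma is_primitive_from c h : intJ h -> is_primitive a b h (primitive_from c h).
Proof. by move=> ih; split => // x ax xb; rewrite primitive_from_a. Qed.

Variables (r s t : R -> R).
Hypotheses (ir : intJ r) (is_ : intJ s) (it : intJ t).

Let rho x := `|r x| + `|s x| + `|t x|.

Let irho : intJ rho.
Proof.
by apply: integrable_add; [apply: integrable_add|]; exact: integrable_norm.
Qed.

Let m := primitive_from 0 rho.
(** The weight of a Bielecki norm. As [E' = 2 * rho * E], the integral of [rho * E] is at most
    [E / 2]: the 2 in the exponent is the source of the contraction constant [1 / 2]. *)
Let E x := expR (2 * m x).

Let pE : is_primitive a b (fun x => 2 * rho x * E x) E.
Proof. by apply: is_primitive_expR => //; exact: is_primitive_from. Qed.

Let E_ge1 x : a <= x -> x <= b -> 1 <= E x.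
Proof.
move=> ax xb; rewrite -expR0 ler_expR mulr_ge0// /m /primitive_from add0r.
by apply: Rintegral_ge0 => y _; rewrite !addr_ge0.
Qed.

(* The exponential weight makes the integral operator a contraction. *)
Let integral_weight h k f g C : intJ h -> intJ k ->
  (forall x, `|h x| + `|k x| <= rho x) ->
  bounded_measurable f -> bounded_measurable g ->
  (forall x, a <= x -> x <= b -> `|f x| <= C * E x) ->
  (forall x, a <= x -> x <= b -> `|g x| <= C * E x) ->
  forall x, a <= x -> x <= b ->
  `|\int[mu]_(y in `]a, x[) (h y * f y + k y * g y)| <= C / 2 * E x.
Proof.
move=> ih ik hk bf bg fC gC x ax xb.
have C0 : 0 <= C.
  have := le_trans (normr_ge0 _) (fC a (lexx a) (ltW ab)).
  by rewrite pmulr_lge0// expR_gt0.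
have i1 : intJ (fun y => h y * f y + k y * g y).
  by apply: integrable_add; exact: integrable_bounded_mul.
have [iE EE] := pE.
have i2 : intJ (fun y => C / 2 * (2 * rho y * E y)).
  rewrite (_ : _ \o _ = (fun y => (C / 2)%:E *
    (EFin \o (fun y => (2 * rho y * E y)%R)) y)%E)//.
  exact: integrableZl.
have sx y : `]a, x[%classic y -> a <= y /\ y <= b.
  by rewrite /= in_itv/= => /andP[ay yx]; rewrite !ltW// (lt_le_trans yx).
apply: (@le_trans _ _ (\int[mu]_(y in `]a, x[) (C / 2 * (2 * rho y * E y)))).
  have i1x : mu.-integrable `]a, x[ (EFin \o (fun y => h y * f y + k y * g y)).
    exact: integrable_subitv i1 _ _.
  apply: le_trans (le_normr_Rintegral _ i1x) _ => //.
  apply: le_Rintegral => //.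
  - exact: integrable_norm.
  - exact: integrable_subitv i2 _ _.
  - move=> y /sx[ay yb]; apply: le_trans (ler_normD _ _) _; rewrite !normrM.
    have -> : C / 2 * (2 * rho y * E y) = rho y * (C * E y) by field.
    apply: (@le_trans _ _ ((`|h y| + `|k y|) * (C * E y))).
      by rewrite mulrDl lerD// ler_wpM2l// ?fC ?gC.
    by rewrite ler_wpM2r// (le_trans _ (fC y ay yb)).
rewrite RintegralZl//; last exact: integrable_subitv iE _ _.
rewrite ler_wpM2l ?divr_ge0// EE// lerDr.
by rewrite expR_ge0.
Qed.

Variables (g : R -> R) (y0 u0 : R).
Hypothesis ig : intJ g.

Let step (w : (R -> R) * (R -> R)) :=
  (primitive_from y0 (fun x => r x * w.2 x + s x * w.1 x),
   primitive_from u0 (fun x => - (s x * w.2 x + t x * w.1 x + g x))).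

Let W n := iter n step (cst y0, cst u0).

Let step_integrable w : bounded_measurable w.1 -> bounded_measurable w.2 ->
  intJ (fun x => r x * w.2 x + s x * w.1 x) /\
  intJ (fun x => - (s x * w.2 x + t x * w.1 x + g x)).
Proof.
move=> b1 b2; split; last apply: integrable_opp; do ?apply: integrable_add => //;
  exact: integrable_bounded_mul.
Qed.

Let W_bounded n : bounded_measurable (W n).1 /\ bounded_measurable (W n).2.
Proof.
elim: n => [|n [b1 b2]] /=.
  by split; split => //; [exists (`|y0|)|exists (`|u0|)].
have [i1 i2] := step_integrable b1 b2.
by split; apply: is_primitive_bounded_measurable; exact: is_primitive_from.
Qed.

Let hk1 x : `|r x| + `|s x| <= rho x. Proof. by rewrite /rho lerDl. Qed.
Let hk2 x : `|s x| + `|t x| <= rho x.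
Proof. by rewrite /rho -addrA lerDr. Qed.

Let bmB f h : bounded_measurable f -> bounded_measurable h ->
  bounded_measurable (fun x => f x - h x).
Proof.
move=> [mf [M fM]] [mh [N hN]]; split; first exact: measurable_funB.
exists (M + N) => x ax xb; apply: le_trans (ler_normB _ _) _.
by rewrite lerD ?fM ?hN.
Qed.

Let step_contraction w w' C :
  bounded_measurable w.1 -> bounded_measurable w.2 ->
  bounded_measurable w'.1 -> bounded_measurable w'.2 ->
  (forall x, a <= x -> x <= b ->
    `|w.1 x - w'.1 x| <= C * E x /\ `|w.2 x - w'.2 x| <= C * E x) ->
  forall x, a <= x -> x <= b ->
    `|(step w).1 x - (step w').1 x| <= C / 2 * E x /\
    `|(step w).2 x - (step w').2 x| <= C / 2 * E x.
Proof.
move=> b1 b2 b1' b2' H x ax xb.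
have [i1 i2] := step_integrable b1 b2; have [i1' i2'] := step_integrable b1' b2'.
have sub h : intJ h -> mu.-integrable `]a, x[ (EFin \o h).
  by move=> ih; exact: integrable_subitv ih _ _.
have c1 := @integral_weight r s _ _ C ir is_ hk1 (bmB b2 b2') (bmB b1 b1')
  (fun z az zb => (H z az zb).2) (fun z az zb => (H z az zb).1) x ax xb.
have c2 := @integral_weight s t _ _ C is_ it hk2 (bmB b2 b2') (bmB b1 b1')
  (fun z az zb => (H z az zb).2) (fun z az zb => (H z az zb).1) x ax xb.
split.
  apply: le_trans c1; rewrite /step/= /primitive_from opprD addrACA subrr add0r.
  rewrite -RintegralB//; [|exact: sub..].
  by rewrite le_eqVlt; apply/orP; left; apply/eqP; congr `|_|;
    apply: eq_Rintegral => z _; ring.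
(* The second component carries a minus sign, so its difference is taken in the opposite order. *)
rewrite distrC; apply: le_trans c2.
rewrite /step/= /primitive_from opprD addrACA subrr add0r.
rewrite -RintegralB//; [|exact: sub..].
by rewrite le_eqVlt; apply/orP; left; apply/eqP; congr `|_|;
  apply: eq_Rintegral => z _; ring.
Qed.

(** Picard iteration. In the weighted norm the contraction constant does not depend on the length of
    the interval, so the solution is obtained on all of [[a, b]] at once. *)
Lemma linear_ode_solution : exists y u : R -> R,
  [/\ is_primitive a b (fun x => r x * u x + s x * y x) y,
      is_primitive a b (fun x => - (s x * u x + t x * y x + g x)) u,
      y a = y0 & u a = u0].
Proof.
have [C HC] : exists C, forall n x, a <= x -> x <= b ->
    `|(W n.+1).1 x - (W n).1 x| <= C * 2^-1 ^+ n * E x /\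
    `|(W n.+1).2 x - (W n).2 x| <= C * 2^-1 ^+ n * E x.
  have [b01 b02] := W_bounded 0; have [b11 b12] := W_bounded 1.
  have [_ [M1 HM1]] := bmB b11 b01; have [_ [M2 HM2]] := bmB b12 b02.
  exists (`|M1| + `|M2|); elim=> [|n IH] x ax xb.
    rewrite expr0 mulr1.
    have h (M z : R) : `|z| <= M -> M <= `|M1| + `|M2| ->
        `|z| <= (`|M1| + `|M2|) * E x.
      move=> zM MM; apply: le_trans zM _; apply: le_trans MM _.
      by rewrite -[leLHS]mulr1 ler_wpM2l ?addr_ge0// E_ge1.
    split; [apply: h (HM1 x ax xb) _|apply: h (HM2 x ax xb) _].
      by rewrite (le_trans (ler_norm _))// lerDl.
    by rewrite (le_trans (ler_norm _))// lerDr.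
  have [b1 b2] := W_bounded n; have [b1' b2'] := W_bounded n.+1.
  have := step_contraction b1' b2' b1 b2 IH ax xb.
  by rewrite exprSr mulrA.
(* The limits are chosen point by point, with the value 0 outside [[a, b]]. *)
have lim1 x : exists l, a <= x -> x <= b ->
    forall n, `|l - (W n).1 x| <= 2 * (C * E x) * 2^-1 ^+ n.
  have [/andP[ax xb]|nab] := boolP (a <= x <= b); last first.
    by exists 0 => ax xb; rewrite ax xb in nab.
  have [n|l Hl] := @geometric_seq_limit _ (fun n => (W n).1 x) (C * E x).
    by have [h _] := HC n x ax xb; apply: le_trans h _; rewrite mulrAC.
  by exists l.
have lim2 x : exists l, a <= x -> x <= b ->
    forall n, `|l - (W n).2 x| <= 2 * (C * E x) * 2^-1 ^+ n.
  have [/andP[ax xb]|nab] := boolP (a <= x <= b); last first.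
    by exists 0 => ax xb; rewrite ax xb in nab.
  have [n|l Hl] := @geometric_seq_limit _ (fun n => (W n).2 x) (C * E x).
    by have [_ h] := HC n x ax xb; apply: le_trans h _; rewrite mulrAC.
  by exists l.
have [y Hy] := choice lim1; have [u Hu] := choice lim2.
have [ME ME0 EM] := is_primitive_bounded (ltW ab) pE.
have Jab x : `]a, b[%classic x -> a <= x /\ x <= b.
  by rewrite /= in_itv/= => /andP[? ?]; rewrite !ltW.
have bm (w : nat -> R -> R) (z : R -> R) :
    (forall n, bounded_measurable (w n)) ->
    (forall x, a <= x -> x <= b ->
       forall n, `|z x - w n x| <= 2 * (C * E x) * 2^-1 ^+ n) ->
    bounded_measurable z.
  move=> bw Hz; split.
    apply: (measurable_fun_cvg (fun n => (bw n).1)) => x /Jab[ax xb].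
    exact: geometric_limit_cvg (Hz x ax xb).
  have [_ [M HM]] := bw 0; exists (2 * (`|C| * ME) + M) => x ax xb.
  have := Hz x ax xb 0; rewrite expr0 mulr1 => h.
  have -> : z x = (z x - w 0 x) + w 0 x by rewrite subrK.
  apply: le_trans (ler_normD _ _) _; apply: lerD (HM x ax xb).
  apply: le_trans h _; rewrite ler_wpM2l//.
  apply: le_trans (ler_norm _) _; rewrite normrM ler_wpM2l//.
  exact: EM.
have by_ : bounded_measurable y by apply: bm Hy => n; have [] := W_bounded n.
have bu : bounded_measurable u by apply: bm Hu => n; have [] := W_bounded n.
(* The limit and its image under [step] both differ from the iterate [n + 1] by at most
   [C * E x * 2^-1 ^+ n], for every [n]. *)
have fixp x : a <= x -> x <= b -> y x = (step (y, u)).1 x /\ u x = (step (y, u)).2 x.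
  move=> ax xb; have H n : `|y x - (step (y, u)).1 x| <= (2 * (C * E x)) * 2^-1 ^+ n /\
      `|u x - (step (y, u)).2 x| <= (2 * (C * E x)) * 2^-1 ^+ n.
    have [b1 b2] := W_bounded n.
    have := @step_contraction (y, u) (W n) (2 * C * 2^-1 ^+ n) by_ bu b1 b2.
    move=> /(_ _ x ax xb)[z az zb|].
      have := Hy z az zb n; have := Hu z az zb n.
      by rewrite -!mulrA ![E z * _]mulrC => -> ->.
    move=> c1 c2; have := Hy x ax xb n.+1; have := Hu x ax xb n.+1.
    rewrite exprSr; set q := 2^-1 ^+ n in c1 c2 *.
    have -> : 2 * (C * E x) * (q / 2) = C * E x * q by field.
    have e : 2 * C * q / 2 * E x = C * E x * q by field.
    rewrite e in c1 c2; rewrite /= => h2 h1.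
    split.
      rewrite -(subrK ((W n.+1).1 x) (y x)) -addrA.
      apply: le_trans (ler_normD _ _) _; rewrite (distrC ((W n.+1).1 x)).
      by apply: le_trans (lerD h1 c1) _; lra.
    rewrite -(subrK ((W n.+1).2 x) (u x)) -addrA.
    apply: le_trans (ler_normD _ _) _; rewrite (distrC ((W n.+1).2 x)).
    by apply: le_trans (lerD h2 c2) _; lra.
  by split; apply/eqP; rewrite -subr_eq0; apply/eqP;
    apply: (@geometric_eq0 _ _ (2 * (C * E x))) => n;
    have [] := H n.
have [i1 i2] := @step_integrable (y, u) by_ bu.
have lab := ltW ab.
exists y, u; split.
- split => // x ax xb; rewrite (fixp x ax xb).1 (fixp a (lexx a) lab).1 /=.
  by rewrite primitive_from_a.
- split => // x ax xb; rewrite (fixp x ax xb).2 (fixp a (lexx a) lab).2 /=.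
  by rewrite primitive_from_a.
- by rewrite (fixp a (lexx a) lab).1 /= primitive_from_a.
- by rewrite (fixp a (lexx a) lab).2 /= primitive_from_a.
Qed.

End LinearODE.

(** * The Sturm-Liouville system *)

Section ComplexPrimitives.
Context {R : realType}.
Local Notation C := R[i].
Local Notation Re := (@complex.Re R).
Local Notation Im := (@complex.Im R).
Local Notation mu := (@lebesgue_measure R).
Variables (a b : R).
Hypothesis ab : a < b.
Implicit Types (f : R -> R) (h k F G : R -> C) (c : C).

Lemma is_primitive_cst (d : R) : is_primitive a b (fun=> 0) (fun=> d).
Proof.
split; first by rewrite (_ : _ \o _ = cst 0%E)//; exact: integrable0.
by move=> x ax xb; rewrite Rintegral_cst// mul0r addr0.
Qed.

(** Absolute continuity with tolerance [|f x|] keeps [f] nonzero on the part of a neighbourhood of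
    [x] inside the interval. This part has positive length even when [x] is an end point. *)
Lemma is_primitive_ae0 (h0 f : R -> R) : is_primitive a b h0 f ->
  ae_in a b (fun x => f x = 0) -> forall x, a <= x -> x <= b -> f x = 0.
Proof.
move=> pf f0 x ax xb; apply/eqP/negPn/negP => fx0.
have nfx : 0 < `|f x| by rewrite normr_gt0.
have [d d0 H] := is_primitive_ac pf nfx.
pose l := Num.max a (x - d / 2); pose m := Num.min b (x + d / 2).
have lm : l < m.
  by rewrite /l /m gt_max !lt_min ab/=; apply/andP; split;
    [|apply/andP; split]; lra.
have near_x y : l < y -> y < m -> f y != 0.
  rewrite /l /m gt_max lt_min => /andP[ay xy] /andP[yb yx].
  apply/eqP => fy0; have [xley|yltx] := leP x y.
    have := H [:: (x, y)].
    rewrite /= /subitv /family_length /family_variation !big_seq1/= ax xley (ltW yb).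
    by move=> /(_ isT isT); rewrite fy0 sub0r normrN ltxx => h;
      have /h : y - x < d by lra.
  have := H [:: (y, x)].
  rewrite /= /subitv /family_length /family_variation !big_seq1/= xb (ltW ay) (ltW yltx).
  by move=> /(_ isT isT); rewrite fy0 subr0 ltxx => h;
    have /h : x - y < d by lra.
have [N [mN N0 subN]] := f0.
have : (mu `]l, m[%classic <= mu N)%E.
  apply: le_measure; rewrite ?inE// => y; rewrite /= in_itv/= => /andP[ly ym].
  apply: subN => /= h; have /eqP := near_x _ ly ym; apply; apply: h.
  move: ly ym; rewrite /l /m gt_max lt_min => /andP[ay _] /andP[yb _].
  by rewrite in_itv/= ay yb.
by rewrite N0 lebesgue_measure_itv/= lte_fin lm -EFinB lee_fin leNgt subr_gt0 lm.
Qed.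

Lemma is_primitive_cst0 (h0 f : R -> R) : is_primitive a b h0 f ->
  (forall x, a <= x -> x <= b -> f x = 0) -> ae_in a b (fun x => h0 x = 0).
Proof.
move=> pf f0; apply: ae_in1 (is_primitive_is_derive pf) => x ax xb df.
have d0 : is_derive x 1 f 0.
  have : is_derive x 1 (cst 0 : R -> R) 0 by exact: is_derive_cst.
  apply: near_eq_is_derive; near=> y; rewrite f0//.
    by apply: ltW; near: y; exact: lt_nbhsr.
  by apply: ltW; near: y; exact: lt_nbhsl.
by have [_ <-] := df; have [_ ->] := d0.
Unshelve. all: by end_near. Qed.

Lemma complex_eta (z : C) : z = Re z +i* Im z.
Proof. by case: z. Qed.

Lemma cconjD (z w : C) : (z + w)^*%C = z^*%C + w^*%C.
Proof. exact: (rmorphD (@conjc R)). Qed.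

Lemma cconjM (z w : C) : (z * w)^*%C = z^*%C * w^*%C.
Proof. exact: (rmorphM (@conjc R)). Qed.

Lemma cconjN (z : C) : (- z)^*%C = - z^*%C.
Proof. exact: (rmorphN (@conjc R)). Qed.

Definition is_cprimitive h F :=
  is_primitive a b (Re \o h) (Re \o F) /\ is_primitive a b (Im \o h) (Im \o F).

Lemma is_primitive_ext (h0 h1 f0 f1 : R -> R) : h0 = h1 -> f0 = f1 ->
  is_primitive a b h0 f0 -> is_primitive a b h1 f1.
Proof. by move=> -> ->. Qed.

Lemma is_cprimitiveZD h k F G c : is_cprimitive h F -> is_cprimitive k G ->
  is_cprimitive (fun x => c * h x + k x) (fun x => c * F x + G x).
Proof.
move=> [rF iF] [rG iG]; split.
- have := is_primitiveZD (Re c) rF (is_primitiveZD (- Im c) iF rG).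
  by apply: is_primitive_ext; apply/funext => x /=; rewrite cReD cReM; ring.
- have := is_primitiveZD (Re c) iF (is_primitiveZD (Im c) rF iG).
  by apply: is_primitive_ext; apply/funext => x /=; rewrite cImD cImM; ring.
Qed.

Lemma is_cprimitive_cst c : is_cprimitive (fun=> 0) (fun=> c).
Proof. by split; exact: is_primitive_cst. Qed.

Lemma is_cprimitiveJ h F : is_cprimitive h F ->
  is_cprimitive (fun x => (h x)^*%C) (fun x => (F x)^*%C).
Proof.
move=> [rF iF]; split.
- by apply: is_primitive_ext rF; apply/funext => x /=; rewrite cReJ.
- have := is_primitiveZD (-1) iF (is_primitive_cst 0).
  by apply: is_primitive_ext; apply/funext => x /=; rewrite cImJ mulN1r addr0.
Qed.

Lemma is_cprimitiveM h k F G : is_cprimitive h F -> is_cprimitive k G ->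
  is_cprimitive (fun x => h x * G x + F x * k x) (fun x => F x * G x).
Proof.
move=> [rF iF] [rG iG]; split.
- have := is_primitiveZD (-1) (is_primitiveM ab iF iG) (is_primitiveM ab rF rG).
  by apply: is_primitive_ext; apply/funext => x /=; rewrite ?cReD !cReM; ring.
- have := is_primitiveZD 1 (is_primitiveM ab rF iG) (is_primitiveM ab iF rG).
  by apply: is_primitive_ext; apply/funext => x /=; rewrite ?cImD !cImM; ring.
Qed.

Lemma is_cprimitive_ae h k F : is_cprimitive h F -> cmeasurable a b k ->
  ae_eqJ a b h k -> is_cprimitive k F.
Proof.
move=> [rF iF] [mr mi] hk; split.
- by apply: is_primitive_ae rF mr _; apply: ae_in1 hk => x _ _ /= ->.
- by apply: is_primitive_ae iF mi _; apply: ae_in1 hk => x _ _ /= ->.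
Qed.

Lemma is_cprimitive_cmeasurable h F : is_cprimitive h F -> cmeasurable a b F.
Proof.
move=> [rF iF]; split; apply: real_ac_measurable.
- exact: is_primitive_ac rF.
- exact: is_primitive_ac iF.
Qed.

Lemma is_cprimitive_integral h F : is_cprimitive h F ->
  F b - F a = cintegral a b h.
Proof.
move=> [[_ rF] [_ iF]]; have := rF b (ltW ab) (lexx _); have := iF b (ltW ab) (lexx _).
rewrite /cintegral /=; case: (F b) => x y; case: (F a) => z w /= -> ->.
by congr (_ +i* _); rewrite addrAC subrr add0r.
Qed.

Lemma is_cprimitive_ae0 h F : is_cprimitive h F -> ae_eqJ a b F 0 ->
  forall x, a <= x -> x <= b -> F x = 0.
Proof.
move=> [rF iF] F0 x ax xb; apply/eqP; rewrite eq_complex; apply/andP; split.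
- apply/eqP; apply: (is_primitive_ae0 rF) => //.
  by apply: ae_in1 F0 => y _ _ /= ->.
- apply/eqP; apply: (is_primitive_ae0 iF) => //.
  by apply: ae_in1 F0 => y _ _ /= ->.
Qed.

Lemma is_cprimitive_cst0 h F : is_cprimitive h F ->
  (forall x, a <= x -> x <= b -> F x = 0) -> ae_eqJ a b h 0.
Proof.
move=> [rF iF] F0.
have r0 : ae_in a b (fun x => Re (h x) = 0).
  by apply: is_primitive_cst0 rF _ => x ax xb /=; rewrite F0.
have i0 : ae_in a b (fun x => Im (h x) = 0).
  by apply: is_primitive_cst0 iF _ => x ax xb /=; rewrite F0.
apply: ae_in2 r0 i0 => x _ _ hr hi.
by rewrite -[RHS]/(0 : C); case: (h x) hr hi => u v /= -> ->.
Qed.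

Lemma is_cprimitive_ac h F : is_cprimitive h F -> absolutely_continuous a b F.
Proof.
move=> [rF iF]; apply: real_ac_absolutely_continuous.
- exact: is_primitive_ac rF.
- exact: is_primitive_ac iF.
Qed.

Lemma is_cprimitive_cderive h F : is_cprimitive h F ->
  ae_eqJ a b (cderive F) h.
Proof.
move=> [rF iF].
apply: ae_in2 (is_primitive_is_derive rF) (is_primitive_is_derive iF).
move=> x _ _ [_ dr] [_ di]; rewrite /cderive !derive1E dr di /=.
by case: (h x).
Qed.

Lemma ac_is_cprimitive F k : absolutely_continuous a b F -> cmeasurable a b k ->
  ae_eqJ a b (cderive F) k -> is_cprimitive k F.
Proof.
move=> acF [mr mi] Fk; split.
- apply: real_ac_is_primitive => //; first exact: absolutely_continuous_Re.
  by apply: ae_in1 Fk => x _ _ /= <-.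
- apply: real_ac_is_primitive => //; first exact: absolutely_continuous_Im.
  by apply: ae_in1 Fk => x _ _ /= <-.
Qed.

Lemma ac_cmeasurable F : absolutely_continuous a b F -> cmeasurable a b F.
Proof.
move=> acF; split; apply: real_ac_measurable.
- exact: absolutely_continuous_Re.
- exact: absolutely_continuous_Im.
Qed.

End ComplexPrimitives.

(** * The first-order system and its Lagrange identity *)

Section QuasiDerivatives.
Context {R : realType}.
Local Notation C := R[i].
Local Notation Re := (@complex.Re R).
Local Notation Im := (@complex.Im R).
Local Notation mu := (@lebesgue_measure R).
Variables (a b : R).
Hypothesis ab : a < b.
Variables (r s t : R -> R).
Hypotheses (ir : mu.-integrable `]a, b[ (EFin \o r))
  (is_ : mu.-integrable `]a, b[ (EFin \o s))
  (it : mu.-integrable `]a, b[ (EFin \o t)).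
Implicit Types (y u z w g k : R -> C).

(* The first-order system equivalent to [l[y] = g] when [r = 1 / p],
   [s = Q / p] and [t = Q ^ 2 / p]; here [u] is the first quasi-derivative. *)
Definition sl_system y u g :=
  is_cprimitive a b (fun x => (r x)%:C * u x + (s x)%:C * y x) y /\
  is_cprimitive a b (fun x => - ((s x)%:C * u x + (t x)%:C * y x + g x)) u.

Lemma sl_systemZD c y u g z w k : sl_system y u g -> sl_system z w k ->
  sl_system (fun x => c * y x + z x) (fun x => c * u x + w x)
    (fun x => c * g x + k x).
Proof.
move=> [y1 u1] [y2 u2]; split.
  have := is_cprimitiveZD c y1 y2; congr is_cprimitive.
  by apply/funext => x; ring.
have := is_cprimitiveZD c u1 u2; congr is_cprimitive.
by apply/funext => x; ring.
Qed.

Lemma sl_system0 : sl_system (fun=> 0) (fun=> 0) (fun=> 0).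
Proof.
by split; have := is_cprimitive_cst a b (0 : C); congr is_cprimitive;
  apply/funext => x; rewrite ?mulr0 ?addr0 ?oppr0.
Qed.

(** Holds because the coefficients are real; this is the source of the symmetry of the minimal
    operator. *)
Lemma sl_systemJ y u g : sl_system y u g ->
  sl_system (fun x => (y x)^*%C) (fun x => (u x)^*%C) (fun x => (g x)^*%C).
Proof.
move=> [/is_cprimitiveJ y1 /is_cprimitiveJ u1].
have J (d : R) : (d%:C)^*%C = d%:C by rewrite /= oppr0.
split.
  move: y1; congr is_cprimitive; apply/funext => x.
  by rewrite cconjD !cconjM !J.
move: u1; congr is_cprimitive; apply/funext => x.
by rewrite cconjN !cconjD !cconjM !J.
Qed.

(** Real coefficients decouple the complex system into one for the real and one for the imaginary
    parts. *)
Lemma sl_system_exists g (y0 u0 : C) : cintegrable a b g ->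
  exists y u, [/\ sl_system y u g, y a = y0 & u a = u0].
Proof.
move=> [ig1 ig2].
have [y1 [u1 [py1 pu1 y1a u1a]]] :=
  linear_ode_solution ab ir is_ it (Re y0) (Re u0) ig1.
have [y2 [u2 [py2 pu2 y2a u2a]]] :=
  linear_ode_solution ab ir is_ it (Im y0) (Im u0) ig2.
exists (fun x => y1 x +i* y2 x), (fun x => u1 x +i* u2 x); split.
- split; split.
  + by apply: is_primitive_ext py1; apply/funext => x //=; rewrite !mul0r !subr0.
  + by apply: is_primitive_ext py2; apply/funext => x //=; rewrite !mul0r !addr0.
  + apply: is_primitive_ext pu1; apply/funext => x //=.
    by case: (g x) => g1 g2 /=; rewrite !mul0r !subr0.
  + apply: is_primitive_ext pu2; apply/funext => x //=.
    by case: (g x) => g1 g2 /=; rewrite !mul0r !addr0.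
- by rewrite y1a y2a [RHS]complex_eta.
- by rewrite u1a u2a [RHS]complex_eta.
Qed.

(** The sesquilinear Wronskian of [(y, u)] and [(z, w)], with [u] and [w] as quasi-derivatives. *)
Definition boundary_form y u z w (x : R) : C := y x * (w x)^*%C - u x * (z x)^*%C.

(** The product rule for the conjugated second system: all terms with [r], [s] and [t] cancel. *)
Lemma sl_lagrange y u g z w k : sl_system y u g -> sl_system z w k ->
  is_cprimitive a b (fun x => g x * (z x)^*%C - y x * (k x)^*%C)
    (boundary_form y u z w).
Proof.
move=> [y1 u1] /sl_systemJ[z1 w1].
have := is_cprimitiveZD (-1) (is_cprimitiveM ab u1 z1) (is_cprimitiveM ab y1 w1).
congr is_cprimitive; apply/funext => x; first by ring.
by rewrite /boundary_form mulN1r addrC.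
Qed.

Lemma sl_lagrange_integral y u g z w k : sl_system y u g -> sl_system z w k ->
  square_integrable a b y -> square_integrable a b g ->
  square_integrable a b z -> square_integrable a b k ->
  boundary_form y u z w b - boundary_form y u z w a =
  fdot a b g z - fdot a b y k.
Proof.
move=> sl1 sl2 sy sg sz sk.
rewrite (is_cprimitive_integral ab (sl_lagrange sl1 sl2)).
have := cintegral_lin (-1) (cintegrable_dot sy sk) (cintegrable_dot sg sz).
rewrite mulN1r addrC => <-; congr cintegral.
by apply/funext => x; rewrite mulN1r addrC.
Qed.

End QuasiDerivatives.

(** * Quasi-derivatives in integral form *)

Section MaximalOperator.
Context {R : realType}.
Local Notation C := R[i].
Local Notation Re := (@complex.Re R).
Local Notation Im := (@complex.Im R).
Local Notation mu := (@lebesgue_measure R).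
Variables (a b : R).
Hypothesis ab : a < b.
Variables (p Q r s t : R -> R).
Hypotheses (ir : mu.-integrable `]a, b[ (EFin \o r))
  (is_ : mu.-integrable `]a, b[ (EFin \o s))
  (it : mu.-integrable `]a, b[ (EFin \o t)).
Hypotheses (p0 : ae_in a b (fun x => p x != 0))
  (rE : ae_in a b (fun x => r x = (p x)^-1))
  (sE : ae_in a b (fun x => s x = Q x / p x))
  (tE : ae_in a b (fun x => t x = Q x ^+ 2 / p x)).
Implicit Types (y u z w g k : R -> C) (f : L2 a b).

Let mr : measurable_fun `]a, b[ r.
Proof. by apply/measurable_EFinP; exact: measurable_int ir. Qed.
Let ms : measurable_fun `]a, b[ s.
Proof. by apply/measurable_EFinP; exact: measurable_int is_. Qed.
Let mt : measurable_fun `]a, b[ t.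
Proof. by apply/measurable_EFinP; exact: measurable_int it. Qed.

Lemma cmeasurableD y z : cmeasurable a b y -> cmeasurable a b z ->
  cmeasurable a b (fun x => y x + z x).
Proof.
move=> my mz; have := cmeasurable_lin 1 my mz; congr cmeasurable.
by apply/funext => x; rewrite -[RHS]/(y x + z x) -[y x in RHS]mul1r.
Qed.

Lemma cmeasurableN y : cmeasurable a b y -> cmeasurable a b (fun x => - y x).
Proof.
move=> my; have m0 : cmeasurable a b (fun=> 0 : C).
  by split; exact: measurable_cst.
have := cmeasurable_lin (-1) my m0; congr cmeasurable.
by apply/funext => x; rewrite -[LHS]/(-1 * y x + 0) mulN1r addr0.
Qed.

Lemma cmeasurable_scale (h : R -> R) y : measurable_fun `]a, b[ h ->
  cmeasurable a b y -> cmeasurable a b (fun x => (h x)%:C * y x).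
Proof.
move=> mh [m1 m2]; split.
- rewrite (_ : _ \o _ = (fun x => h x * Re (y x))); first exact: measurable_funM.
  by apply/funext => x /=; rewrite cReM /= mul0r subr0.
- rewrite (_ : _ \o _ = (fun x => h x * Im (y x))); first exact: measurable_funM.
  by apply/funext => x /=; rewrite cImM /= mul0r addr0.
Qed.

Let real_coef (x y : R) : (x * y)%:C = x%:C * y%:C.
Proof. exact: (rmorphM (@real_complex R)). Qed.

(** Solving the definition of the quasi-derivatives for [y'] and [u'] gives the system almost
    everywhere; dividing by [p] is allowed since it is nonzero there. To pass from derivatives to
    integrals the right-hand sides must be Borel, hence [r], [s], [t] in place of the quotients. *)
Lemma L_restrE (bc : (R -> C) -> (R -> C) -> Prop) (f g : L2 a b) :
  L_restr a b p Q bc (f, g) <->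
  exists y u, [/\ sl_system a b r s t y u (repr g), represents f y & bc y u].
Proof.
have [mgr mgi] : cmeasurable a b (repr g) by have [] := L2fun_sqint (repr g).
split=> [[y [u [acy [acu uE] /= fy gE bcyu]]]|[y [u [[py pu] fy bcyu]]]].
- have my := ac_cmeasurable acy; have mu_ := ac_cmeasurable acu.
  exists y, u; split => //; split.
    apply: ac_is_cprimitive => //.
      by apply: cmeasurableD; exact: cmeasurable_scale.
    have h : ae_in a b (fun x => [/\ p x != 0, r x = (p x)^-1 & s x = Q x / p x]).
      by apply: ae_in3 p0 rE sE => x.
    apply: ae_in2 uE h => x _ _ -> [px -> ->]; rewrite /qderiv1 real_coef.
    have pp : ((p x)^-1)%:C * (p x)%:C = 1 by rewrite -real_coef mulVf.
    by rewrite mulrBr mulrA pp mul1r; ring.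
  apply: ac_is_cprimitive => //.
    apply: cmeasurableN; apply: cmeasurableD; last by split.
    by apply: cmeasurableD; exact: cmeasurable_scale.
  apply: ae_in3 gE sE tE => x _ _ gx -> ->.
  rewrite gx -[X in _ + X]/(- qderiv2 p Q y u x) /qderiv2; ring.
- exists y, u; have cy := is_cprimitive_cderive py; have cu := is_cprimitive_cderive pu.
  split => //.
  + exact: is_cprimitive_ac py.
  + split; first exact: is_cprimitive_ac pu.
    have h : ae_in a b (fun x => [/\ p x != 0, r x = (p x)^-1 & s x = Q x / p x]).
      by apply: ae_in3 p0 rE sE => x.
    apply: ae_in2 cy h => x _ _ cyx [px rx sx]; rewrite /qderiv1 cyx rx sx.
    have pp : (p x)%:C * ((p x)^-1)%:C = 1 by rewrite -real_coef mulfV.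
    rewrite real_coef; set P := (p x)%:C in pp *; set I := _^-1%:C in pp *.
    have -> : P * (I * u x + (Q x)%:C * I * y x) - (Q x)%:C * y x =
      P * I * u x + P * I * ((Q x)%:C * y x) - (Q x)%:C * y x by ring.
    by rewrite pp; ring.
  + apply: ae_in3 cu sE tE => x _ _ cux sx tx.
    rewrite -[RHS]/(- qderiv2 p Q y u x) /qderiv2 cux sx tx /=; ring.
Qed.

End MaximalOperator.

Section SquareIntegrableClasses.
Local Open Scope quotient_scope.
Context {R : realType}.
Local Notation C := R[i].
Local Notation Re := (@complex.Re R).
Local Notation Im := (@complex.Im R).
Local Notation mu := (@lebesgue_measure R).
Variables (a b : R).
Implicit Types (y z : R -> C) (f g : L2 a b) (c : C).

Lemma L2_exists y : square_integrable a b y -> exists f, represents f y.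
Proof.
move=> sy; have yP : y \in L2pred a b by apply/asboolP.
exists (\pi_(L2 a b) (MkL2fun yP)); apply/(L2_eqP _ (MkL2fun yP)).
by rewrite reprK.
Qed.

Lemma represents_repr f : represents f (repr f).
Proof. by apply: aeW. Qed.

Lemma represents_eq f g y : represents f y -> represents g y -> f = g.
Proof.
move=> fy gy; rewrite -[f]reprK -[g]reprK; apply/eqP/L2_eqP.
by apply: ae_eqJ2 fy gy => x -> ->.
Qed.

Lemma representsZD c f g y z : represents f y -> represents g z ->
  represents (c *: f + g) (fun x => c * y x + z x).
Proof.
move=> fy gz; have e : ae_eqJ a b (repr (c *: f + g)) (c *: repr f + repr g).
  apply/(L2_eqP _ (c *: repr f + repr g)).
  by rewrite reprK (raddfD \pi_(L2 a b)) /= pi_L2scale !reprK.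
have h : ae_eqJ a b (c *: repr f + repr g : L2fun a b) (fun x => c * y x + z x).
  by apply: ae_eqJ2 fy gz => x <- <-.
by apply: ae_eqJ2 e h => x -> ->.
Qed.

Lemma represents0 : represents (0 : L2 a b) (fun=> 0).
Proof.
have := representsZD (-1) (represents_repr 0) (represents_repr 0).
rewrite scaler0 addr0; apply: ae_in1 => x _ _ ->.
by rewrite mulN1r addNr.
Qed.

Lemma L2dot_represents f g y z : square_integrable a b y ->
  square_integrable a b z -> represents f y -> represents g z ->
  L2dot f g = fdot a b y z.
Proof. by move=> sy sz fy gz; apply: fdot_ae => //; exact: L2fun_sqint. Qed.

Lemma square_integrable_cintegrable y : square_integrable a b y ->
  cintegrable a b y.
Proof.
move=> sy; have s1 : square_integrable a b (fun=> 1 : C).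
  split; first by split; exact: measurable_cst.
  rewrite (_ : _ \o _ = cst 1%E).
    by apply/integrableP; split => //=; rewrite integral_cst//= normr1 mul1e
      lebesgue_measure_itv/=; case: ifP => _; rewrite -?EFinB ltry.
  by apply/funext => x /=; rewrite expr1n expr0n/= addr0.
have := cintegrable_dot sy s1; congr cintegrable.
by apply/funext => x; rewrite -[RHS]mulr1; congr (_ * _); exact: conjc1.
Qed.

Lemma is_cprimitive_square_integrable h F : a < b -> is_cprimitive a b h F ->
  square_integrable a b F.
Proof.
move=> ab pF; have mF := is_cprimitive_cmeasurable pF; split => //.
have [rF iF] := pF.
have [M M0 FM] := is_primitive_bounded (ltW ab) rF.
have [N N0 FN] := is_primitive_bounded (ltW ab) iF.
have muJ : (mu `]a, b[%classic < +oo)%E.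
  by rewrite lebesgue_measure_itv/= lte_fin ab -EFinB ltry.
apply: measurable_bounded_integrable => //.
- exact: cmeasurable_sqr.
- exists (M ^+ 2 + N ^+ 2); split; first exact: num_real.
  move=> K MK x; rewrite /= in_itv/= => /andP[ax xb].
  have := FM x (ltW ax) (ltW xb); have := FN x (ltW ax) (ltW xb).
  rewrite /= => h1 h2; rewrite ger0_norm ?addr_ge0 ?sqr_ge0//.
  apply: le_trans (ltW MK); rewrite -(real_normK (num_real (Re _))).
  by rewrite -(real_normK (num_real (Im _))) lerD// lerXn2r// nnegrE.
Qed.

End SquareIntegrableClasses.

(** * The maximal operator together with its boundary values *)

Section BoundaryValues.
Context {R : realType}.
Local Notation C := R[i].
Local Notation mu := (@lebesgue_measure R).
Variables (a b : R).
Hypothesis ab : a < b.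
Variables (r s t : R -> R).
Hypotheses (ir : mu.-integrable `]a, b[ (EFin \o r))
  (is_ : mu.-integrable `]a, b[ (EFin \o s))
  (it : mu.-integrable `]a, b[ (EFin \o t)).
Hypothesis r0 : ae_in a b (fun x => r x != 0).
Implicit Types (y u z w : R -> C) (f g : L2 a b) (c : C).

(** A relation, because end point values belong to the absolutely continuous representatives and not
    to the class [f]. With linearity, [boundary_values_uniq] makes it single-valued in [f]. *)
Definition boundary_values f g ya ua yb ub := exists y u,
  [/\ sl_system a b r s t y u (repr g), represents f y &
      [/\ y a = ya, u a = ua, y b = yb & u b = ub]].

(** Needed because [repr] of a linear combination equals the combination of the representatives only
    almost everywhere. *)
Lemma sl_system_ae y u (g0 g1 : R -> C) : sl_system a b r s t y u g0 ->
  cmeasurable a b g0 -> cmeasurable a b g1 -> ae_eqJ a b g0 g1 ->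
  sl_system a b r s t y u g1.
Proof.
move=> [py pu] m0 m1 g01; split => //; apply: is_cprimitive_ae (pu) _ _.
  have mh : cmeasurable a b (fun x => - ((s x)%:C * u x + (t x)%:C * y x + g0 x)).
    by have [rp ip] := pu; split; apply: is_primitive_measurable;
      [exact: rp|exact: ip].
  have := cmeasurableD mh (cmeasurableD m0 (cmeasurableN m1)).
  by congr cmeasurable; apply/funext => x; ring.
by apply: ae_in1 g01 => x _ _ /= ->.
Qed.

Lemma repr_cmeasurable f : cmeasurable a b (repr f).
Proof. by have [] := L2fun_sqint (repr f). Qed.

Lemma boundary_valuesZD c f g f' g' ya ua yb ub ya' ua' yb' ub' :
  boundary_values f g ya ua yb ub -> boundary_values f' g' ya' ua' yb' ub' ->
  boundary_values (c *: f + f') (c *: g + g')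
    (c * ya + ya') (c * ua + ua') (c * yb + yb') (c * ub + ub').
Proof.
move=> [y [u [sl1 fy [<- <- <- <-]]]] [z [w [sl2 fz [<- <- <- <-]]]].
exists (fun x => c * y x + z x), (fun x => c * u x + w x); split => //.
- apply: sl_system_ae (sl_systemZD c sl1 sl2) _ _ _.
  + by have [m1 m2] := cmeasurable_lin c (repr_cmeasurable g) (repr_cmeasurable g').
  + exact: repr_cmeasurable.
  + have := representsZD c (represents_repr g) (represents_repr g').
    by apply: ae_in1 => x _ _ /= ->.
- exact: representsZD.
Qed.

Lemma boundary_values0 : boundary_values 0 0 0 0 0 0.
Proof.
exists (fun=> 0), (fun=> 0); split => //; last exact: represents0.
apply: sl_system_ae (sl_system0 a b r s t) _ (repr_cmeasurable 0) _.
  by split; exact: measurable_cst.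
by apply: ae_in1 (represents0 a b) => x _ _ /= ->.
Qed.

Lemma boundary_values_green f g f' g' ya ua yb ub za wa zb wb :
  boundary_values f g ya ua yb ub -> boundary_values f' g' za wa zb wb ->
  L2dot g f' - L2dot f g' =
  (yb * wb^*%C - ub * zb^*%C) - (ya * wa^*%C - ua * za^*%C).
Proof.
move=> [y [u [sl1 fy [<- <- <- <-]]]] [z [w [sl2 fz [<- <- <- <-]]]].
have sy := is_cprimitive_square_integrable ab sl1.1.
have sz := is_cprimitive_square_integrable ab sl2.1.
have sg := L2fun_sqint (repr g); have sg' := L2fun_sqint (repr g').
rewrite (L2dot_represents sg sz (represents_repr g) fz).
rewrite (L2dot_represents sy sg' fy (represents_repr g')).
by rewrite -(sl_lagrange_integral ab sl1 sl2).
Qed.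

(** A continuous [y] that vanishes almost everywhere is 0. Then [r * u = 0] almost everywhere, so
    [u = 0] since [r] is nonzero, and the second equation leaves [g = 0]. *)
Lemma boundary_values_uniq g ya ua yb ub : boundary_values 0 g ya ua yb ub ->
  [/\ ya = 0, ua = 0, yb = 0, ub = 0 & g = 0].
Proof.
move=> [y [u [[py pu] fy [<- <- <- <-]]]].
have y0 : forall x, a <= x -> x <= b -> y x = 0.
  apply: (is_cprimitive_ae0 ab py).
  by apply: ae_eqJ2 fy (represents0 a b) => x <- ->.
have u0 : forall x, a <= x -> x <= b -> u x = 0.
  apply: (is_cprimitive_ae0 ab pu); have h := is_cprimitive_cst0 py y0.
  apply: ae_in2 h r0 => x ax xb; rewrite y0 ?ltW// mulr0 addr0 => /eqP.
  by rewrite -[X in _ == X]/(0 : C) mulf_eq0 => /orP[/eqP[->]|/eqP//]; rewrite eqxx.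
have g0 : represents g (fun=> 0).
  apply: ae_in1 (is_cprimitive_cst0 pu u0) => x ax xb.
  rewrite y0 ?ltW// u0 ?ltW// !mulr0 !add0r => /eqP.
  by rewrite -[X in _ == X]/(0 : C) oppr_eq0 => /eqP.
split; [apply: y0|apply: u0|apply: y0|apply: u0|] => //; rewrite ?ltW//.
exact: represents_eq g0 (represents0 a b).
Qed.

Lemma boundary_values_exists g ya ua : exists f yb ub,
  boundary_values f g ya ua yb ub.
Proof.
have ig := square_integrable_cintegrable (L2fun_sqint (repr g)).
have [y [u [sl ya_ ua_]]] := sl_system_exists ab ir is_ it ya ua ig.
have [f fy] := L2_exists (is_cprimitive_square_integrable ab sl.1).
by exists f, (y b), (u b), y, u.
Qed.

End BoundaryValues.

(** * Kernel, range and adjoint *)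

Section DotProduct.
Context {R : realType} {H : lmodType R[i]}.
Local Notation C := R[i].
Variable dot : {dot H for (@conjc R)}.
Implicit Types (u v w e z : H) (c : C).

Lemma dotZDl c u v w : dot (c *: u + v) w = c * dot u w + dot v w.
Proof. by rewrite linearDl linearZl_LR. Qed.

Lemma dotBl u v w : dot (u - v) w = dot u w - dot v w.
Proof. by rewrite linearBl. Qed.

Lemma dotZl c u w : dot (c *: u) w = c * dot u w.
Proof. by rewrite linearZl_LR. Qed.

Lemma dotC u v : dot u v = (dot v u)^*%C.
Proof. by rewrite hermC expr0 mul1r. Qed.

Lemma dot0l w : dot 0 w = 0.
Proof. by rewrite linear0l. Qed.

Lemma dot0r w : dot w 0 = 0.
Proof. by rewrite dotC dot0l conjc0. Qed.

Lemma dotZDr c u v w : dot w (c *: u + v) = c^*%C * dot w u + dot w v.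
Proof. by rewrite dotC dotZDl cconjD cconjM -!(dotC w). Qed.

Lemma dot_eq0 u : dot u u = 0 -> u = 0.
Proof.
move=> u0; apply/eqP/negPn/negP; rewrite -(dnorm_gt0 dot).
by rewrite u0 ltxx.
Qed.

Lemma dot_neq0 u : u != 0 -> dot u u != 0.
Proof. by rewrite -(dnorm_gt0 dot); exact: lt0r_neq0. Qed.

Lemma dot_sym0 u v : dot u v = 0 -> dot v u = 0.
Proof. by move=> uv; rewrite dotC uv conjc0. Qed.

Lemma orthogonal_projection1 e z : exists c, dot (z - c *: e) e = 0.
Proof.
have [->|e0] := eqVneq e 0; first by exists 0; rewrite dot0r.
by exists (dot z e / dot e e); rewrite dotBl dotZl divfK ?subrr// dot_neq0.
Qed.

Lemma projection_dot c e z : dot (z - c *: e) e = 0 ->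
  dot (z - c *: e) z = dot (z - c *: e) (z - c *: e).
Proof.
set x := z - _ => xe; have zE : z = c *: e + x by rewrite /x addrC subrK.
by rewrite [in LHS]zE dotZDr xe mulr0 add0r.
Qed.

(** Gram-Schmidt. The reduced vector [e] may be 0, so the case of dependent [e1] and [e2] is
    included. *)
Lemma orthogonal_projection2 e1 e2 z : exists c1 c2,
  dot (z - (c1 *: e1 + c2 *: e2)) e1 = 0 /\
  dot (z - (c1 *: e1 + c2 *: e2)) e2 = 0.
Proof.
have [d d0] := orthogonal_projection1 e1 e2.
have [c c0] := orthogonal_projection1 e1 z.
pose e := e2 - d *: e1; have [k k0] := orthogonal_projection1 e (z - c *: e1).
exists (c - k * d), k.
have -> : z - ((c - k * d) *: e1 + k *: e2) = z - c *: e1 - k *: e.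
  rewrite /e scalerBr scalerBl scalerA !opprD !opprK !addrA.
  by rewrite -!addrA; congr (_ + (_ + _)); rewrite addrC.
have z1 : dot (z - c *: e1 - k *: e) e1 = 0.
  by rewrite dotBl c0 dotZl d0 mulr0 subrr.
split => //; have -> : e2 = d *: e1 + e by rewrite /e addrC subrK.
by rewrite dotZDr z1 k0 mulr0 addr0.
Qed.

End DotProduct.

(** * Adjoint and boundary values, from Green's identity and the initial value problem *)

Section BoundaryTriple.
Context {R : realType} {H : lmodType R[i]}.
Local Notation C := R[i].
Variable dot : {dot H for (@conjc R)}.
(* [bv f g ya ua yb ub] : the maximal operator maps [f] to [g], and
   [ya], [ua], [yb], [ub] are the values of [f] and of its first
   quasi-derivative at the two end points. *)
Variable bv : H -> H -> C -> C -> C -> C -> Prop.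
Hypothesis bvZD : forall c f g f' g' ya ua yb ub ya' ua' yb' ub',
  bv f g ya ua yb ub -> bv f' g' ya' ua' yb' ub' ->
  bv (c *: f + f') (c *: g + g')
    (c * ya + ya') (c * ua + ua') (c * yb + yb') (c * ub + ub').
Hypothesis bv0 : bv 0 0 0 0 0 0.
Hypothesis bv_green : forall f g f' g' ya ua yb ub za wa zb wb,
  bv f g ya ua yb ub -> bv f' g' za wa zb wb ->
  dot g f' - dot f g' =
  (yb * wb^*%C - ub * zb^*%C) - (ya * wa^*%C - ua * za^*%C).
Hypothesis bv_uniq : forall g ya ua yb ub, bv 0 g ya ua yb ub ->
  [/\ ya = 0, ua = 0, yb = 0, ub = 0 & g = 0].
Hypothesis bv_exists : forall g ya ua, exists f yb ub, bv f g ya ua yb ub.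

Lemma bvZ c f g ya ua yb ub : bv f g ya ua yb ub ->
  bv (c *: f) (c *: g) (c * ya) (c * ua) (c * yb) (c * ub).
Proof. by move=> h; have := bvZD c h bv0; rewrite !addr0. Qed.

Lemma bvB f g f' g' ya ua yb ub ya' ua' yb' ub' :
  bv f g ya ua yb ub -> bv f' g' ya' ua' yb' ub' ->
  bv (f - f') (g - g') (ya - ya') (ua - ua') (yb - yb') (ub - ub').
Proof.
move=> h h'; have := bvZD (-1) h' h.
by rewrite !scaleN1r !mulN1r ![- _ + _]addrC.
Qed.

(* Green's identity for the pairs of basis functions gives [|W| ^ 2 = 1] for
   their Wronskian [W] at the right end point. *)
Let kernel_basis : exists e1 e2 (y1 u1 y2 u2 : C),
  [/\ bv e1 0 1 0 y1 u1, bv e2 0 0 1 y2 u2 & y1 * u2 - u1 * y2 != 0].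
Proof.
have [e1 [y1 [u1 b1]]] := bv_exists 0 1 0.
have [e2 [y2 [u2 b2]]] := bv_exists 0 0 1.
exists e1, e2, y1, u1, y2, u2; split => //; apply/eqP => w0.
have := bv_green b1 b1; have := bv_green b1 b2.
have := bv_green b2 b1; have := bv_green b2 b2.
rewrite !dot0l !dot0r !conjc0 !conjc1 !mulr0 !mul0r !mulr1 !subr0 !sub0r opprK.
move=> h22 h21 h12 h11.
(* The Gram determinant of the form [y * conj w - u * conj z] in [(y1, u1)] and [(y2, u2)]: the
   matrix of the form has determinant 1, so [|W| ^ 2] remains. *)
have : (y1 * u2 - u1 * y2) * (y1 * u2 - u1 * y2)^*%C =
  (y1 * u1^*%C - u1 * y1^*%C) * (y2 * u2^*%C - u2 * y2^*%C) -
  (y1 * u2^*%C - u1 * y2^*%C) * (y2 * u1^*%C - u2 * y1^*%C).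
  by rewrite cconjD cconjN !cconjM; ring.
have e12 : y1 * u2^*%C - u1 * y2^*%C = 1.
  by apply/eqP; rewrite -subr_eq0 -h12 eqxx.
have e21 : y2 * u1^*%C - u2 * y1^*%C = -1.
  by apply/eqP; rewrite -subr_eq0 opprK -h21 eqxx.
rewrite w0 mul0r e12 e21 -h11 mul0r sub0r mulrN1 opprK => /eqP.
by rewrite eq_sym oner_eq0.
Qed.

(* Cramer's rule. *)
Let cramer (y u y1 u1 y2 u2 : C) : y1 * u2 - u1 * y2 != 0 ->
  y * u1^*%C - u * y1^*%C = 0 -> y * u2^*%C - u * y2^*%C = 0 -> y = 0 /\ u = 0.
Proof.
move=> w0 h1 h2; have cw : (y1 * u2 - u1 * y2)^*%C != 0 by rewrite conjc_eq0.
split; apply: (mulIf cw); rewrite mul0r.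
- transitivity (y1^*%C * (y * u2^*%C - u * y2^*%C) -
    y2^*%C * (y * u1^*%C - u * y1^*%C)); last by rewrite h1 h2 !mulr0 subrr.
  by rewrite cconjD cconjN !cconjM; ring.
- transitivity (u1^*%C * (y * u2^*%C - u * y2^*%C) -
    u2^*%C * (y * u1^*%C - u * y1^*%C)); last by rewrite h1 h2 !mulr0 subrr.
  by rewrite cconjD cconjN !cconjM; ring.
Qed.

(* The range of the minimal operator is the orthogonal of the kernel of the
   maximal one, so that [z] lies in this kernel. *)
Let range_orthogonal z : (forall v k, bv v k 0 0 0 0 -> dot z k = 0) ->
  exists ya ua yb ub, bv z 0 ya ua yb ub.
Proof.
move=> zperp; have [e1 [e2 [y1 [u1 [y2 [u2 [b1 b2 w0]]]]]]] := kernel_basis.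
have [c1 [c2 [k1 k2]]] := orthogonal_projection2 dot e1 e2 z.
set n := c1 *: e1 + c2 *: e2 in k1 k2; set k := z - n in k1 k2.
have bn := bvZD c1 b1 (bvZ c2 b2); rewrite -/n scaler0 scaler0 addr0 in bn.
(* As [k] is orthogonal to the kernel, Green's identity against [e1] and [e2] makes the values of
   [v] at [b] vanish too. Hence [k] is in the minimal range and orthogonal to [z], thus to
   itself. *)
have [v [yb [ub bvv]]] := bv_exists k 0 0.
have g1 := bv_green bvv b1; have g2 := bv_green bvv b2.
rewrite k1 dot0r !mul0r !subr0 in g1; rewrite k2 dot0r !mul0r !subr0 in g2.
have [yb0 ub0] := cramer w0 (esym g1) (esym g2).
rewrite yb0 ub0 in bvv; have zk := zperp _ _ bvv.
have nk : dot n k = 0.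
  apply: dot_sym0; rewrite /n.
  by rewrite dotZDr k1 mulr0 add0r -[c2 *: e2]addr0 dotZDr k2 dot0r mulr0 addr0.
have : k = 0 by apply: (dot_eq0 (dot := dot)); rewrite {1}/k dotBl zk nk subrr.
by move/eqP; rewrite subr_eq0 => /eqP ->; do 4 eexists; exact: bn.
Qed.

(** With [w] mapped to [h], Green's identity turns the assumption into orthogonality of [f - w] to
    the minimal range, so [f - w] is in the kernel. *)
Lemma minimal_adjoint f h :
  (forall v k, bv v k 0 0 0 0 -> dot h v = dot f k) ->
  exists ya ua yb ub, bv f h ya ua yb ub.
Proof.
move=> adj; have [w [yb [ub bw]]] := bv_exists h 0 0.
have [v k bvv|ya' [ua' [yb' [ub' bz]]]] := @range_orthogonal (f - w).
  have := bv_green bw bvv; rewrite !conjc0 !mulr0 !subrr dotBl.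
  by rewrite (adj _ _ bvv) => ->.
have := bvZD 1 bz bw; rewrite !scale1r subrK add0r => h'.
by do 4 eexists; exact: h'.
Qed.

(** If [w] is mapped to [f], Green's identity makes [w] orthogonal to the minimal range. So [w] is
    in the kernel as well, and its image [f] is 0. *)
Lemma minimal_domain_orthogonal f :
  (forall v k, bv v k 0 0 0 0 -> dot f v = 0) -> f = 0.
Proof.
move=> fperp; have [w [yb [ub bw]]] := bv_exists f 0 0.
have [v k bvv|ya' [ua' [yb' [ub' bz]]]] := @range_orthogonal w.
  have := bv_green bw bvv; rewrite !conjc0 !mulr0 !subrr.
  by rewrite (fperp _ _ bvv) sub0r => /eqP; rewrite oppr_eq0 => /eqP.
have := bvB bw bz; rewrite subrr subr0 => /bv_uniq.
by case.
Qed.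

(** Values at [a] are free. With zero data at [a], Green's identity expresses the values at [b]
    through the products of the right-hand side with the kernel basis, and these can be
    prescribed. *)
Lemma boundary_surjective ya ua yb ub : exists f g, bv f g ya ua yb ub.
Proof.
have [e1 [e2 [y1 [u1 [y2 [u2 [b1 b2 w0]]]]]]] := kernel_basis.
(* Up to scaling, [e1 - d1 *: e2] and [e2 - d2 *: e1] form the dual basis of [e1], [e2]; uniqueness
   makes them nonzero. *)
have [d1 h1] := orthogonal_projection1 dot e2 e1.
have [d2 h2] := orthogonal_projection1 dot e1 e2.
have e1' : e1 - d1 *: e2 != 0.
  apply/eqP => e0; have := bvB b1 (bvZ d1 b2).
  by rewrite e0 => /bv_uniq[/eqP]; rewrite mulr0 subr0 oner_eq0.
have e2' : e2 - d2 *: e1 != 0.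
  apply/eqP => e0; have := bvB b2 (bvZ d2 b1).
  by rewrite e0 => /bv_uniq[_ /eqP]; rewrite mulr0 subr0 oner_eq0.
have n1 : dot (e1 - d1 *: e2) e1 != 0 by rewrite projection_dot// dot_neq0.
have n2 : dot (e2 - d2 *: e1) e2 != 0 by rewrite projection_dot// dot_neq0.
have at_b y u : exists f g, bv f g 0 0 y u.
  pose t1 := y * u1^*%C - u * y1^*%C; pose t2 := y * u2^*%C - u * y2^*%C.
  pose k := (t1 / dot (e1 - d1 *: e2) e1) *: (e1 - d1 *: e2) +
            (t2 / dot (e2 - d2 *: e1) e2) *: (e2 - d2 *: e1).
  have k1 : dot k e1 = t1.
    by rewrite dotZDl dotZl h2 mulr0 addr0 divfK.
  have k2 : dot k e2 = t2.
    by rewrite dotZDl dotZl h1 mulr0 add0r divfK.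
  have [v [y' [u' bvv]]] := bv_exists k 0 0.
  have g1 := bv_green bvv b1; have g2 := bv_green bvv b2.
  rewrite k1 dot0r !mul0r !subr0 /t1 in g1; rewrite k2 dot0r !mul0r !subr0 /t2 in g2.
  have [|| yy uu] := @cramer (y - y') (u - u') _ _ _ _ w0.
  - transitivity ((y * u1^*%C - u * y1^*%C) - (y' * u1^*%C - u' * y1^*%C)).
      by ring.
    by rewrite g1 subrr.
  - transitivity ((y * u2^*%C - u * y2^*%C) - (y' * u2^*%C - u' * y2^*%C)).
      by ring.
    by rewrite g2 subrr.
  exists v, k; move/eqP: yy; move/eqP: uu; rewrite !subr_eq0.
  by move=> /eqP -> /eqP ->.
have [w [yb0 [ub0 bw]]] := bv_exists 0 ya ua.
have [v [k bvv]] := at_b (yb - yb0) (ub - ub0).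
have := bvZD 1 bvv bw; rewrite !mul1r !subrK !add0r => h.
by do 2 eexists; exact: h.
Qed.

End BoundaryTriple.

(** * Density of the minimal domain *)

Section OrthogonalDense.
Context {R : realType} {H : lmodType R[i]}.
Local Notation C := R[i].
Local Notation Re := (@complex.Re R).
Local Notation Im := (@complex.Im R).
Variable dot : {dot H for (@conjc R)}.
Implicit Types (u v w z : H) (c : C).

Let N2 u : R := Re (dot u u).
Let sqc c : R := Re c ^+ 2 + Im c ^+ 2.

Let dot_self u : dot u u = (N2 u)%:C.
Proof.
have : dot u u = (dot u u)^*%C by exact: dotC.
rewrite /N2; case: (dot u u) => x y /= [yy]; congr (_ +i* _).
by lra.
Qed.

Let N2_ge0 u : 0 <= N2 u.
Proof. by have := dnorm_ge0 dot u; rewrite dot_self lecR. Qed.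

Let N2ZD c u v : N2 (c *: u + v) =
  sqc c * N2 u + 2 * Re (c * dot u v) + N2 v.
Proof.
rewrite {1}/N2 dotZDl !dotZDr dot_self (dot_self v) (dotC dot v u) /sqc.
case: (dot u v) => x y; case: c => c1 c2 /=; ring.
Qed.

(** Pythagoras for the projection of [u] on the line of [v]. It yields Cauchy-Schwarz, and it shows
    that a nearly closest point leaves a nearly orthogonal remainder. *)
Let projection_defect u v : exists c,
  sqc (dot u v) = (N2 u - N2 (u - c *: v)) * N2 v.
Proof.
have [c c0] := orthogonal_projection1 dot v u; exists c.
have uE : u = c *: v + (u - c *: v) by rewrite addrC subrK.
have -> : dot u v = c * (N2 v)%:C by rewrite {1}uE dotZDl c0 addr0 dot_self.
have {1}-> : N2 u = sqc c * N2 v + N2 (u - c *: v).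
  by rewrite {1}uE N2ZD (dot_sym0 c0) mulr0 /= mulr0 addr0.
by rewrite addrK /sqc cReM cImM /=; ring.
Qed.

Let cauchy_schwarz u v : sqc (dot u v) <= N2 u * N2 v.
Proof.
have [c ->] := projection_defect u v; rewrite ler_wpM2r//.
by rewrite gerBl.
Qed.

(** Completeness for geometrically convergent sequences only, which a minimizing sequence can be
    chosen to be. The gap between the rates 16 and 2 of these squared norms leaves room for the
    weights in the proof for L_2. *)
Hypothesis complete : forall (f : nat -> H) (A : R),
  (forall n, N2 (f n.+1 - f n) <= A * 16^-1 ^+ n) ->
  exists l K, forall n, N2 (l - f n) <= K * 2^-1 ^+ n.

(** The projection theorem: a sequence in [D] minimizing the distance to [f] converges, and its
    limit differs from [f] by a vector orthogonal to [D], that is, by 0. *)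
Lemma orthogonal_dense (D : set H) : D 0 ->
  (forall c u v, D u -> D v -> D (c *: u + v)) ->
  (forall f, (forall v, D v -> dot f v = 0) -> f = 0) ->
  forall f e, 0 < e -> exists2 g, D g & hnorm dot (f - g) < e.
Proof.
move=> D0 DZD Dperp f e e0.
pose S := [set N2 (f - g) | g in D]; pose d := inf S.
have hS : has_inf S.
  by split; [exists (N2 (f - 0)); exists 0|exists 0 => _ [g _ <-]].
have dle g : D g -> d <= N2 (f - g).
  by move=> Dg; apply: ge_inf; [exact: hS.2|exists g].
have e16 n : 0 < 16^-1 ^+ n :> R by rewrite exprn_gt0// invr_gt0.
have /choice[m Hm] : forall n, exists g, D g /\ N2 (f - g) < d + 16^-1 ^+ n.
  move=> n; have [_ [g Dg <-] h] := inf_adherent (e16 n) hS.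
  by exists g.
have DB u v : D u -> D v -> D (u - v).
  by move=> Du Dv; rewrite addrC -scaleN1r; exact: DZD.
have DD u v : D u -> D v -> D (u + v).
  by move=> Du Dv; rewrite -[u]scale1r; exact: DZD.
have DZ c u : D u -> D (c *: u).
  by move=> Du; rewrite -[_ *: _]addr0; exact: DZD.
(* The parallelogram identity with the midpoint, which is in [D] and so at squared distance at least
   [d] from [f]. The excess [2 * q + 2 * q / 16] for [q = 16^-1 ^+ n] is below [4 * q]. *)
have mm n : N2 (m n.+1 - m n) <= 4 * 16^-1 ^+ n.
  have [Dn hn] := Hm n; have [Dn1 hn1] := Hm n.+1.
  pose u := f - m n; pose v := f - m n.+1.
  have h := dle _ (DZ (2^-1) _ (DD _ _ Dn Dn1)).
  have -> : m n.+1 - m n = -1 *: v + u.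
    by rewrite /u /v scaleN1r opprB subrKA.
  have par : N2 (-1 *: v + u) =
      2 * N2 u + 2 * N2 v - 4 * N2 (f - 2^-1 *: (m n + m n.+1)).
    have -> : f - 2^-1 *: (m n + m n.+1) = 2^-1 *: v + 2^-1 *: u.
      rewrite -scalerDr /u /v addrACA -opprD scalerBr [m n.+1 + _]addrC.
      congr (_ - _); rewrite -mulr2n -(scaler_nat 2 f) scalerA.
      by rewrite mulVf ?scale1r// pnatr_eq0.
    rewrite N2ZD.
    have -> : N2 (2^-1 *: v + 2^-1 *: u) =
        sqc (2^-1) * (N2 u + N2 v + 2 * Re (dot v u)).
      rewrite -scalerDr -[_ *: _]addr0 N2ZD dot0r mulr0 /= mulr0 addr0.
      have -> : N2 0 = 0 by rewrite /N2 dot0l.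
      by rewrite addr0 -[v]scale1r N2ZD mul1r scale1r /sqc /=; ring.
    have -> : sqc (2^-1) = 4^-1.
      rewrite /sqc (_ : 2^-1 = (2^-1 : R)%:C); last first.
        by rewrite -[LHS]/((2%:R)^-1) -[2%:R](rmorph_nat (@real_complex R)) fmorphV.
      by rewrite /=; field.
    rewrite (_ : -1 * dot v u = - dot v u) ?mulN1r//.
    by case: (dot v u) => x y; rewrite /sqc /=; field.
  rewrite par; move: hn hn1 h; rewrite -/u -/v exprS.
  set q := 16^-1 ^+ n; set A := N2 (f - _); move: (e16 n); rewrite -/q.
  by move=> q0 h1 h2 h3; lra.
have [l [K HK]] := complete mm.
have fl : f - l = 0.
  apply: Dperp => g Dg.
  (* Moving [m n] along [g] stays in [D] and gains at most [16^-1 ^+ n], so [f - m n] is almost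
     orthogonal to [g]; Cauchy-Schwarz handles [l - m n]. *)
  have bound n : sqc (dot (f - l) g) <= (2 * N2 g * (1 + K)) * 2^-1 ^+ n.
    have [Dn hn] := Hm n; have [c hc] := projection_defect (f - m n) g.
    have h1 : sqc (dot (f - m n) g) <= 16^-1 ^+ n * N2 g.
      rewrite hc ler_wpM2r//; have := dle _ (DZD c _ _ Dg Dn).
      by rewrite opprD addrA addrAC; lra.
    have h2 := cauchy_schwarz (l - m n) g.
    have h3 : N2 (l - m n) * N2 g <= K * 2^-1 ^+ n * N2 g by rewrite ler_wpM2r.
    have q : 16^-1 ^+ n <= 2^-1 ^+ n :> R.
      by rewrite lerXn2r// ?nnegrE ?invr_ge0// lef_pV2 ?posrE// ler_nat.
    have h4 : 16^-1 ^+ n * N2 g <= 2^-1 ^+ n * N2 g by rewrite ler_wpM2r.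
    have -> : f - l = (f - m n) - (l - m n) by rewrite opprB addrA subrK.
    rewrite dotBl.
    apply: (@le_trans _ _ (2 * sqc (dot (f - m n) g) + 2 * sqc (dot (l - m n) g))).
      case: (dot (f - m n) g) => x y; case: (dot (l - m n) g) => z w.
      rewrite /sqc /= -subr_ge0.
      have -> : 2 * (x ^+ 2 + y ^+ 2) + 2 * (z ^+ 2 + w ^+ 2) -
        ((x - z) ^+ 2 + (y - w) ^+ 2) = (x + z) ^+ 2 + (y + w) ^+ 2 by ring.
      by rewrite addr_ge0 ?sqr_ge0.
    have -> : 2 * N2 g * (1 + K) * 2^-1 ^+ n =
      2 * (2^-1 ^+ n * N2 g) + 2 * (K * 2^-1 ^+ n * N2 g) by ring.
    by rewrite lerD// ler_wpM2l// (le_trans h1, le_trans h2).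
  have : sqc (dot (f - l) g) = 0.
    apply: (@geometric_eq0 _ _ (2 * N2 g * (1 + K))) => n.
    by rewrite ger0_norm ?addr_ge0 ?sqr_ge0.
  rewrite /sqc; case: (dot (f - l) g) => x y /= /eqP.
  by rewrite paddr_eq0 ?sqr_ge0// !sqrf_eq0 => /andP[/eqP -> /eqP ->].
have e2 : 0 < e ^+ 2 by rewrite exprn_gt0.
have c0 := @geometric_cvg0 _ (fun n => N2 (l - m n)) K.
have /cvgr0Pnorm_lt/(_ _ e2)[n _ Hn] : N2 (l - m n) @[n --> \oo] --> 0.
  by apply: c0 => n; rewrite ger0_norm.
exists (m n); first by have [] := Hm n.
have -> : f = l by apply/eqP; rewrite -subr_eq0 fl.
have := Hn n (leqnn n); rewrite /= ger0_norm// => h.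
by rewrite /hnorm -(ger0_norm (ltW e0)) -sqrtr_sqr ltr_sqrt.
Qed.

End OrthogonalDense.

(** * Completeness of L_2 along geometrically convergent sequences *)

Section L2Complete.
Context {R : realType}.
Local Notation C := R[i].
Local Notation Re := (@complex.Re R).
Local Notation Im := (@complex.Im R).
Local Notation mu := (@lebesgue_measure R).
Variables (a b : R).

(* The series [S] of the squared increments with weights [4 ^ n] is integrable,
   and where it is finite it dominates the sequence geometrically. *)
Lemma square_integral_limit (F : nat -> R -> R) (A : R) :
  (forall n, measurable_fun `]a, b[ (F n)) ->
  (forall n, \int[mu]_(x in `]a, b[) ((F n.+1 x - F n x) ^+ 2)%:E <=
     (A * 16^-1 ^+ n)%:E)%E ->
  exists G S : R -> R, [/\ measurable_fun `]a, b[ G,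
    mu.-integrable `]a, b[ (EFin \o S) &
    ae_in a b (fun x => forall n, (G x - F n x) ^+ 2 <= S x * 4^-1 ^+ n)].
Proof.
(* The weight [4 ^+ n] is a compromise: the integrals still decay like [4^-1 ^+ n], while finiteness
   of the sum forces pointwise increments of order [2^-1 ^+ n]. *)
move=> mF FA; pose d n x := (4 ^+ n * (F n.+1 x - F n x) ^+ 2)%:E : \bar R.
have mq n : measurable_fun `]a, b[ (fun x => (F n.+1 x - F n x) ^+ 2).
  by apply: (@measurable_funX _ _ _ _ _ 2%N); exact: measurable_funB.
have md n : measurable_fun `]a, b[ (d n).
  by apply/measurable_EFinP; exact: measurable_funM.
have d0 n x : (0 <= d n x)%E by rewrite lee_fin mulr_ge0 ?sqr_ge0 ?exprn_ge0.
pose S x := (\sum_(n <oo) d n x)%E.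
have S0 x : (0 <= S x)%E by apply: nneseries_ge0 => n _ _; exact: d0.
have mS : measurable_fun `]a, b[ S 
  by apply: ge0_emeasurable_sum => [n x _ _|n _]; [exact: d0|exact: md].
have A0 : 0 <= A.
  have := FA 0; rewrite expr0 mulr1 -lee_fin; apply: le_trans.
  by apply: integral_ge0 => x _; rewrite lee_fin sqr_ge0.
have intS : (\int[mu]_(x in `]a, b[) S x < +oo)%E.
  rewrite integral_nneseries//.
  apply: (@le_lt_trans _ _ (\sum_(n <oo) (A * 4^-1 ^+ n)%:E)%E).
    apply: lee_nneseries => [n _ _|n _]; first exact: integral_ge0.
    have -> : (\int[mu]_(x in `]a, b[) d n x =
        (4 ^+ n)%:E * \int[mu]_(x in `]a, b[) ((F n.+1 x - F n x) ^+ 2)%:E)%E.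
      rewrite -ge0_integralZl//.
      - by apply/measurable_EFinP; exact: mq.
      - by move=> x _; rewrite lee_fin sqr_ge0.
    apply: le_trans (lee_wpmul2l _ (FA n)) _; first by rewrite lee_fin exprn_ge0.
    rewrite -EFinM lee_fin mulrCA ler_wpM2l// -exprMn.
    by rewrite lerXn2r// ?nnegrE//; lra.
  have : cvgn (series (geometric A (4^-1 : R))).
    by apply: is_cvg_geometric_series; rewrite ger0_norm ?invr_ge0// invf_lt1// ltr1n.
  move=> /cvg_ex[l /= Hl].
  have : (fun n => \sum_(0 <= i < n) (A * 4^-1 ^+ i)%:E)%E @ \oo --> l%:E.
    apply: cvg_EFin; first by apply: nearW => n; rewrite sumEFin.
    by under eq_fun do rewrite /= sumEFin.
  by move/cvg_lim => ->//; rewrite ltry.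
have iS : mu.-integrable `]a, b[ S.
  apply/integrableP; split => //; apply: le_lt_trans intS.
  rewrite le_eqVlt; apply/orP; left; apply/eqP.
  by apply: eq_integral => x _; rewrite gee0_abs.
pose g x := S x \is a fin_num.
have lim_g x : g x ->
    forall n, `|F n.+1 x - F n x| <= Num.sqrt (fine (S x)) * 2^-1 ^+ n.
  move=> gx n; have : (d n x <= S x)%E.
    apply: le_trans (nneseries_lim_ge n.+1 _) => //.
    rewrite big_nat_recr//= leeDr//; exact: sume_ge0.
  move=> dS; have h : 4 ^+ n * (F n.+1 x - F n x) ^+ 2 <= fine (S x).
    by rewrite -lee_fin fineK.
  rewrite -(ler_pXn2r (n := 2))// ?nnegrE ?mulr_ge0 ?sqrtr_ge0 ?exprn_ge0//.
  rewrite real_normK ?num_real// exprMn sqr_sqrtr ?fine_ge0//.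
  rewrite -exprM mulnC exprM -(ler_pM2l (x := 4 ^+ n)) ?exprn_gt0//.
  apply: le_trans h _; rewrite mulrCA -exprMn.
  by rewrite (_ : 4 * _ = 1) ?expr1n ?mulr1//; field.
have /choice[G HG] : forall x, exists l, (g x -> forall n,
    `|l - F n x| <= 2 * Num.sqrt (fine (S x)) * 2^-1 ^+ n) /\ (~ g x -> l = 0).
  move=> x; have [gx|ngx] := pselect (g x); last by exists 0.
  by have [l Hl] := geometric_seq_limit (lim_g x gx); exists l.
exists G, (fun x => 4 * fine (S x)); split.
(* Where the series diverges, sequence and limit are set to 0, so that [G] is a limit at every point
   and hence measurable. *)
- pose F' n x := if g x then F n x else 0.
  apply: (@measurable_fun_cvg _ _ _ _ F').
    move=> n; rewrite /F'; apply: measurable_fun_if => //.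
    + apply: (measurable_fun_bool true).
      exact: emeasurable_fin_num mS.
    + by apply: measurable_funS (mF n); [exact: measurable_itv|exact: subIsetl].
  move=> x _; have [h1 h2] := HG x; have [gx|gx] := boolP (g x).
    rewrite (_ : F' ^~ x = F ^~ x); first exact: geometric_limit_cvg (h1 gx).
    by apply/funext => n; rewrite /F' gx.
  rewrite (_ : F' ^~ x = fun=> 0); first by rewrite h2; [exact: cvg_cst|exact/negP].
  by apply/funext => n; rewrite /F' (negbTE gx).
- rewrite (_ : _ \o _ = (fun x => 4%:E * (EFin \o (fine \o S)) x)%E)//.
  apply: integrableZl => //; apply/integrableP; split.
    by apply/measurable_EFinP; exact: measurableT_comp.
  apply: le_lt_trans intS; apply: ge0_le_integral => //.
  - apply: measurableT_comp => //; apply/measurable_EFinP.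
    exact: measurableT_comp.
  - move=> x _ /=; rewrite ger0_norm ?fine_ge0//.
    have [gx|] := boolP (g x); first by rewrite fineK.
    by rewrite /g ge0_fin_numE// -leNgt leye_eq => /eqP ->; rewrite leey.
- have finS : ae_in a b g by apply: integrable_ae iS; exact: measurable_itv.
  apply: ae_in1 finS => x _ _ gx n.
  have [h1 _] := HG x; have := h1 gx n.
  rewrite -(ler_pXn2r (n := 2))// ?nnegrE ?mulr_ge0 ?sqrtr_ge0 ?exprn_ge0//.
  rewrite real_normK ?num_real// => h; apply: le_trans h _.
  rewrite !exprMn sqr_sqrtr ?fine_ge0// -exprM mulnC exprM.
  rewrite (_ : 2 ^+ 2 = 4 :> R); last by ring.
  by rewrite (_ : (2^-1) ^+ 2 = 4^-1 :> R)//; field.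
Qed.

Lemma L2dot_self_represents (h : L2 a b) y : square_integrable a b y ->
  represents h y ->
  Re (L2dot h h) = \int[mu]_(x in `]a, b[) (Re (y x) ^+ 2 + Im (y x) ^+ 2).
Proof.
by move=> sy hy; rewrite (L2dot_represents sy sy hy hy) fdot_self.
Qed.

Lemma square_integral_le (f : R -> R) (B : R) (S : R -> R) :
  measurable_fun `]a, b[ f -> (forall x, 0 <= f x) ->
  mu.-integrable `]a, b[ (EFin \o S) ->
  ae_in a b (fun x => f x <= S x * B) ->
  mu.-integrable `]a, b[ (EFin \o f) /\
  \int[mu]_(x in `]a, b[) f x <= \int[mu]_(x in `]a, b[) `|S x| * `|B|.
Proof.
move=> mf f0 iS fS.
have iSB : mu.-integrable `]a, b[ (EFin \o (fun x => `|B| * `|S x|)).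
  rewrite (_ : _ \o _ = (fun x => `|B|%:E * (EFin \o (fun x => `|S x|%R)) x)%E)//.
  by apply: integrableZl => //; exact: integrable_norm.
have le_ : (\int[mu]_(x in `]a, b[) (f x)%:E <=
    \int[mu]_(x in `]a, b[) (`|B| * `|S x|)%:E)%E.
  apply: ae_ge0_le_integral => //.
  - by move=> x _; rewrite lee_fin.
  - exact/measurable_EFinP.
  - exact: measurable_int iSB.
  - apply: (@filterS _ _ (ae_filter_ringOfSetsType mu) _ _ _ fS) => x h Jx.
    rewrite lee_fin (le_trans (h Jx))//.
    by rewrite mulrC -normrM ler_norm.
have if_ : mu.-integrable `]a, b[ (EFin \o f).
  apply/integrableP; split; first exact/measurable_EFinP.
  have -> : (\int[mu]_(x in `]a, b[) `|(EFin \o f) x| =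
      \int[mu]_(x in `]a, b[) (f x)%:E)%E.
    by apply: eq_integral => x _ /=; rewrite ger0_norm.
  apply: le_lt_trans le_ _; apply: integrable_lty iSB.
  exact: measurable_itv.
split => //; rewrite mulrC -RintegralZl//; last exact: integrable_norm.
rewrite -lee_fin /Rintegral !fineK//; exact: integrable_fin_num.
Qed.

Lemma L2_complete (f : nat -> L2 a b) (A : R) :
  (forall n, Re (L2dot (f n.+1 - f n) (f n.+1 - f n)) <= A * 16^-1 ^+ n) ->
  exists l K, forall n, Re (L2dot (l - f n) (l - f n)) <= K * 2^-1 ^+ n.
Proof.
move=> fA; pose y n : R -> C := repr (f n).
have sy n : square_integrable a b (y n) by exact: L2fun_sqint.
have sB (z w : R -> C) : square_integrable a b z -> square_integrable a b w ->
    square_integrable a b (fun x => z x - w x).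
  move=> sz sw; have := square_integrable_lin (-1) sw sz.
  congr square_integrable; apply/funext => x.
  by rewrite -[LHS]/(-1 * w x + z x) mulN1r addrC.
have rB (g h : L2 a b) (z w : R -> C) : represents g z -> represents h w ->
    represents (g - h) (fun x => z x - w x).
  move=> gz hw; have := representsZD (-1) hw gz.
  by rewrite scaleN1r addrC; apply: ae_in1 => x _ _ ->; rewrite mulN1r addrC.
have my n : cmeasurable a b (y n) by have [] := sy n.
have dA n : \int[mu]_(x in `]a, b[) (Re (y n.+1 x - y n x) ^+ 2 +
    Im (y n.+1 x - y n x) ^+ 2) <= A * 16^-1 ^+ n.
  have sd := sB _ _ (sy n.+1) (sy n).
  have rd := rB _ _ _ _ (represents_repr (f n.+1)) (represents_repr (f n)).
  rewrite -(L2dot_self_represents sd rd).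
  exact: fA.
(* Here [p] and [q] stand for the real and imaginary parts, in either order. *)
have half (p q : C -> R) : (forall z, p z ^+ 2 + q z ^+ 2 = Re z ^+ 2 + Im z ^+ 2) ->
    (forall n, measurable_fun `]a, b[ (p \o y n)) ->
    (forall z w, p (z - w) = p z - p w) ->
    forall n, (\int[mu]_(x in `]a, b[) (((p \o y n.+1) x - (p \o y n) x) ^+ 2)%:E
      <= (A * 16^-1 ^+ n)%:E)%E.
  move=> pq mp pB n; have [md intd] := sB _ _ (sy n.+1) (sy n).
  have mq : measurable_fun `]a, b[ (fun x => ((p \o y n.+1) x - (p \o y n) x) ^+ 2).
    by apply: (@measurable_funX _ _ _ _ _ 2%N); exact: measurable_funB.
  apply: (@le_trans _ _ (\int[mu]_(x in `]a, b[) (Re (y n.+1 x - y n x) ^+ 2 +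
      Im (y n.+1 x - y n x) ^+ 2)%:E)%E).
    apply: ge0_le_integral => //.
    - by move=> x _; rewrite lee_fin sqr_ge0.
    - exact/measurable_EFinP.
    - exact: measurable_int intd.
    - by move=> x _; rewrite lee_fin -pB -pq lerDl sqr_ge0.
  rewrite -[leLHS]fineK ?lee_fin; first exact: dA.
  exact: integrable_fin_num intd.
have [G1 [S1 [mG1 iS1 H1]]] := square_integral_limit (fun n => (my n).1)
  (half Re Im (fun z => erefl) (fun n => (my n).1) (fun z w => raddfB _ z w)).
have [G2 [S2 [mG2 iS2 H2]]] := square_integral_limit (fun n => (my n).2)
  (half Im Re (fun z => addrC _ _) (fun n => (my n).2) (fun z w => raddfB _ z w)).
pose z x := G1 x +i* G2 x; pose S x := S1 x + S2 x.
have iS : mu.-integrable `]a, b[ (EFin \o S) by exact: integrable_add.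
have mz : cmeasurable a b z by [].
have mzy n : cmeasurable a b (fun x => z x - y n x).
  by apply: cmeasurableD => //; exact: cmeasurableN.
have bound n : ae_in a b (fun x =>
    Re (z x - y n x) ^+ 2 + Im (z x - y n x) ^+ 2 <= S x * 4^-1 ^+ n).
  apply: ae_in2 H1 H2 => x _ _ h1 h2.
  by rewrite raddfB (raddfB Im) mulrDl lerD//; [exact: h1|exact: h2].
have key n := square_integral_le (cmeasurable_sqr (mzy n))
  (fun x => addr_ge0 (sqr_ge0 _) (sqr_ge0 _)) iS (bound n).
have szy n : square_integrable a b (fun x => z x - y n x).
  by split; [exact: mzy|have [] := key n].
have sz : square_integrable a b z.
  have := square_integrable_lin 1 (szy 0) (sy 0); congr square_integrable.
  by apply/funext => x; rewrite -[LHS]/(1 * (z x - y 0 x) + y 0 x) mul1r subrK.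
have [l lz] := L2_exists sz.
exists l, (\int[mu]_(x in `]a, b[) `|S x|) => n.
rewrite (L2dot_self_represents (szy n) (rB _ _ _ _ lz (represents_repr _))).
have [_ h] := key n; apply: le_trans h _; apply: ler_wpM2l.
  by apply: Rintegral_ge0.
rewrite ger0_norm ?exprn_ge0 ?invr_ge0// lerXn2r ?nnegrE ?invr_ge0//.
by rewrite lef_pV2 ?posrE// ler_nat.
Qed.

End L2Complete.

(** * Contractions and dissipative extensions *)

Section Contractions.
Context {R : realType}.
Local Notation C := R[i].
Local Notation normc := ComplexField.Normc.normc.

Definition sqnorm n (v : 'cV[C]_n) : R := \sum_i normc (v i 0) ^+ 2.

Lemma sqnorm_ge0 n (v : 'cV[C]_n) : 0 <= sqnorm v.
Proof. by apply: sumr_ge0 => i _; rewrite sqr_ge0. Qed.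

Lemma normc_ge0 (z : C) : 0 <= normc z.
Proof. by case: z => x y; exact: sqrtr_ge0. Qed.

Lemma ler_normcD (z w : C) : normc (z + w) <= normc z + normc w.
Proof.
rewrite -lecR; have := ler_normD z w.
by rewrite (_ : (normc z + normc w)%:C = `|z| + `|w|)//=; rewrite raddfD.
Qed.

Lemma normc_sqr (z : C) : normc z ^+ 2 = complex.Re z ^+ 2 + complex.Im z ^+ 2.
Proof. by case: z => x y /=; rewrite sqr_sqrtr// addr_ge0 ?sqr_ge0. Qed.

Lemma sqnormZ n c (v : 'cV[C]_n) : sqnorm (c *: v) = normc c ^+ 2 * sqnorm v.
Proof.
rewrite /sqnorm mulr_sumr; apply: eq_bigr => i _.
by rewrite mxE ComplexField.Normc.normcM exprMn.
Qed.

Lemma sqnorm0 n : sqnorm (0 : 'cV[C]_n) = 0.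
Proof. by rewrite -(scale0r (0 : 'cV_n)) sqnormZ normc_sqr /= expr0n addr0 mul0r. Qed.

Lemma sqnorm_eq0 n (v : 'cV[C]_n) : sqnorm v = 0 -> v = 0.
Proof.
move=> /eqP; rewrite psumr_eq0 => [/allP h|i _]; last exact: sqr_ge0.
apply/matrixP => i j; rewrite (ord1 j) mxE; apply: ComplexField.Normc.eq0_normc.
by apply/eqP; rewrite -(sqrf_eq0 (normc _)); exact: (h i (mem_index_enum _)).
Qed.

Lemma hermitian_normE n (v : 'cV[C]_n) : hermitian_norm v = Num.sqrt (sqnorm v).
Proof. by []. Qed.

Lemma contractingP n (K : 'M[C]_n) :
  contracting K <-> forall v, sqnorm (K *m v) <= sqnorm v.
Proof.
split=> [cK v|cK].
  pose S := [set hermitian_norm (K *m w) | w in [set w | hermitian_norm w <= 1]].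
  (* [sup] dominates the set only when the set is bounded. The entries of [w] have modulus at most
     1, so row sums of [|K i j|] give a bound. *)
  have ubS : has_ubound S.
    exists (Num.sqrt (\sum_i (\sum_j normc (K i j)) ^+ 2)) => _ [w /= w1 <-].
    apply: ler_wsqrtr; apply: ler_sum => i _.
    rewrite ler_sqr ?nnegrE; first last.
    - by apply: sumr_ge0 => j _; exact: normc_ge0.
    - exact: normc_ge0.
    rewrite mxE.
    have tri (I : finType) (F : I -> C) : normc (\sum_j F j) <= \sum_j normc (F j).
      elim/big_ind2: _ => [|x1 x2 y1 y2 h1 h2|//].
        by rewrite ComplexField.Normc.normc0.
      by apply: le_trans (ler_normcD _ _) _; exact: lerD.
    apply: le_trans (tri _ _) _; apply: ler_sum => j _.
    rewrite ComplexField.Normc.normcM ler_piMr ?normc_ge0//.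
    apply: le_trans w1; rewrite hermitian_normE.
    rewrite -(ger0_norm (normc_ge0 _)) -sqrtr_sqr ler_wsqrtr//.
    rewrite /sqnorm (bigD1 j)//= lerDl; apply: sumr_ge0 => k _; exact: sqr_ge0.
  have [->|v0] := eqVneq v 0; first by rewrite mulmx0.
  have s0 : 0 < sqnorm v.
    rewrite lt_neqAle sqnorm_ge0 andbT eq_sym.
    by apply: contraNneq v0 => /sqnorm_eq0 ->.
  pose c : R := (Num.sqrt (sqnorm v))^-1.
  have c2 : normc c%:C ^+ 2 = (sqnorm v)^-1.
    by rewrite normc_sqr /= expr0n addr0 exprVn sqr_sqrtr ?sqnorm_ge0.
  have : hermitian_norm (K *m (c%:C *: v)) <= 1.
    apply: le_trans cK; apply: ub_le_sup => //; exists (c%:C *: v) => //=.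
    by rewrite hermitian_normE sqnormZ c2 mulVf ?gt_eqF// sqrtr1.
  rewrite hermitian_normE -scalemxAr sqnormZ c2 -[X in _ <= X]sqrtr1 ler_sqrt//.
  by rewrite mulrC ler_pdivrMr// mul1r.
apply: sup_le_ub.
  by exists 0; exists 0; rewrite ?mulmx0 /= hermitian_normE sqnorm0 sqrtr0 ?ler01.
by move=> _ [v /= v1 <-]; apply: le_trans v1; exact: (ler_wsqrtr (cK v)).
Qed.

(* A linear relation in C^2 that does not increase norms is the graph of a
   contraction of a subspace; it is extended by 0 on the orthogonal. *)
Lemma contraction_extension (V : 'cV[C]_2 -> 'cV[C]_2 -> Prop) :
  (forall c x y x' y', V x y -> V x' y' -> V (c *: x + x') (c *: y + y')) ->
  V 0 0 -> (forall x y, V x y -> sqnorm y <= sqnorm x) ->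
  exists2 K : 'M[C]_2, contracting K & forall x y, V x y -> K *m x = y.
Proof.
move=> VZD V0 Vle.
have VZ c x y : V x y -> V (c *: x) (c *: y).
  by move=> h; have := VZD c _ _ _ _ h V0; rewrite !addr0.
(* Two images of one vector differ by an image of 0, whose norm is at most 0. *)
have Vfun x y y' : V x y -> V x y' -> y = y'.
  move=> h h'; have := VZD (-1) _ _ _ _ h' h; rewrite !scaleN1r addNr.
  move=> /Vle; rewrite sqnorm0 => h0; apply/eqP; rewrite eq_sym -subr_eq0 -oppr_eq0.
  rewrite opprB addrC; apply/eqP/sqnorm_eq0/eqP.
  by rewrite eq_le h0 sqnorm_ge0.
(* Three cases, by the dimension of the domain of [V]: it is 0, 2 or 1. *)
have [[x1 [y1 [V1 x10]]]|none] :=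
    pselect (exists x y, V x y /\ x != 0); last first.
  exists 0; first by apply/contractingP => v; rewrite mul0mx sqnorm0 sqnorm_ge0.
  move=> x y Vxy; rewrite mul0mx; apply: (Vfun x) (Vxy).
  have -> : x = 0 by apply/eqP/negPn/negP => x0; apply: none; exists x, y.
  exact: V0.
have mul_row (u w : 'cV[C]_2) (c : 'cV[C]_2) :
    row_mx u w *m (c : 'cV_(1 + 1)) = c 0 0 *: u + c 1 0 *: w.
  rewrite -[c in LHS](@vsubmxK _ 1 1) mul_row_col.
  rewrite [usubmx _]mx11_scalar [dsubmx _]mx11_scalar !mul_mx_scalar !mxE.
  by congr (c _ _ *: _ + c _ _ *: _); apply: val_inj.
have [[x2 [y2 [V2 xu]]]|none] := pselect (exists x2 y2, V x2 y2 /\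
    (row_mx x1 x2 : 'M[C]_2) \in unitmx).
  pose X : 'M[C]_2 := row_mx x1 x2; pose Y : 'M[C]_2 := row_mx y1 y2.
  exists (Y *m invmx X).
    apply/contractingP => v; apply: Vle; pose c := invmx X *m v.
    have -> : v = X *m c by rewrite mulmxA mulmxV// mul1mx.
    rewrite mulmxA -(mulmxA Y) mulVmx// mulmx1 /X /Y !mul_row.
    by apply: VZD => //; exact: VZ.
  move=> x y Vxy; apply: (Vfun x) (Vxy).
  pose c := invmx X *m x; have {1}-> : x = X *m c by rewrite mulmxA mulmxV// mul1mx.
  rewrite -mulmxA -/c /X /Y !mul_row.
  by apply: VZD => //; exact: VZ.
have parallel x y : V x y -> exists c, x = c *: x1.
  move=> Vxy; have : (row_mx x1 x : 'M[C]_2) \notin unitmx.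
    by apply/negP => xu; apply: none; exists x, y.
  rewrite unitmxE unitfE negbK -det_tr => /det0P[w w0 ww].
  have : row_mx x1 x *m (w^T : 'cV_(1 + 1)) = 0.
    by apply: trmx_inj; rewrite trmx_mul trmxK ww trmx0.
  rewrite mul_row !mxE => h.
  have w1 : w 0 1 != 0.
    apply/eqP => w10; move: h; rewrite w10 scale0r addr0 => /eqP.
    rewrite scaler_eq0 (negbTE x10) orbF => /eqP w00.
    case/eqP: w0; apply/matrixP => i j; rewrite (ord1 i) mxE.
    by case: j => -[|[|//]] p; [rewrite -[RHS]w00|rewrite -[RHS]w10];
      congr (w _ _); exact: val_inj.
  exists (- (w 0 0 / w 0 1)); apply: (scalerI w1); rewrite scalerA mulrN mulrC divfK//.
  by rewrite scaleNr; apply/eqP; rewrite -addr_eq0 addrC h.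
have s1 : 0 < sqnorm x1.
  rewrite lt_neqAle sqnorm_ge0 andbT eq_sym.
  by apply: contraNneq x10 => /sqnorm_eq0 ->.
pose x1' : 'rV[C]_2 := \row_j (x1 j 0)^*%C.
have x1x1 : x1' *m x1 = (sqnorm x1)%:C%:M.
  apply/matrixP => i j; rewrite !mxE (ord1 i) (ord1 j) eqxx mulr1n /sqnorm.
  rewrite (raddf_sum (@real_complex R)); apply: eq_bigr => k _.
  rewrite mxE normc_sqr; case: (x1 k 0) => u w /=; apply/eqP; rewrite eq_complex /=.
  by apply/andP; split; apply/eqP; ring.
(* Cauchy-Schwarz by Lagrange's identity: the defect is the squared modulus of the determinant of
   [x1] and [v]. *)
have cs v : normc ((x1' *m v) 0 0) ^+ 2 <= sqnorm x1 * sqnorm v.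
  rewrite mxE /sqnorm !big_ord_recl !big_ord0 /= !mxE !normc_sqr.
  move: (v 0 0) (v (lift 0 0) 0) (x1 0 0) (x1 (lift 0 0) 0).
  move=> [a1 a2] [b1 b2] [c1 c2] [d1 d2] /=; rewrite -subr_ge0 !addr0.
  set lhs := (X in 0 <= X).
  have -> : lhs = (c1 * b1 - c2 * b2 - d1 * a1 + d2 * a2) ^+ 2 +
      (c1 * b2 + c2 * b1 - d1 * a2 - d2 * a1) ^+ 2 by rewrite /lhs; ring.
  by rewrite addr_ge0 ?sqr_ge0.
(* The rank-one map that sends [x1] to [y1] and kills the orthogonal complement of [x1]. *)
exists (((sqnorm x1)^-1)%:C *: (y1 *m x1')).
  apply/contractingP => v.
  rewrite -scalemxAl -mulmxA [x1' *m v]mx11_scalar mul_mx_scalar scalerA sqnormZ.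
  rewrite ComplexField.Normc.normcM exprMn normc_sqr /= expr0n addr0 /=.
  set t := normc _ ^+ 2; have := cs v; rewrite -/t => ht.
  have := Vle _ _ V1; have := sqnorm_ge0 y1; have t0 : 0 <= t by exact: sqr_ge0.
  move=> y0 yx; rewrite exprVn -mulrA mulrC ler_pdivrMr ?exprn_gt0//.
  apply: (@le_trans _ _ (sqnorm x1 * sqnorm v * sqnorm x1)).
    by apply: ler_pM.
  by rewrite expr2; lra.
move=> x y Vxy; have [c xc] := parallel _ _ Vxy.
apply: (Vfun x) (Vxy); rewrite xc -scalemxAl -scalemxAr -mulmxA x1x1 mul_mx_scalar.
rewrite !scalerA mulrCA -(rmorphM (@real_complex R)) mulVf ?gt_eqF// mulr1.
exact: VZ.
Qed.

End Contractions.

(** * Dissipative extensions in terms of the Cayley transforms of the boundary values *)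

Section DissipativeExtensions.
Context {R : realType} {H : lmodType R[i]}.
Local Notation C := R[i].
Local Notation Im := (@complex.Im R).
Variable dot : {dot H for (@conjc R)}.
(* [T f g x y] : the maximal operator maps [f] to [g], and [x], [y] are the
   Cayley transforms [Gamma1 f + i Gamma2 f] and [Gamma1 f - i Gamma2 f]. *)
Variable T : H -> H -> 'cV[C]_2 -> 'cV[C]_2 -> Prop.
Hypothesis TZD : forall c f g f' g' x y x' y',
  T f g x y -> T f' g' x' y' ->
  T (c *: f + f') (c *: g + g') (c *: x + x') (c *: y + y').
Hypothesis T0 : T 0 0 0 0.
Hypothesis T_im : forall f g x y, T f g x y ->
  4 * Im (dot g f) = sqnorm x - sqnorm y.
Hypothesis T_uniq : forall g x y, T 0 g x y -> [/\ x = 0, y = 0 & g = 0].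
Hypothesis T_surj : forall x y, exists f g, T f g x y.
Hypothesis T_adjoint : forall f h,
  (forall v k, T v k 0 0 -> dot h v = dot f k) -> exists x y, T f h x y.
Hypothesis T_dense : densely_defined dot [set fg | T fg.1 fg.2 0 0].

Definition minimal_graph : set (H * H) := [set fg | T fg.1 fg.2 0 0].

Definition boundary_graph (K : 'M[C]_2) : set (H * H) :=
  [set fg | exists x y, T fg.1 fg.2 x y /\ K *m x = y].

Lemma T_sub f g f' g' x y x' y' : T f g x y -> T f' g' x' y' ->
  T (f - f') (g - g') (x - x') (y - y').
Proof.
move=> h h'; have := TZD (-1) h' h.
by rewrite !scaleN1r ![- _ + _]addrC.
Qed.

Lemma T_functional f g g' x y x' y' : T f g x y -> T f g' x' y' ->
  [/\ x = x', y = y' & g = g'].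
Proof.
move=> h h'; have := T_sub h h'; rewrite subrr => /T_uniq[/eqP + /eqP + /eqP].
by rewrite !subr_eq0 => /eqP -> /eqP -> /eqP ->.
Qed.

Lemma minimal_sub_boundary K : minimal_graph `<=` boundary_graph K.
Proof. by move=> fg h; exists 0, 0; rewrite mulmx0. Qed.

Lemma densely_definedS (A B : set (H * H)) : A `<=` B ->
  densely_defined dot A -> densely_defined dot B.
Proof.
move=> AB dA f e e0; have [g [k Agk] fg] := dA f e e0.
by exists g => //; exists k; exact: AB.
Qed.

Lemma boundary_graph_dissipative K : contracting K ->
  dissipative dot (boundary_graph K).
Proof.
move=> /contractingP cK; split; first split.
- by exists 0, 0; rewrite mulmx0.
- move=> c [f g] [f' g'] [x [y [h yE]]] [x' [y' [h' yE']]].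
  exists (c *: x + x'), (c *: y + y').
  by split; [exact: TZD|rewrite mulmxDr -scalemxAr yE yE'].
- by move=> f g g' [x [y [h _]]] [x' [y' [h' _]]]; have [] := T_functional h h'.
- exact: densely_definedS (@minimal_sub_boundary K) T_dense.
- move=> f g [x [y [/T_im h yE]]]; have := cK x; rewrite yE => le_.
  by rewrite /= in h; lra.
Qed.

(* Dissipativity of [f + c v] for [v] in the minimal domain and all [c] forces
   the terms linear in [c] to vanish. *)
Lemma dissipative_extension_maximal B : dissipative dot B ->
  minimal_graph `<=` B -> forall f g, B (f, g) -> exists x y, T f g x y.
Proof.
move=> [[_ Blin _] _ Bim] minB f g Bfg; apply: T_adjoint => v k Tvk.
(* The minimal operator is symmetric, so the term quadratic in [c] is real and drops out. *)
have kv0 : Im (dot k v) = 0.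
  by have := T_im Tvk; rewrite sqnorm0 subrr => h; lra.
pose A := dot g v - dot f k.
have key c : 0 <= Im (dot g f) + Im (c^*%C * A).
  have := Bim _ _ (Blin c _ _ (minB (v, k) Tvk) Bfg).
  rewrite /= dotZDl !dotZDr (dotC dot k f) /A; move: kv0.
  case: (dot k v) => a1 a2 /= ->.
  case: (dot g f) => b1 b2; case: (dot g v) => c1 c2; case: (dot f k) => d1 d2.
  case: c => e1 e2 /=; set l := (X in 0 <= X -> _); set m := (X in _ -> 0 <= X).
  by rewrite (_ : l = m)// /l /m; ring.
have A0 : complex.Re A ^+ 2 + Im A ^+ 2 <= 0.
  rewrite leNgt; apply/negP => Apos; set s := _ + _ in Apos.
  (* Chosen so that the supposedly nonnegative expression becomes -1. *)
  pose t := (Im (dot g f) + 1) / s.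
  have := key ((0 +i* t) * A).
  have -> : Im (((0 +i* t) * A)^*%C * A) = - t * s.
    by rewrite /s; case: (A) => u w /=; ring.
  by rewrite /t mulNr divfK ?gt_eqF//; lra.
have : A = 0.
  have : complex.Re A ^+ 2 + Im A ^+ 2 = 0.
    by apply/eqP; rewrite eq_le A0 addr_ge0 ?sqr_ge0.
  move=> /eqP; rewrite paddr_eq0 ?sqr_ge0// !sqrf_eq0 => /andP[/eqP u0 /eqP w0].
  by rewrite [LHS]complex_eta u0 w0.
by move/eqP; rewrite subr_eq0 => /eqP.
Qed.

(** An element of a larger dissipative operator is compared with one of [boundary_graph K] having
    the same [x]. Their difference has first transform 0, so dissipativity forces its second
    transform to vanish. *)
Lemma boundary_graph_maximal K : contracting K ->
  maximal_dissipative_extension dot minimal_graph (boundary_graph K).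
Proof.
move=> cK; split; first exact: minimal_sub_boundary.
split; first exact: boundary_graph_dissipative.
move=> B dB KB; apply/seteqP; split => // -[f g] Bfg.
have minB := subset_trans (@minimal_sub_boundary K) KB.
have [x [y h]] := dissipative_extension_maximal dB minB Bfg.
exists x, y; split => //; have [f' [g' h']] := T_surj x (K *m x).
have Bfg' : B (f', g') by apply: KB; exists x, (K *m x).
have [[_ Blin _] _ Bim] := dB.
have := Bim _ _ (Blin (-1) _ _ Bfg' Bfg).
have := T_im (TZD (-1) h' h); rewrite /= !scaleN1r addNr sqnorm0 => imE le_.
have : sqnorm (- (K *m x) + y) = 0.
  by apply/eqP; rewrite eq_le sqnorm_ge0 andbT; move: imE le_; set u := Im _; lra.
by move/sqnorm_eq0/eqP; rewrite addrC subr_eq0 => /eqP.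
Qed.

(** On [L] dissipativity says that the relation between the two transforms does not increase norms.
    A contraction extending this relation defines a dissipative operator containing [L], which
    equals [L] by maximality. *)
Lemma maximal_dissipative_extension_boundary L :
  maximal_dissipative_extension dot minimal_graph L ->
  exists2 K : 'M[C]_2, contracting K & L = boundary_graph K.
Proof.
move=> [minL [dL maxL]]; have [[L0 Llin _] _ Lim] := dL.
pose V x y := exists f g, L (f, g) /\ T f g x y.
have [||x y [f [g [Lfg h]]]|K cK KV] := @contraction_extension R V.
- move=> c x y x' y' [f [g [Lfg h]]] [f' [g' [Lfg' h']]].
  exists (c *: f + f'), (c *: g + g'); split; last exact: TZD.
  exact: (Llin c _ _ Lfg Lfg').
- by exists 0, 0.
- have := Lim _ _ Lfg; have := T_im h; set u := Im _; lra.
exists K => //; apply/esym/maxL; first exact: boundary_graph_dissipative.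
move=> [f g] Lfg; have [x [y h]] := dissipative_extension_maximal dL minL Lfg.
by exists x, y; split => //; apply: KV; exists f, g.
Qed.

Lemma boundary_graph_inj : injective boundary_graph.
Proof.
move=> K K' KK'.
have Kx (x : 'cV[C]_2) : K *m x = K' *m x.
  have [f [g h]] := T_surj x (K *m x).
  have : boundary_graph K (f, g) by exists x, (K *m x).
  rewrite KK' => -[x' [y' [h' yE]]].
  by have [xx yy _] := T_functional h h'; rewrite yy -yE xx.
apply/trmx_inj/row_matrixP => i; apply: trmx_inj.
by rewrite -!tr_col !trmxK !colE Kx.
Qed.

End DissipativeExtensions.

(** * From boundary values to their Cayley transforms *)

Section CayleyTransform.
Context {R : realType} {H : lmodType R[i]}.
Local Notation C := R[i].
Local Notation Im := (@complex.Im R).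
Variable dot : {dot H for (@conjc R)}.
Variable bv : H -> H -> C -> C -> C -> C -> Prop.
Hypothesis bvZD : forall c f g f' g' ya ua yb ub ya' ua' yb' ub',
  bv f g ya ua yb ub -> bv f' g' ya' ua' yb' ub' ->
  bv (c *: f + f') (c *: g + g')
    (c * ya + ya') (c * ua + ua') (c * yb + yb') (c * ub + ub').
Hypothesis bv0 : bv 0 0 0 0 0 0.
Hypothesis bv_green : forall f g f' g' ya ua yb ub za wa zb wb,
  bv f g ya ua yb ub -> bv f' g' za wa zb wb ->
  dot g f' - dot f g' =
  (yb * wb^*%C - ub * zb^*%C) - (ya * wa^*%C - ua * za^*%C).
Hypothesis bv_uniq : forall g ya ua yb ub, bv 0 g ya ua yb ub ->
  [/\ ya = 0, ua = 0, yb = 0, ub = 0 & g = 0].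
Hypothesis bv_surj : forall ya ua yb ub, exists f g, bv f g ya ua yb ub.
Hypothesis bv_adjoint : forall f h,
  (forall v k, bv v k 0 0 0 0 -> dot h v = dot f k) ->
  exists ya ua yb ub, bv f h ya ua yb ub.

Definition col2 (c d : C) : 'cV[C]_2 := \col_(i < 2) if i == 0 then c else d.

Definition cayley f g (x y : 'cV[C]_2) := exists ya ua yb ub,
  [/\ bv f g ya ua yb ub, x = col2 ua (- ub) + 'i *: col2 ya yb &
      y = col2 ua (- ub) - 'i *: col2 ya yb].

Lemma imaginaryE : 'i%R = 0 +i* 1 :> C.
Proof. by []. Qed.

Lemma col2_eta (x : 'cV[C]_2) : x = col2 (x 0 0) (x 1 0).
Proof.
apply/matrixP => i j; rewrite (ord1 j) mxE.
by case: i => -[|[|//]] p /=; congr (x _ _); exact: val_inj.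
Qed.

Lemma cayley0 f g : cayley f g 0 0 <-> bv f g 0 0 0 0.
Proof.
have i0 : 'i%R != 0 :> C by rewrite imaginaryE eq_complex /= oner_eq0 andbF.
split=> [[ya [ua [yb [ub [h x0 y0]]]]]|h]; last first.
  exists 0, 0, 0, 0; split => //; apply/matrixP => i j; rewrite !mxE;
    by case: ifP; rewrite ?oppr0 mulr0 ?subr0 ?addr0.
have sum0 : col2 ua (- ub) = 0.
  have : col2 ua (- ub) + col2 ua (- ub) = 0.
    by rewrite -[RHS]addr0 {1}x0 y0 addrACA subrr addr0.
  move/eqP; rewrite -mulr2n -scaler_nat scaler_eq0 => /orP[|/eqP//].
  by rewrite pnatr_eq0.
have col0 : col2 ya yb = 0.
  by move/eqP: x0; rewrite sum0 add0r eq_sym scaler_eq0 (negbTE i0) => /eqP.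
have e (c d : C) : col2 c d = 0 -> c = 0 /\ d = 0.
  by move=> /matrixP cd; have := cd 0 0; have := cd 1 0; rewrite !mxE.
have [u0 /eqP w0] := e _ _ sum0; have [v0 z0] := e _ _ col0.
rewrite oppr_eq0 in w0; move/eqP: w0 => w0.
by rewrite u0 v0 w0 z0 in h.
Qed.

Lemma col2ZD c (u v u' v' : C) :
  col2 (c * u + u') (c * v + v') = c *: col2 u v + col2 u' v'.
Proof. by apply/matrixP => i j; rewrite !mxE; case: ifP. Qed.

Lemma cayleyZD c f g f' g' x y x' y' : cayley f g x y -> cayley f' g' x' y' ->
  cayley (c *: f + f') (c *: g + g') (c *: x + x') (c *: y + y').
Proof.
move=> [ya [ua [yb [ub [h -> ->]]]]] [ya' [ua' [yb' [ub' [h' -> ->]]]]].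
do 4 eexists; split; first exact: bvZD h h'.
- rewrite opprD -mulrN !col2ZD !scalerDr !scalerA [c * 'i]mulrC addrACA.
  by congr (_ + (_ + _)).
- rewrite opprD -mulrN !col2ZD !scalerDr !scalerN !scalerA [c * 'i]mulrC.
  by rewrite addrACA -opprD.
Qed.

Lemma cayley_im f g x y : cayley f g x y ->
  4 * Im (dot g f) = sqnorm x - sqnorm y.
Proof.
move=> [ya [ua [yb [ub [h -> ->]]]]]; have {h} := bv_green h h.
rewrite (dotC dot f g) => /(congr1 (@complex.Im R)).
rewrite /sqnorm !big_ord_recl !big_ord0 /= !mxE /= imaginaryE !normc_sqr.
case: (dot g f) => d1 d2; case: ya => a1 a2; case: ua => b1 b2.
case: yb => c1 c2; case: ub => e1 e2 /= E.
have {E} : d2 + d2 = c1 * - e2 + c2 * e1 + - (e1 * - c2 + e2 * c1) +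
  - (a1 * - b2 + a2 * b1 + - (b1 * - a2 + b2 * a1)) by lra.
set l := d2 + d2 => E; have -> : 4 * d2 = l + l by rewrite /l; ring.
by rewrite E; ring.
Qed.

Lemma cayley_uniq g x y : cayley 0 g x y -> [/\ x = 0, y = 0 & g = 0].
Proof.
move=> [ya [ua [yb [ub [/bv_uniq[-> -> -> -> ->] -> ->]]]]].
by split => //; apply/matrixP => i j; rewrite !mxE;
  case: ifP; rewrite ?oppr0 mulr0 ?subr0 ?addr0.
Qed.

Lemma cayley_surj x y : exists f g, cayley f g x y.
Proof.
have i0 : 'i%R != 0 :> C by rewrite imaginaryE eq_complex /= oner_eq0 andbF.
have n2 : 2 != 0 :> C by rewrite pnatr_eq0.
pose u := 2^-1 *: (x + y).
have [v iv] : exists v : 'cV[C]_2, 'i%R *: v = 2^-1 *: (x - y).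
  exists ((2 * 'i%R)^-1 *: (x - y)).
  by rewrite scalerA invfM mulrCA mulfV// mulr1.
(* Half the sum of [x] and [y] is [Gamma1], half their difference is ['i] times [Gamma2]; the sign
   in the last argument undoes the one in the second entry of [Gamma1]. *)
have [f [g h]] := bv_surj (v 0 0) (u 0 0) (v 1 0) (- u 1 0).
have [cu cv] := (esym (col2_eta u), esym (col2_eta v)).
have twice (z : 'cV[C]_2) : 2^-1 *: (z + z) = z.
  by rewrite -mulr2n -(scaler_nat 2 z) scalerA mulVf// scale1r.
exists f, g; do 4 eexists; split; first exact: h.
- rewrite opprK cu cv iv -scalerDr.
  by rewrite addrACA subrr addr0 twice.
- rewrite opprK cu cv iv -scalerBr.
  by rewrite opprB [x + y]addrC -addrA [x + (y - x)]addrC subrK twice.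
Qed.

Lemma cayley_adjoint f h :
  (forall v k, cayley v k 0 0 -> dot h v = dot f k) -> exists x y, cayley f h x y.
Proof.
move=> adj; have [v k /cayley0|ya [ua [yb [ub hb]]]] := @bv_adjoint f h.
  exact: adj.
by do 6 eexists; split; first exact: hb.
Qed.

End CayleyTransform.

(** * Transfer of the abstract correspondence to the Sturm-Liouville operators *)

Theorem theorem6 (R : realType) (a b : R) (hab : a < b) (p Q : R -> R)
    (mp : Lebesgue_measurable a b p) (mQ : Lebesgue_measurable a b Q)
    (p_neq0 : {ae (@lebesgue_measure R), forall x, `]a, b[%classic x -> p x != 0})
    (ip : Lebesgue_integrable a b (fun x => (p x)^-1))
    (iQp : Lebesgue_integrable a b (fun x => Q x / p x))
    (iQ2p : Lebesgue_integrable a b (fun x => Q x ^+ 2 / p x)) :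
  [/\ forall K : 'M[R[i]]_2, contracting K ->
        maximal_dissipative_extension (@L2dot R a b)
          (L_min a b p Q) (L_K a b p Q K),
      forall L : set (L2 a b * L2 a b),
        maximal_dissipative_extension (@L2dot R a b) (L_min a b p Q) L ->
        exists2 K : 'M[R[i]]_2, contracting K & L = L_K a b p Q K &
      set_bij [set K : 'M[R[i]]_2 | contracting K]
        [set L | maximal_dissipative_extension (@L2dot R a b)
                   (L_min a b p Q) L]
        (L_K a b p Q)].
Proof.
have [r ir rE] := Lebesgue_integrable_borel ip.
have [s is_ sE] := Lebesgue_integrable_borel iQp.
have [t it tE] := Lebesgue_integrable_borel iQ2p.
have r0 : ae_in a b (fun x => r x != 0).
  by apply: ae_in2 rE p_neq0 => x _ _ ->; rewrite invr_eq0.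
pose bv := @boundary_values R a b r s t; pose dot := @L2dot R a b.
have restrE := L_restrE hab ir is_ it p_neq0 rE sE tE.
have bvZD := @boundary_valuesZD R a b r s t.
have bv0 := @boundary_values0 R a b r s t.
have green := @boundary_values_green R a b hab r s t.
have uniq := @boundary_values_uniq R a b hab r s t r0.
have exists_ := @boundary_values_exists R a b hab r s t ir is_ it.
have surj := boundary_surjective (dot := dot) bvZD bv0 green uniq exists_.
have adj := minimal_adjoint (dot := dot) bvZD bv0 green exists_.
have perp := minimal_domain_orthogonal (dot := dot) bvZD bv0 green uniq exists_.
pose T := cayley bv.
have LminE : L_min a b p Q = minimal_graph T.
  apply/seteqP; split => -[f g].
    move=> /restrE[y [u [sl fy [ya yb ua ub]]]]; apply/cayley0.
    by exists y, u.
  move=> /cayley0 [y [u [sl fy [ya ua yb ub]]]]; apply/restrE.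
  by exists y, u.
have GammaE u y : Gamma1 a b u = col2 (u a) (- u b) /\ Gamma2 a b y = col2 (y a) (y b).
  by [].
have bcE (K : 'M[R[i]]_2) (x y : 'cV[R[i]]_2) :
    (K - 1%:M) *m x + 'i%R *: ((K + 1%:M) *m y) =
    K *m (x + 'i%R *: y) - (x - 'i%R *: y).
  rewrite mulmxBl mulmxDl !mul1mx mulmxDr -scalemxAr scalerDr opprB.
  by rewrite addrACA [- x + _]addrC.
have LKE K : L_K a b p Q K = boundary_graph T K.
  apply/seteqP; split => -[f g].
    move=> /restrE[y [u [sl fy]]]; rewrite bcE => /eqP; rewrite subr_eq0 => /eqP bc.
    do 2 eexists; split; last exact: bc.
    by exists (y a), (u a), (y b), (u b); split => //; exists y, u.
  move=> [x [z [[ya [ua [yb [ub [[y [u [sl fy [e1 e2 e3 e4]]]] xE zE]]]]] Kx]]].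
  apply/restrE; exists y, u; split => //; rewrite bcE.
  by apply/eqP; rewrite subr_eq0; apply/eqP; move: Kx; rewrite xE zE -e1 -e2 -e3 -e4.
have TZD := cayleyZD bvZD.
have T0 : T 0 0 0 0 by apply/cayley0.
have Tim := cayley_im (dot := dot) green.
have Tuniq := cayley_uniq uniq.
have Tsurj := cayley_surj surj.
have Tadj := cayley_adjoint (dot := dot) adj.
have Tdense : densely_defined dot [set fg | T fg.1 fg.2 0 0].
  move=> f e e0.
  have [||h hperp|g [k gk] fg] := orthogonal_dense (dot := dot)
    (@L2_complete R a b) (D := [set f | exists g, bv f g 0 0 0 0]) _ _ _ f e0.
  - by exists 0.
  - move=> c u v [u' hu] [v' hv]; exists (c *: u' + v').
    by have := bvZD c _ _ _ _ _ _ _ _ _ _ _ _ hu hv; rewrite !mulr0 !addr0.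
  - by apply: perp => v k h'; apply: hperp; exists k.
  - by exists g => //; exists k; apply/cayley0.
have maxi K : contracting K -> maximal_dissipative_extension dot
    (L_min a b p Q) (L_K a b p Q K).
  rewrite LminE LKE.
  exact: (boundary_graph_maximal TZD T0 Tim Tuniq Tsurj Tadj Tdense).
have conv L : maximal_dissipative_extension dot (L_min a b p Q) L ->
    exists2 K : 'M[R[i]]_2, contracting K & L = L_K a b p Q K.
  rewrite LminE => /(maximal_dissipative_extension_boundary
    TZD T0 Tim Tuniq Tadj Tdense).
  by move=> [K cK ->]; exists K; rewrite ?LKE.
split; [exact: maxi|exact: conv|split].
- exact: maxi.
- by move=> K K' _ _; rewrite !LKE => /(boundary_graph_inj TZD Tuniq Tsurj).
- by move=> L /conv[K cK ->]; exists K.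
Qed.
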